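(* Let $G$ be a compact Lie group and let $Y$ be a compact metrizable space equipped with a continuous action of $G$. Denote by $\alpha \colon G \to \operatorname{Aut}(C(Y))$ the induced action of $G$ on $C(Y)$. Then $\dim_{\mathrm{Rok}}^{\mathrm{c}}(\alpha) = \mathrm{ind}_G(Y) - 1$.
   Context: Lie groups are not required to be connected; in particular finite groups are compact Lie groups. The induced action is $\alpha_g(f)(y) = f(g^{-1} \cdot y)$. $G$-index: $\mathrm{ind}_G(Y)$ is the least integer $n \geq 1$ such that there exists a $G$-equivariant continuous map from $Y$ to the $n$-fold join $G^{\star n}$ (and $\infty$ if there is no such $n$). Rokhlin dimension with commuting towers. Let $\alpha \colon G \to \operatorname{Aut}(A)$ be a (point-norm continuous) action of a compact group $G$ on a separable $C^*$-algebra $A$. Put $A_\infty = \ell^\infty(A)/c_0(A)$, with $A \subseteq A_\infty$ as (classes of) constant sequences; let $\mathrm{Ann}(A) = \{x \in A_\infty \cap A' : xa = 0 \text{ for all } a \in A\}$ and $F_\infty(A) = (A_\infty \cap A')/\mathrm{Ann}(A)$, a unital $C^*$-algebra (if $A$ is unital, $\mathrm{Ann}(A) = 0$ and $F_\infty(A) = A_\infty \cap A'$). The action $\alpha$ induces an action on $F_\infty(A)$, and $F_\infty^{(\alpha)}(A)$ denotes the subalgebra of elements on which $G$ acts continuously. $\dim_{\mathrm{Rok}}^{\mathrm{c}}(\alpha)$ is the least integer $d \geq 0$ for which there exist $G$-equivariant completely positive contractive order zero maps $\varphi_0, \ldots, \varphi_d \colon C(G) \to F_\infty^{(\alpha)}(A)$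 with pairwise commuting ranges and $\sum_{j=0}^d \varphi_j(1) = 1$, where $G$ acts on $C(G)$ by left translation; it is $\infty$ if no such $d$ exists. Equivalently, $\dim_{\mathrm{Rok}}^{\mathrm{c}}(\alpha) \leq d$ if and only if there is a unital $G$-equivariant homomorphism $C(G^{\star(d+1)}) \to F_\infty^{(\alpha)}(A)$, where $G^{\star k}$ is the $k$-fold join $G \star \cdots \star G$ with the $G$-action induced by left translation. Here the join of compact Hausdorff spaces $X, Y$ is $X \star Y = (X \times Y \times [0,1])/{\sim}$ with $(x,y,0) \sim (x',y,0)$ and $(x,y,1) \sim (x,y',1)$, and if $G$ acts on $X$ and $Y$ then $G$ acts on $X \star Y$ by $g \cdot (x,y,t) = (g\cdot x, g \cdot y, t)$. *)

(* Defs.v *)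
From HB Require Import structures.
From mathcomp Require Import all_boot all_order all_algebra.
From mathcomp Require Import complex ring_quotient.
From mathcomp Require Import all_classical all_reals all_analysis.
From mathcomp Require Import ring lra.

Set Implicit Arguments.
Unset Strict Implicit.
Unset Printing Implicit Defensive.

Import Order.TTheory GRing.Theory Num.Theory numFieldNormedType.Exports.
Import Normc.

Local Open Scope classical_set_scope.
Local Open Scope ring_scope.
Local Open Scope complex_scope.
Local Open Scope quotient_scope.

(* Possibly non-unital complex *-algebras with a seminorm rather than a norm:
   this class is closed under subalgebras and quotients without any closedness
   hypothesis.  C*-algebras are the instances of CStarAlgebra below. *)
HB.mixin Record Lmodule_isStarAlgebra (R : realType) A
    of GRing.Lmodule R[i] A := {
  smul : A -> A -> A;
  star : A -> A;
  snorm : A -> R;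
  smulA : associative smul;
  smulDl : left_distributive smul +%R;
  smulDr : right_distributive smul +%R;
  scale_smull : forall (c : R[i]) (x y : A), c *: smul x y = smul (c *: x) y;
  scale_smulr : forall (c : R[i]) (x y : A), c *: smul x y = smul x (c *: y);
  starK : involutive star;
  starD : {morph star : x y / x + y};
  starZ : forall (c : R[i]) (x : A), star (c *: x) = (c^*)%C *: star x;
  starM : forall x y : A, star (smul x y) = smul (star y) (star x);
  snormD : forall x y : A, snorm (x + y) <= snorm x + snorm y;
  snormZ : forall (c : R[i]) (x : A), snorm (c *: x) = normc c * snorm x;
  snormM : forall x y : A, snorm (smul x y) <= snorm x * snorm y;
  snorm_star : forall x : A, snorm (star x) = snorm x
}.

#[short(type="starAlgType")]
HB.structure Definition StarAlgebra (R : realType) :=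
  { A of GRing.Lmodule R[i] A & Lmodule_isStarAlgebra R A }.

Notation "x ** y" := (smul x y) (at level 40, left associativity) : ring_scope.

HB.mixin Record StarAlgebra_isCStar (R : realType) A of StarAlgebra R A := {
  snorm_eq0 : forall x : A, snorm x = 0 -> x = 0;
  cstar_identity : forall x : A, snorm (star x ** x) = snorm x ^+ 2;
  snorm_complete : forall u : nat -> A,
    (forall e : R, 0 < e -> exists N, forall m n, (N <= m)%N -> (N <= n)%N ->
       snorm (u m - u n) < e) ->
    exists l : A, snorm (u n - l) @[n --> \oo] --> (0 : R)
}.

#[short(type="cstarAlgType")]
HB.structure Definition CStarAlgebra (R : realType) :=
  { A of StarAlgebra R A & StarAlgebra_isCStar R A }.

Section StarAlgebraTheory.
Context {R : realType} {A : starAlgType R}.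
Implicit Types (x y : A) (c : R[i]).

Lemma smul0r x : 0 ** x = 0.
Proof. by apply: (addIr (0 ** x)); rewrite -smulDl !add0r. Qed.

Lemma smulr0 x : x ** 0 = 0.
Proof. by apply: (addIr (x ** 0)); rewrite -smulDr !add0r. Qed.

Lemma smulNr x y : (- x) ** y = - (x ** y).
Proof. by apply/eqP; rewrite -addr_eq0 -smulDl addNr smul0r. Qed.

Lemma smulrN x y : x ** (- y) = - (x ** y).
Proof. by apply/eqP; rewrite -addr_eq0 -smulDr addNr smulr0. Qed.

Lemma smulBl x y z : (x - y) ** z = x ** z - y ** z.
Proof. by rewrite smulDl smulNr. Qed.

Lemma smulBr x y z : z ** (x - y) = z ** x - z ** y.
Proof. by rewrite smulDr smulrN. Qed.

Lemma star0 : star (0 : A) = 0.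
Proof. by apply: (addIr (star 0)); rewrite -starD !add0r. Qed.

Lemma starN x : star (- x) = - star x.
Proof. by apply/eqP; rewrite -addr_eq0 -starD addNr star0. Qed.

Lemma starB x y : star (x - y) = star x - star y.
Proof. by rewrite starD starN. Qed.

Lemma snorm0 : snorm (0 : A) = 0.
Proof. by rewrite -(scale0r (0 : A)) snormZ normc0 mul0r. Qed.

Lemma snormN x : snorm (- x) = snorm x.
Proof. by rewrite -scaleN1r snormZ normcN normc1 mul1r. Qed.

Lemma snorm_ge0 x : 0 <= snorm x.
Proof.
have : 0 <= snorm x + snorm x by rewrite -{2}snormN -snorm0 -(subrr x) snormD.
by rewrite -mulr2n pmulrn_lge0.
Qed.

Lemma snormB x y : snorm (x - y) <= snorm x + snorm y.
Proof. by rewrite -(snormN y) snormD. Qed.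

Lemma snorm_distC x y : snorm (x - y) = snorm (y - x).
Proof. by rewrite -snormN opprB. Qed.

End StarAlgebraTheory.

Lemma le_homogeneous {R : realType} {V : lmodType R[i]} (n : V -> R) :
  (forall x, 0 <= n x) ->
  (forall c x, n (c *: x) <= normc c * n x) ->
  forall c x, n (c *: x) = normc c * n x.
Proof.
move=> n0 nZ c x; apply/eqP; rewrite eq_le nZ /=.
have [->|c0] := eqVneq c 0; first by rewrite normc0 mul0r.
have nc : 0 < normc c.
  by rewrite -ltcR; change (0 < `|c|); rewrite normr_gt0.
rewrite mulrC -ler_pdivlMr// mulrC -normcV.
by apply: le_trans (nZ _ _); rewrite scalerA mulVf// scale1r.
Qed.

Record star_subalg (R : realType) (A : starAlgType R) := StarSubalg {
  subalg_pred :> {pred A};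
  subalg_submod : submod_closed subalg_pred;
  subalgM : {in subalg_pred &, forall x y, x ** y \in subalg_pred};
  subalg_star : {in subalg_pred, forall x, star x \in subalg_pred}
}.

HB.instance Definition _ (R : realType) (A : starAlgType R)
    (S : star_subalg A) := GRing.isSubmodClosed.Build R[i] A (subalg_pred S)
  (GRing.submod_closed_semi (subalg_submod S)).

Record subalg (R : realType) (A : starAlgType R) (S : star_subalg A) :=
  Subalg { subalg_val : A; subalg_valP : subalg_val \in subalg_pred S }.

Section SubalgStructure.
Context {R : realType} {A : starAlgType R} (S : star_subalg A).

HB.instance Definition _ := [isSub for @subalg_val R A S].
HB.instance Definition _ := [Choice of subalg S by <:].
HB.instance Definition _ := [SubChoice_isSubLmodule of subalg S by <:].

Implicit Types (x y : subalg S).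

Definition subalg_mul x y : subalg S :=
  Subalg (subalgM (subalg_valP x) (subalg_valP y)).
Definition subalg_adj x : subalg S := Subalg (subalg_star (subalg_valP x)).
Definition subalg_norm x : R := snorm (subalg_val x).

Fact subalg_mulA : associative subalg_mul.
Proof. by move=> x y z; apply: val_inj; exact: smulA. Qed.
Fact subalg_mulDl : left_distributive subalg_mul +%R.
Proof. by move=> x y z; apply: val_inj; exact: smulDl. Qed.
Fact subalg_mulDr : right_distributive subalg_mul +%R.
Proof. by move=> x y z; apply: val_inj; exact: smulDr. Qed.
Fact subalg_scalel (c : R[i]) x y :
  c *: subalg_mul x y = subalg_mul (c *: x) y.
Proof. by apply: val_inj; exact: scale_smull. Qed.
Fact subalg_scaler (c : R[i]) x y :
  c *: subalg_mul x y = subalg_mul x (c *: y).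
Proof. by apply: val_inj; exact: scale_smulr. Qed.
Fact subalg_adjK : involutive subalg_adj.
Proof. by move=> x; apply: val_inj; exact: starK. Qed.
Fact subalg_adjD : {morph subalg_adj : x y / x + y}.
Proof. by move=> x y; apply: val_inj; exact: starD. Qed.
Fact subalg_adjZ (c : R[i]) x : subalg_adj (c *: x) = (c^*)%C *: subalg_adj x.
Proof. by apply: val_inj; exact: starZ. Qed.
Fact subalg_adjM x y :
  subalg_adj (subalg_mul x y) = subalg_mul (subalg_adj y) (subalg_adj x).
Proof. by apply: val_inj; exact: starM. Qed.
Fact subalg_normD x y :
  subalg_norm (x + y) <= subalg_norm x + subalg_norm y.
Proof. exact: snormD. Qed.
Fact subalg_normZ (c : R[i]) x :
  subalg_norm (c *: x) = normc c * subalg_norm x.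
Proof. exact: snormZ. Qed.
Fact subalg_normM x y :
  subalg_norm (subalg_mul x y) <= subalg_norm x * subalg_norm y.
Proof. exact: snormM. Qed.
Fact subalg_norm_adj x : subalg_norm (subalg_adj x) = subalg_norm x.
Proof. exact: snorm_star. Qed.

HB.instance Definition _ := Lmodule_isStarAlgebra.Build R (subalg S)
  subalg_mulA subalg_mulDl subalg_mulDr subalg_scalel subalg_scaler
  subalg_adjK subalg_adjD subalg_adjZ subalg_adjM
  subalg_normD subalg_normZ subalg_normM subalg_norm_adj.

End SubalgStructure.

Record star_ideal (R : realType) (A : starAlgType R) := StarIdeal {
  ideal_pred :> {pred A};
  ideal_submod : submod_closed ideal_pred;
  ideal_mull : forall a, {in ideal_pred, forall x, a ** x \in ideal_pred};
  ideal_mulr : forall a, {in ideal_pred, forall x, x ** a \in ideal_pred};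
  ideal_star : {in ideal_pred, forall x, star x \in ideal_pred}
}.

HB.instance Definition _ (R : realType) (A : starAlgType R)
    (I : star_ideal A) := GRing.isSubmodClosed.Build R[i] A (ideal_pred I)
  (GRing.submod_closed_semi (ideal_submod I)).

Definition quotalg (R : realType) (A : starAlgType R) (I : star_ideal A) : Type
  := {ideal_quot (ideal_pred I)}.

Section QuotientStructure.
Context {R : realType} {A : starAlgType R} (I : star_ideal A).
Local Notation Q := (quotalg I).

HB.instance Definition _ := GRing.Zmodule.on Q.

Definition quot_pi (x : A) : Q := \pi_{ideal_quot (ideal_pred I)} x.
Definition quot_repr (x : Q) : A := repr (x : {ideal_quot (ideal_pred I)}).

Lemma quot_reprK : cancel quot_repr quot_pi.
Proof. exact: reprK. Qed.

Lemma quot_piP (x y : A) : reflect (quot_pi x = quot_pi y) (x - y \in I).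
Proof. by rewrite Quotient.idealrBE; exact: eqP. Qed.

Lemma quot_piB : {morph quot_pi : x y / x - y}.
Proof. exact: raddfB. Qed.

Lemma quot_piD : {morph quot_pi : x y / x + y}.
Proof. exact: raddfD. Qed.

Lemma quot_pi0 : quot_pi 0 = 0.
Proof. exact: raddf0. Qed.

Lemma quot_ind (P : Q -> Prop) : (forall x, P (quot_pi x)) -> forall x, P x.
Proof. by move=> Ppi x; rewrite -[x]quot_reprK. Qed.

Lemma repr_sub_mem (x : A) : quot_repr (quot_pi x) - x \in I.
Proof. by apply/quot_piP; rewrite quot_reprK. Qed.

Definition quot_scale (c : R[i]) (x : Q) : Q := quot_pi (c *: quot_repr x).
Definition quot_mul (x y : Q) : Q := quot_pi (quot_repr x ** quot_repr y).
Definition quot_adj (x : Q) : Q := quot_pi (star (quot_repr x)).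
Definition quot_norm (x : Q) : R :=
  inf [set snorm y | y in [set y | quot_pi y = x]].

Lemma quot_scaleE c x : quot_scale c (quot_pi x) = quot_pi (c *: x).
Proof. by apply/quot_piP; rewrite -scalerBr rpredZ ?repr_sub_mem. Qed.

Lemma quot_mulE x y : quot_mul (quot_pi x) (quot_pi y) = quot_pi (x ** y).
Proof.
apply/quot_piP; set x' := quot_repr _; set y' := quot_repr _.
rewrite (_ : _ - _ = (x' - x) ** y' + x ** (y' - y)).
  by apply: rpredD; [apply: ideal_mulr|apply: ideal_mull]; exact: repr_sub_mem.
by rewrite smulBl smulBr addrA subrK.
Qed.

Lemma quot_adjE x : quot_adj (quot_pi x) = quot_pi (star x).
Proof. by apply/quot_piP; rewrite -starB; apply: ideal_star; exact: repr_sub_mem. Qed.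

Let scalerA c d (x : Q) : quot_scale c (quot_scale d x) = quot_scale (c * d) x.
Proof. by elim/quot_ind: x => x; rewrite !quot_scaleE scalerA. Qed.
Let scale1r : left_id 1 quot_scale.
Proof. by elim/quot_ind=> x; rewrite quot_scaleE scale1r. Qed.
Let scalerDr : right_distributive quot_scale +%R.
Proof.
move=> c; elim/quot_ind=> x; elim/quot_ind=> y.
by rewrite -quot_piD !quot_scaleE scalerDr quot_piD.
Qed.
Let scalerDl (v : Q) : {morph quot_scale^~ v : a b / a + b}.
Proof.
by elim/quot_ind: v => v a b; rewrite !quot_scaleE scalerDl quot_piD.
Qed.

HB.instance Definition _ := GRing.Zmodule_isLmodule.Build R[i] Q
  scalerA scale1r scalerDr scalerDl.

Lemma quot_piZ c x : quot_pi (c *: x) = c *: quot_pi x.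
Proof. by rewrite -quot_scaleE. Qed.

Fact quot_norm_has_inf (x : Q) :
  has_inf [set snorm y | y in [set y | quot_pi y = x]].
Proof.
split; first by exists (snorm (quot_repr x)), (quot_repr x) => //; exact: quot_reprK.
by exists 0 => _ [y _ <-]; exact: snorm_ge0.
Qed.

Fact quot_norm_ge0 (x : Q) : 0 <= quot_norm x.
Proof.
apply: lb_le_inf; first exact: (quot_norm_has_inf x).1.
by move=> _ [y _ <-]; exact: snorm_ge0.
Qed.

Lemma quot_norm_le (x : A) : quot_norm (quot_pi x) <= snorm x.
Proof. by apply: ge_inf; [exact: (quot_norm_has_inf _).2|exists x]. Qed.

Fact le_quot_norm (a k : R) (x : Q) : 0 <= k ->
  (forall y, quot_pi y = x -> a <= k * snorm y) -> a <= k * quot_norm x.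
Proof.
rewrite le_eqVlt => /predU1P[<-|k0] h.
  by rewrite mul0r -(mul0r (snorm (quot_repr x))) h// quot_reprK.
rewrite mulrC -ler_pdivrMr//; apply: lb_le_inf; first exact: (quot_norm_has_inf x).1.
by move=> _ [y yx <-]; rewrite ler_pdivrMr// mulrC h.
Qed.

Fact quot_mulA : associative quot_mul.
Proof.
elim/quot_ind=> x; elim/quot_ind=> y; elim/quot_ind=> z.
by rewrite !quot_mulE smulA.
Qed.
Fact quot_mulDl : left_distributive quot_mul +%R.
Proof.
elim/quot_ind=> x; elim/quot_ind=> y; elim/quot_ind=> z.
by rewrite -quot_piD !quot_mulE smulDl quot_piD.
Qed.
Fact quot_mulDr : right_distributive quot_mul +%R.
Proof.
elim/quot_ind=> x; elim/quot_ind=> y; elim/quot_ind=> z.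
by rewrite -quot_piD !quot_mulE smulDr quot_piD.
Qed.
Fact quot_scalel (c : R[i]) (x y : Q) :
  c *: quot_mul x y = quot_mul (c *: x) y.
Proof.
elim/quot_ind: x => x; elim/quot_ind: y => y.
by rewrite quot_mulE -!quot_piZ quot_mulE scale_smull.
Qed.
Fact quot_scaler (c : R[i]) (x y : Q) :
  c *: quot_mul x y = quot_mul x (c *: y).
Proof.
elim/quot_ind: x => x; elim/quot_ind: y => y.
by rewrite quot_mulE -!quot_piZ quot_mulE scale_smulr.
Qed.
Fact quot_adjK : involutive quot_adj.
Proof. by elim/quot_ind=> x; rewrite !quot_adjE starK. Qed.
Fact quot_adjD : {morph quot_adj : x y / x + y}.
Proof.
elim/quot_ind=> x; elim/quot_ind=> y.
by rewrite -quot_piD !quot_adjE starD quot_piD.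
Qed.
Fact quot_adjZ (c : R[i]) (x : Q) : quot_adj (c *: x) = (c^*)%C *: quot_adj x.
Proof.
by elim/quot_ind: x => x; rewrite -quot_piZ !quot_adjE starZ quot_piZ.
Qed.
Fact quot_adjM (x y : Q) :
  quot_adj (quot_mul x y) = quot_mul (quot_adj y) (quot_adj x).
Proof.
elim/quot_ind: x => x; elim/quot_ind: y => y.
by rewrite !(quot_mulE, quot_adjE) starM.
Qed.
Fact quot_normD (x y : Q) : quot_norm (x + y) <= quot_norm x + quot_norm y.
Proof.
rewrite -lerBlDr -[leRHS]mul1r; apply: le_quot_norm => // x' <-.
rewrite mul1r lerBlDr -lerBlDl -[leRHS]mul1r.
apply: le_quot_norm => // y' <-; rewrite mul1r lerBlDl.
by rewrite -quot_piD (le_trans (quot_norm_le _))// snormD.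
Qed.
Fact quot_normZ (c : R[i]) (x : Q) : quot_norm (c *: x) = normc c * quot_norm x.
Proof.
apply: le_homogeneous => [|{c x} c x]; first exact: quot_norm_ge0.
apply: le_quot_norm => [|y <-]; first by rewrite -lecR; exact: (normr_ge0 c).
by rewrite -quot_piZ -snormZ quot_norm_le.
Qed.
Fact quot_normM (x y : Q) :
  quot_norm (quot_mul x y) <= quot_norm x * quot_norm y.
Proof.
apply: le_quot_norm => [|y' <-]; first exact: quot_norm_ge0.
rewrite mulrC; apply: le_quot_norm => [|x' <-]; first exact: snorm_ge0.
by rewrite mulrC quot_mulE (le_trans (quot_norm_le _))// snormM.
Qed.
Fact quot_norm_adj (x : Q) : quot_norm (quot_adj x) = quot_norm x.
Proof.
have le (z : Q) : quot_norm (quot_adj z) <= quot_norm z.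
  rewrite -[leRHS]mul1r; apply: le_quot_norm => // z' <-.
  by rewrite mul1r quot_adjE -(snorm_star z') quot_norm_le.
by apply/eqP; rewrite eq_le le -{1}[x]quot_adjK le.
Qed.

HB.instance Definition _ := Lmodule_isStarAlgebra.Build R Q
  quot_mulA quot_mulDl quot_mulDr quot_scalel quot_scaler
  quot_adjK quot_adjD quot_adjZ quot_adjM
  quot_normD quot_normZ quot_normM quot_norm_adj.

End QuotientStructure.

Section SupNorm.
Context {R : realType} {T : Type}.
Implicit Type f : T -> R.

Definition supn f : R := sup (range f).

Lemma le_supn f (t : T) : (exists M, forall t, f t <= M) -> f t <= supn f.
Proof.
move=> [M fM]; apply: ub_le_sup; last by exists t.
by exists M => _ [s _ <-].
Qed.

Lemma supn_le f (c : R) : 0 <= c -> (forall t, f t <= c) -> supn f <= c.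
Proof.
move=> c0 fc; rewrite /supn; have [->|/set0P ne] := eqVneq (range f) set0.
  by rewrite sup0.
by apply: ge_sup => // _ [s _ <-].
Qed.

Lemma supn_ge0 f : (forall t, 0 <= f t) -> 0 <= supn f.
Proof.
move=> f0; rewrite /supn; have [hs|/sup_out->//] := pselect (has_sup (range f)).
have [_ [t _ _]] := hs.1; apply: le_trans (f0 t) _.
by apply: ub_le_sup; [exact: hs.2|exists t].
Qed.

End SupNorm.

Lemma squeeze0 {R : realType} {T : Type} {F : set_system T} {FF : Filter F}
    (f h : T -> R) : (forall t, 0 <= f t) -> (forall t, f t <= h t) ->
  h @ F --> (0 : R) -> f @ F --> (0 : R).
Proof.
move=> f0 fh h0; apply: (squeeze_cvgr _ (cvg_cst _) h0).
by apply: nearW => t; rewrite f0 fh.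
Qed.

Definition bounded_pred (R : realType) (A : starAlgType R) : {pred nat -> A} :=
  fun x => `[< exists M : R, forall n, snorm (x n) <= M >].
Arguments bounded_pred {R A}.

Record linfty (R : realType) (A : starAlgType R) := Linfty {
  linfty_val :> nat -> A;
  linfty_valP : linfty_val \in bounded_pred }.

Section Linfty.
Context {R : realType} {A : starAlgType R}.

Fact bounded_submod : submod_closed (bounded_pred : {pred nat -> A}).
Proof.
split=> [|c x y /asboolP[M xM] /asboolP[N yN]]; apply/asboolP.
  by exists 0 => n; rewrite snorm0.
exists (normc c * M + N) => n; rewrite (le_trans (snormD _ _))// lerD//.
by rewrite snormZ ler_wpM2l// -lecR; exact: (normr_ge0 c).
Qed.

HB.instance Definition _ := GRing.isSubmodClosed.Build R[i] (nat -> A)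
  bounded_pred (GRing.submod_closed_semi bounded_submod).

HB.instance Definition _ := [isSub for @linfty_val R A].
HB.instance Definition _ := [Choice of linfty A by <:].
HB.instance Definition _ := [SubChoice_isSubLmodule of linfty A by <:].

Implicit Types x y : linfty A.

Lemma linfty_bounded x : exists M : R, forall n, snorm (x n) <= M.
Proof. exact/asboolP/(linfty_valP x). Qed.

Fact linfty_mul_subproof x y : (fun n => x n ** y n) \in bounded_pred.
Proof.
have [[M xM] [N yN]] := (linfty_bounded x, linfty_bounded y).
apply/asboolP; exists (M * N) => n; rewrite (le_trans (snormM _ _))//.
by rewrite ler_pM ?snorm_ge0.
Qed.
Fact linfty_adj_subproof x : (fun n => star (x n)) \in bounded_pred.
Proof.
have [M xM] := linfty_bounded x.
by apply/asboolP; exists M => n; rewrite snorm_star.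
Qed.

Definition linfty_mul x y : linfty A := Linfty (linfty_mul_subproof x y).
Definition linfty_adj x : linfty A := Linfty (linfty_adj_subproof x).
Definition linfty_norm x : R := supn (fun n => snorm (x n)).

Lemma le_linfty_norm x n : snorm (x n) <= linfty_norm x.
Proof. exact: (le_supn _ (linfty_bounded x)). Qed.

Fact linfty_norm_ge0 x : 0 <= linfty_norm x.
Proof. by apply: supn_ge0 => n; exact: snorm_ge0. Qed.

Fact linfty_mulA : associative linfty_mul.
Proof. by move=> x y z; apply/val_inj/funext => n; exact: smulA. Qed.
Fact linfty_mulDl : left_distributive linfty_mul +%R.
Proof. by move=> x y z; apply/val_inj/funext => n; exact: smulDl. Qed.
Fact linfty_mulDr : right_distributive linfty_mul +%R.
Proof. by move=> x y z; apply/val_inj/funext => n; exact: smulDr. Qed.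
Fact linfty_scalel (c : R[i]) x y :
  c *: linfty_mul x y = linfty_mul (c *: x) y.
Proof. by apply/val_inj/funext => n; exact: scale_smull. Qed.
Fact linfty_scaler (c : R[i]) x y :
  c *: linfty_mul x y = linfty_mul x (c *: y).
Proof. by apply/val_inj/funext => n; exact: scale_smulr. Qed.
Fact linfty_adjK : involutive linfty_adj.
Proof. by move=> x; apply/val_inj/funext => n; exact: starK. Qed.
Fact linfty_adjD : {morph linfty_adj : x y / x + y}.
Proof. by move=> x y; apply/val_inj/funext => n; exact: starD. Qed.
Fact linfty_adjZ (c : R[i]) x : linfty_adj (c *: x) = (c^*)%C *: linfty_adj x.
Proof. by apply/val_inj/funext => n; exact: starZ. Qed.
Fact linfty_adjM x y :
  linfty_adj (linfty_mul x y) = linfty_mul (linfty_adj y) (linfty_adj x).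
Proof. by apply/val_inj/funext => n; exact: starM. Qed.
Fact linfty_normD x y : linfty_norm (x + y) <= linfty_norm x + linfty_norm y.
Proof.
apply: supn_le => [|n]; first by rewrite addr_ge0 ?linfty_norm_ge0.
by rewrite (le_trans (snormD _ _))// lerD ?le_linfty_norm.
Qed.
Fact linfty_normZ (c : R[i]) x : linfty_norm (c *: x) = normc c * linfty_norm x.
Proof.
apply: le_homogeneous => [|{c x} c x]; first exact: linfty_norm_ge0.
have c0 : 0 <= normc c by rewrite -lecR; exact: (normr_ge0 c).
apply: supn_le => [|n]; first by rewrite mulr_ge0 ?linfty_norm_ge0.
by rewrite snormZ ler_wpM2l ?le_linfty_norm.
Qed.
Fact linfty_normM x y :
  linfty_norm (linfty_mul x y) <= linfty_norm x * linfty_norm y.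
Proof.
apply: supn_le => [|n]; first by rewrite mulr_ge0 ?linfty_norm_ge0.
by rewrite (le_trans (snormM _ _))// ler_pM ?snorm_ge0 ?le_linfty_norm.
Qed.
Fact linfty_norm_adj x : linfty_norm (linfty_adj x) = linfty_norm x.
Proof. by congr sup; congr image; apply/funext => n; exact: snorm_star. Qed.

HB.instance Definition _ := Lmodule_isStarAlgebra.Build R (linfty A)
  linfty_mulA linfty_mulDl linfty_mulDr linfty_scalel linfty_scaler
  linfty_adjK linfty_adjD linfty_adjZ linfty_adjM
  linfty_normD linfty_normZ linfty_normM linfty_norm_adj.

Definition c0_pred : {pred linfty A} :=
  fun x => `[< snorm (x n) @[n --> \oo] --> (0 : R) >].

Fact c0_submod : submod_closed c0_pred.
Proof.
split=> [|c x y /asboolP x0 /asboolP y0]; apply/asboolP.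
  have -> : (fun n => snorm ((0 : linfty A) n)) = cst 0.
    by apply/funext => n; exact: snorm0.
  exact: cvg_cst.
apply: (@squeeze0 _ _ _ _ _ (fun n => normc c * snorm (x n) + snorm (y n))).
- by move=> n; exact: snorm_ge0.
- by move=> n; rewrite -snormZ; exact: snormD.
- rewrite -[0 in X in _ --> X](addr0 0) -[in X in _ --> (X + _)](mulr0 (normc c)).
  by apply: cvgD => //; exact: cvgMr.
Qed.
Fact c0_mull a : {in c0_pred, forall x, a ** x \in c0_pred}.
Proof.
move=> x /asboolP x0; apply/asboolP.
apply: (@squeeze0 _ _ _ _ _ (fun n => linfty_norm a * snorm (x n))).
- by move=> n; exact: snorm_ge0.
- move=> n; apply: (le_trans (snormM _ _)).
  by rewrite ler_wpM2r ?snorm_ge0 ?le_linfty_norm.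
- by rewrite -[0 in X in _ --> X](mulr0 (linfty_norm a)); exact: cvgMr.
Qed.
Fact c0_mulr a : {in c0_pred, forall x, x ** a \in c0_pred}.
Proof.
move=> x /asboolP x0; apply/asboolP.
apply: (@squeeze0 _ _ _ _ _ (fun n => linfty_norm a * snorm (x n))).
- by move=> n; exact: snorm_ge0.
- move=> n; apply: (le_trans (snormM _ _)).
  by rewrite mulrC ler_wpM2r ?snorm_ge0 ?le_linfty_norm.
- by rewrite -[0 in X in _ --> X](mulr0 (linfty_norm a)); exact: cvgMr.
Qed.
Fact c0_star : {in c0_pred, forall x, star x \in c0_pred}.
Proof.
move=> x /asboolP x0; apply/asboolP.
have -> : (fun n => snorm ((star x) n)) = (fun n => snorm (x n)).
  by apply/funext => n; exact: snorm_star.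
exact: x0.
Qed.

Definition c0 : star_ideal (linfty A) :=
  StarIdeal c0_submod c0_mull c0_mulr c0_star.

Fact const_bounded (a : A) : (fun=> a) \in bounded_pred.
Proof. by apply/asboolP; exists (snorm a). Qed.

Definition const_seq (a : A) : linfty A := Linfty (const_bounded a).

End Linfty.
Arguments c0 {R} A.

Section CentralSequenceAlgebra.
Context {R : realType} (A : starAlgType R).

Definition Ainf : starAlgType R := quotalg (c0 A).

Definition Ainf_const (a : A) : Ainf := quot_pi (c0 A) (const_seq a).

Lemma Ainf_const_star a : star (Ainf_const a) = Ainf_const (star a).
Proof.
rewrite /Ainf_const [LHS]quot_adjE; congr quot_pi.
by apply/val_inj/funext.
Qed.

Definition commutant_pred : {pred Ainf} :=
  fun x => `[< forall a, x ** Ainf_const a = Ainf_const a ** x >].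

Fact commutant_submod : submod_closed commutant_pred.
Proof.
split=> [|c x y /asboolP xC /asboolP yC]; apply/asboolP => a.
  by rewrite smul0r smulr0.
by rewrite smulDl smulDr -scale_smull -scale_smulr xC yC.
Qed.
Fact commutantM :
  {in commutant_pred &, forall x y, x ** y \in commutant_pred}.
Proof.
move=> x y /asboolP xC /asboolP yC; apply/asboolP => a.
by rewrite -smulA yC smulA xC smulA.
Qed.
Fact commutant_star : {in commutant_pred, forall x, star x \in commutant_pred}.
Proof.
move=> x /asboolP xC; apply/asboolP => a.
by rewrite -[a]starK -Ainf_const_star -!starM xC.
Qed.

Definition commutant : star_subalg Ainf :=
  StarSubalg commutant_submod commutantM commutant_star.

Definition annihilator_pred : {pred subalg commutant} :=
  fun x => `[< forall a, val x ** Ainf_const a = 0 >].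

Fact annihilator_submod : submod_closed annihilator_pred.
Proof.
split=> [|c x y /asboolP xA /asboolP yA]; apply/asboolP => a.
  by rewrite raddf0 smul0r.
by rewrite linearP smulDl -scale_smull xA yA scaler0 addr0.
Qed.
Fact annihilator_mull x :
  {in annihilator_pred, forall y, x ** y \in annihilator_pred}.
Proof.
move=> y /asboolP yA; apply/asboolP => a.
by rewrite -[LHS]smulA yA smulr0.
Qed.
Fact annihilator_mulr x :
  {in annihilator_pred, forall y, y ** x \in annihilator_pred}.
Proof.
move=> y /asboolP yA; apply/asboolP => a; rewrite -[LHS]smulA.
by have /asboolP -> := subalg_valP x; rewrite smulA yA smul0r.
Qed.
Fact annihilator_star :
  {in annihilator_pred, forall y, star y \in annihilator_pred}.
Proof.
move=> y /asboolP yA; apply/asboolP => a; rewrite -[a]starK -Ainf_const_star.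
have /asboolP yC := subalg_valP y.
by rewrite -[LHS]starM -yC yA star0.
Qed.

Definition annihilator : star_ideal (subalg commutant) :=
  StarIdeal annihilator_submod annihilator_mull annihilator_mulr
    annihilator_star.

Definition Finf : starAlgType R := quotalg annihilator.

End CentralSequenceAlgebra.

HB.mixin Record Topological_Group_isTopGroup G of Topological G & Group G := {
  mulg_continuous : continuous (fun p : G * G => (p.1 * p.2)%g);
  invg_continuous : continuous (fun x : G => (x^-1)%g)
}.

#[short(type="topGroupType")]
HB.structure Definition TopGroup :=
  { G of Topological G & Group G & Topological_Group_isTopGroup G }.

(* Actions by isometric *-automorphisms; for C*-algebras the isometry
   condition is automatic. *)
Record alg_action (R : realType) (G : groupType) (A : starAlgType R) :=
  AlgAction {
  act_fun :> G -> A -> A;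
  act_lin : forall g (c : R[i]) x y,
    act_fun g (c *: x + y) = c *: act_fun g x + act_fun g y;
  act_mul : forall g x y, act_fun g (x ** y) = act_fun g x ** act_fun g y;
  act_star : forall g x, act_fun g (star x) = star (act_fun g x);
  act_norm : forall g x, snorm (act_fun g x) = snorm x;
  act_one : forall x, act_fun 1%g x = x;
  act_comp : forall g h x, act_fun (g * h)%g x = act_fun g (act_fun h x)
}.

Record cstar_action (R : realType) (G : topGroupType) (A : cstarAlgType R) :=
  CStarAction {
  cstar_act :> alg_action G A;
  cstar_act_cont : forall (a : A) (g0 : G),
    snorm (cstar_act g a - cstar_act g0 a) @[g --> g0] --> (0 : R)
}.

Section ActionTheory.
Context {R : realType} {G : groupType} {A : starAlgType R}.
Variable b : alg_action G A.
Implicit Types (g h : G).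

Lemma actD g x y : b g (x + y) = b g x + b g y.
Proof. by rewrite -[x]scale1r act_lin !scale1r. Qed.

Lemma act0 g : b g 0 = 0.
Proof. by apply: (addIr (b g 0)); rewrite -actD !add0r. Qed.

Lemma actZ g c x : b g (c *: x) = c *: b g x.
Proof. by rewrite -[c *: x]addr0 act_lin act0 addr0. Qed.

Lemma actB g x y : b g (x - y) = b g x - b g y.
Proof. by rewrite actD -scaleN1r actZ scaleN1r. Qed.

Lemma actVK g : cancel (b (g^-1)%g) (b g).
Proof. by move=> x; rewrite -act_comp mulgV act_one. Qed.

Section Sub.
Variable (S : star_subalg A).
Hypothesis bS : forall g, {in subalg_pred S, forall x, b g x \in subalg_pred S}.

Definition sub_act_fun g (x : subalg S) : subalg S :=
  Subalg (bS g (subalg_valP x)).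

Definition sub_act : alg_action G (subalg S).
Proof.
apply: (@AlgAction _ _ _ sub_act_fun).
- by move=> *; apply: val_inj; exact: act_lin.
- by move=> *; apply: val_inj; exact: act_mul.
- by move=> *; apply: val_inj; exact: act_star.
- by move=> *; exact: act_norm.
- by move=> *; apply: val_inj; exact: act_one.
- by move=> *; apply: val_inj; exact: act_comp.
Defined.

End Sub.

Section Quot.
Variable (I : star_ideal A).
Hypothesis bI : forall g, {in ideal_pred I, forall x, b g x \in ideal_pred I}.

Definition quot_act_fun g (x : quotalg I) : quotalg I :=
  quot_pi I (b g (quot_repr x)).

Lemma quot_act_funE g (x : A) : quot_act_fun g (quot_pi I x) = quot_pi I (b g x).
Proof. by apply/quot_piP; rewrite -actB; apply/bI/repr_sub_mem. Qed.

Definition quot_act : alg_action G (quotalg I).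
Proof.
apply: (@AlgAction _ _ _ quot_act_fun).
- move=> g c; elim/(@quot_ind R A I)=> x; elim/(@quot_ind R A I)=> y.
  by rewrite -quot_piZ -quot_piD !quot_act_funE act_lin quot_piD quot_piZ.
- move=> g; elim/(@quot_ind R A I)=> x; elim/(@quot_ind R A I)=> y.
  by rewrite [_ ** _]quot_mulE !quot_act_funE act_mul [RHS]quot_mulE.
- move=> g; elim/(@quot_ind R A I)=> x.
  by rewrite [star _]quot_adjE !quot_act_funE act_star [RHS]quot_adjE.
- have act1 x : quot_act_fun 1%g x = x.
    by elim/(@quot_ind R A I): x => x; rewrite quot_act_funE act_one.
  have actM g h x : quot_act_fun (g * h)%g x = quot_act_fun g (quot_act_fun h x).
    by elim/(@quot_ind R A I): x => x; rewrite !quot_act_funE act_comp.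
  have le g x : snorm (quot_act_fun g x) <= snorm x.
    rewrite -[leRHS]mul1r; apply: le_quot_norm => // y <-.
    by rewrite mul1r quot_act_funE -(act_norm b g y) quot_norm_le.
  move=> g x; apply/eqP; rewrite eq_le le /=.
  by rewrite -{1}[x]act1 -(mulVg g) actM le.
- by elim/(@quot_ind R A I)=> x; rewrite quot_act_funE act_one.
- by move=> g h; elim/(@quot_ind R A I)=> x; rewrite !quot_act_funE act_comp.
Defined.

End Quot.

End ActionTheory.

Section InducedActions.
Context {R : realType} {G : groupType} {A : starAlgType R}.
Variable b : alg_action G A.
Implicit Types (g h : G).

Fact linfty_act_subproof g (x : linfty A) : (fun n => b g (x n)) \in bounded_pred.
Proof.
have [M xM] := linfty_bounded x.
by apply/asboolP; exists M => n; rewrite act_norm.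
Qed.

Definition linfty_act : alg_action G (linfty A).
Proof.
apply: (@AlgAction _ _ _ (fun g x => Linfty (linfty_act_subproof g x))).
- by move=> *; apply/val_inj/funext => n; exact: act_lin.
- by move=> *; apply/val_inj/funext => n; exact: act_mul.
- by move=> *; apply/val_inj/funext => n; exact: act_star.
- by move=> g x; congr sup; congr image; apply/funext => n; exact: act_norm.
- by move=> *; apply/val_inj/funext => n; exact: act_one.
- by move=> *; apply/val_inj/funext => n; exact: act_comp.
Defined.

Fact c0_act g : {in c0 A, forall x, linfty_act g x \in c0 A}.
Proof.
move=> x /asboolP x0; apply/asboolP.
have -> : (fun n => snorm (linfty_act g x n)) = (fun n => snorm (x n)).
  by apply/funext => n; exact: act_norm.
exact: x0.
Qed.

Definition Ainf_act : alg_action G (Ainf A) := quot_act c0_act.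

Lemma Ainf_act_const g a : Ainf_act g (Ainf_const a) = Ainf_const (b g a).
Proof.
rewrite [LHS](quot_act_funE c0_act) /Ainf_const; congr quot_pi.
exact: val_inj.
Qed.

Fact commutant_act g : {in commutant A, forall x, Ainf_act g x \in commutant A}.
Proof.
move=> x /asboolP xC; apply/asboolP => a.
by rewrite -[a](actVK b g) -Ainf_act_const -!act_mul xC.
Qed.

Definition central_act : alg_action G (subalg (commutant A)) :=
  sub_act commutant_act.

Fact annihilator_act g :
  {in annihilator A, forall x, central_act g x \in annihilator A}.
Proof.
move=> x /asboolP xA; apply/asboolP => a.
by rewrite -[a](actVK b g) -Ainf_act_const -[LHS]act_mul xA; exact: act0.
Qed.

Definition Finf_act : alg_action G (Finf A) := quot_act annihilator_act.

End InducedActions.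

Section ContinuousPart.
Context {R : realType} {G : topGroupType} {B : starAlgType R}.
Variable b : alg_action G B.

Definition continuous_pred : {pred B} := fun x =>
  `[< forall g0 : G, snorm (b g x - b g0 x) @[g --> g0] --> (0 : R) >].

Fact continuous_submod : submod_closed continuous_pred.
Proof.
split=> [|c x y /asboolP xc /asboolP yc]; apply/asboolP => g0.
  have -> : (fun g : G => snorm (b g 0 - b g0 0)) = cst 0.
    by apply/funext => g; rewrite !act0 subrr snorm0.
  exact: cvg_cst.
apply: (@squeeze0 _ _ _ _ _
  (fun g => normc c * snorm (b g x - b g0 x) + snorm (b g y - b g0 y))).
- by move=> g; exact: snorm_ge0.
- move=> g; rewrite -snormZ scalerBr !act_lin opprD addrACA.
  exact: snormD.
- rewrite -[0 in X in _ --> X](addr0 0) -[in X in _ --> (X + _)](mulr0 (normc c)).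
  by apply: cvgD => //; exact: cvgMr.
Qed.
Fact continuousM_pred :
  {in continuous_pred &, forall x y, x ** y \in continuous_pred}.
Proof.
move=> x y /asboolP xc /asboolP yc; apply/asboolP => g0.
apply: (@squeeze0 _ _ _ _ _
  (fun g => snorm y * snorm (b g x - b g0 x) +
            snorm x * snorm (b g y - b g0 y))).
- by move=> g; exact: snorm_ge0.
- move=> g; have -> : b g (x ** y) - b g0 (x ** y) =
      (b g x - b g0 x) ** b g y + b g0 x ** (b g y - b g0 y).
    by rewrite !act_mul smulBl smulBr addrA subrK.
  apply: (le_trans (snormD _ _)); apply: lerD.
    by rewrite -(act_norm b g y) mulrC; exact: snormM.
  by rewrite -(act_norm b g0 x); exact: snormM.
- rewrite -[0 in X in _ --> X](addr0 0).
  rewrite -[in X in _ --> (X + _)](mulr0 (snorm y)).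
  rewrite -[in X in _ --> (_ + X)](mulr0 (snorm x)).
  by apply: cvgD; exact: cvgMr.
Qed.
Fact continuous_star :
  {in continuous_pred, forall x, star x \in continuous_pred}.
Proof.
move=> x /asboolP xc; apply/asboolP => g0.
have -> : (fun g => snorm (b g (star x) - b g0 (star x))) =
          (fun g => snorm (b g x - b g0 x)).
  by apply/funext => g; rewrite !act_star -starB snorm_star.
exact: xc.
Qed.

Definition continuous_part : star_subalg B :=
  StarSubalg continuous_submod continuousM_pred continuous_star.

Fact continuous_part_act g :
  {in continuous_part, forall x, b g x \in continuous_part}.
Proof.
move=> x /asboolP xc; apply/asboolP => g0.
have -> : (fun h => snorm (b h (b g x) - b g0 (b g x))) =
    (fun h => snorm (b h x - b (g0 * g)%g x)) \o (fun h => h * g)%g.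
  by apply/funext => h /=; rewrite !act_comp.
apply: (@cvg_comp _ _ _ (fun h => h * g)%g _ _ (nbhs (g0 * g)%g)); last exact: xc.
apply: (@cvg_comp _ _ _ (fun h : G => (h, g)) (fun p => (p.1 * p.2)%g)
  _ (nbhs (g0, g))); last exact: (@mulg_continuous G (g0, g)).
by apply: cvg_pair; [exact: cvg_id|exact: cvg_cst].
Qed.

Definition continuous_part_action : alg_action G (subalg continuous_part) :=
  sub_act continuous_part_act.

End ContinuousPart.

Section CompletelyPositive.
Context {R : realType}.

(* The positive elements of a C*-algebra are those of the form y^* y; for
   M_n(A) this is X = Y^* Y entrywise. *)
Definition mx_positive (A : starAlgType R) n (X : 'M[A]_n) : Prop :=
  exists Y : 'M[A]_n, forall i j, X i j = \sum_k star (Y k i) ** Y k j.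

Definition positive (A : starAlgType R) (a : A) : Prop :=
  exists y, a = star y ** y.

Definition completely_positive (A B : starAlgType R) (f : A -> B) : Prop :=
  forall n (X : 'M[A]_n), mx_positive X -> mx_positive (map_mx f X).

Definition contractive (A B : starAlgType R) (f : A -> B) : Prop :=
  forall a, snorm (f a) <= snorm a.

Definition order_zero (A B : starAlgType R) (f : A -> B) : Prop :=
  forall a b, positive a -> positive b -> a ** b = 0 -> f a ** f b = 0.

Definition is_identity (A : starAlgType R) (e : A) : Prop :=
  forall x, e ** x = x /\ x ** e = x.

Definition equivariant (G : groupType) (A B : starAlgType R)
    (a : alg_action G A) (b : alg_action G B) (f : A -> B) : Prop :=
  forall g x, f (a g x) = b g (f x).

End CompletelyPositive.

Definition least_nat (R : realType) (P : nat -> Prop) : \bar R :=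
  if pselect (exists n, `[< P n >]) is left exP then (ex_minn exP)%:R%:E
  else +oo%E.

Section Complex.
Context {R : realType}.
Implicit Types (z w : R[i]) (e : R).

Lemma normc_ge0 z : 0 <= normc z.
Proof. by rewrite -lecR; exact: (@normr_ge0 _ R[i] z). Qed.

Lemma normc_conj z : normc (z^*)%C = normc z.
Proof. by apply: complexI; exact: (normcJ z). Qed.

Lemma normc_distC z w : normc (z - w) = normc (w - z).
Proof. by rewrite -normcN opprB. Qed.

Lemma normc_conjM z : normc ((z^*)%C * z) = normc z ^+ 2.
Proof. by rewrite normcM normc_conj expr2. Qed.

Lemma normc_i : normc ('i%C : R[i]) = 1.
Proof. by rewrite /normc /= expr0n add0r expr1n sqrtr1. Qed.

Lemma complex_continuousP (Y : topologicalType) (f : Y -> R[i]^o) (y : Y) :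
  {for y, continuous f} <->
  forall e, 0 < e -> \forall y' \near y, normc (f y - f y') < e.
Proof.
split=> [/cvgrPdist_lt fc e e0|fc].
  have /fc : 0 < e%:C by rewrite ltcR.
  by apply: filterS => y'; rewrite -ltcR.
apply/cvgrPdist_lt => -[e e'] /=; rewrite ltcE /= => /andP[/eqP -> e0].
by apply: filterS (fc e e0) => y'; rewrite -ltcR.
Qed.

Lemma complex_complete (u : nat -> R[i]) :
  (forall e, 0 < e -> exists N, forall m n, (N <= m)%N -> (N <= n)%N ->
    normc (u m - u n) < e) ->
  exists l, forall e, 0 < e -> \forall n \near \oo, normc (u n - l) < e.
Proof.
move=> uC.
have leRe z : `|complex.Re z| <= normc z by rewrite -lecR; exact: (normc_ge_Re z).
have leIm z : `|complex.Im z| <= normc z.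
  rewrite -normrN -ReiNIm (le_trans (leRe _))// normcM.
  by rewrite normc_i mulr1.
have cvgR (v : nat -> R) : (forall m n, `|v m - v n| <= normc (u m - u n)) ->
    cvg (v @ \oo).
  move=> vu; apply/cauchy_cvgP/cauchy_ballP => e e0; near_simpl.
  have [N uN] := uC e e0.
  exists ([set n | (N <= n)%N], [set n | (N <= n)%N]).
    by split; exists N.
  by move=> [m n] [/= Nm Nn]; rewrite /ball/= (le_lt_trans (vu _ _))// uN.
have /cvg_ex[a ua] : cvg ((fun n => complex.Re (u n)) @ \oo).
  apply: cvgR => m n; apply: le_trans (leRe _).
  by case: (u m) (u n) => [? ?] [? ?].
have /cvg_ex[b ub] : cvg ((fun n => complex.Im (u n)) @ \oo).
  apply: cvgR => m n; apply: le_trans (leIm _).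
  by case: (u m) (u n) => [? ?] [? ?].
exists (a +i* b) => e e0.
have e2 : 0 < e / 2 by rewrite divr_gt0.
near=> n.
have -> : u n - (a +i* b) = (complex.Re (u n) - a)%:C + 'i%C * (complex.Im (u n) - b)%:C.
  by rewrite [LHS]complexE; case: (u n).
rewrite (le_lt_trans (le_normcD _ _))// [ltRHS]splitr ltrD//.
  rewrite /normc/= expr0n addr0 sqrtr_sqr distrC; near: n.
  by move/cvgrPdist_lt : ua; apply.
rewrite normcM normc_i mul1r.
rewrite /normc/= expr0n addr0 sqrtr_sqr distrC; near: n.
by move/cvgrPdist_lt : ub; apply.
Unshelve. all: by end_near. Qed.

End Complex.

Definition continuous_fun_pred (R : realType) (Y : topologicalType) :
    {pred Y -> R[i]^o} := fun f => `[< continuous f >].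
Arguments continuous_fun_pred {R Y}.

Record cfun (R : realType) (Y : topologicalType) (cY : compact [set: Y]) :=
  Cfun {
  cfun_val :> Y -> R[i]^o;
  cfun_valP : cfun_val \in continuous_fun_pred }.
Arguments cfun R {Y} cY.

Section ContinuousFunctions.
Context {R : realType} {Y : topologicalType} {cY : compact [set: Y]}.
Local Notation CY := (cfun R cY).

Fact continuous_fun_submod :
  submod_closed (continuous_fun_pred : {pred Y -> R[i]^o}).
Proof.
split=> [|c f h /asboolP fc /asboolP hc]; apply/asboolP => y.
  exact: cvg_cst.
apply: (@cvgD _ R[i]^o); last exact: hc.
by apply: (@cvgZr _ R[i]^o); exact: fc.
Qed.

HB.instance Definition _ := GRing.isSubmodClosed.Build R[i] (Y -> R[i]^o)
  continuous_fun_pred (GRing.submod_closed_semi continuous_fun_submod).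

HB.instance Definition _ := [isSub for @cfun_val R Y cY].
HB.instance Definition _ := [Choice of CY by <:].
HB.instance Definition _ := [SubChoice_isSubLmodule of CY by <:].

Implicit Types f h : CY.

Lemma cfun_continuous f : continuous f.
Proof. exact/asboolP/(cfun_valP f). Qed.

Lemma cfun_near f y (e : R) : 0 < e -> \forall y' \near y, normc (f y - f y') < e.
Proof. exact: ((complex_continuousP f y).1 (@cfun_continuous f y) e). Qed.

Lemma cfun_bounded f : exists M : R, forall y, normc (f y) <= M.
Proof.
have := (@compact_near_coveringP Y setT).1 cY R (pinfty_nbhs R)
  (fun M y => normc (f y) <= M) _.
case=> [y _|M [_ Mf]].
  exists ([set y' | normc (f y - f y') < 1], [set M | normc (f y) + 1 < M]).
    split; first exact: cfun_near.
    by exists (normc (f y) + 1); split => //; exact: num_real.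
  move=> [y' M] /= [yy' yM].
  apply: le_trans (ltW yM).
  have -> : f y' = f y - (f y - f y') by rewrite opprB addrC subrK.
  by rewrite (le_trans (le_normcD _ _))// normcN lerD2l ltW.
by exists (M + 1) => y; apply: Mf => //; rewrite ltrDl.
Qed.

Fact cfun_mul_subproof f h : (fun y => f y * h y) \in continuous_fun_pred.
Proof.
apply/asboolP => y; apply: (@cvgM R[i]); exact: cfun_continuous.
Qed.
Fact cfun_adj_subproof f : (fun y => (f y)^*%C) \in continuous_fun_pred.
Proof.
apply/asboolP => y; apply/complex_continuousP => e e0.
apply: filterS (cfun_near f y e0) => y'.
by rewrite -rmorphB/= normc_conj.
Qed.
Fact cfun_one_subproof : (fun=> 1) \in @continuous_fun_pred R Y.
Proof. by apply/asboolP => y; exact: cvg_cst. Qed.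

Definition cfun_mul f h : CY := Cfun cY (cfun_mul_subproof f h).
Definition cfun_adj f : CY := Cfun cY (cfun_adj_subproof f).
Definition cfun_one : CY := Cfun cY cfun_one_subproof.
Definition cfun_norm f : R := supn (fun y => normc (f y)).

Lemma le_cfun_norm f y : normc (f y) <= cfun_norm f.
Proof. exact: (le_supn _ (cfun_bounded f)). Qed.

Fact cfun_norm_ge0 f : 0 <= cfun_norm f.
Proof. by apply: supn_ge0 => y; exact: normc_ge0. Qed.

Fact cfun_mulA : associative cfun_mul.
Proof. by move=> x y z; apply/val_inj/funext => n; exact: mulrA. Qed.
Fact cfun_mulDl : left_distributive cfun_mul +%R.
Proof. by move=> x y z; apply/val_inj/funext => n; exact: mulrDl. Qed.
Fact cfun_mulDr : right_distributive cfun_mul +%R.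
Proof. by move=> x y z; apply/val_inj/funext => n; exact: mulrDr. Qed.
Fact cfun_scalel (c : R[i]) f h :
  c *: cfun_mul f h = cfun_mul (c *: f) h.
Proof. by apply/val_inj/funext => n; exact: mulrA. Qed.
Fact cfun_scaler (c : R[i]) f h :
  c *: cfun_mul f h = cfun_mul f (c *: h).
Proof. by apply/val_inj/funext => n; exact: mulrCA. Qed.
Fact cfun_adjK : involutive cfun_adj.
Proof. by move=> f; apply/val_inj/funext => n; exact: conjcK. Qed.
Fact cfun_adjD : {morph cfun_adj : f h / f + h}.
Proof. by move=> f h; apply/val_inj/funext => n; exact: rmorphD. Qed.
Fact cfun_adjZ (c : R[i]) f : cfun_adj (c *: f) = (c^*)%C *: cfun_adj f.
Proof. by apply/val_inj/funext => n; exact: rmorphM. Qed.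
Fact cfun_adjM f h :
  cfun_adj (cfun_mul f h) = cfun_mul (cfun_adj h) (cfun_adj f).
Proof.
by apply/val_inj/funext => n; rewrite /= [RHS]mulrC; exact: rmorphM.
Qed.
Fact cfun_normD f h : cfun_norm (f + h) <= cfun_norm f + cfun_norm h.
Proof.
apply: supn_le => [|y]; first by rewrite addr_ge0 ?cfun_norm_ge0.
by rewrite (le_trans (le_normcD _ _))// lerD ?le_cfun_norm.
Qed.
Fact cfun_normZ (c : R[i]) f : cfun_norm (c *: f) = normc c * cfun_norm f.
Proof.
apply: le_homogeneous => [|{c f} c f]; first exact: cfun_norm_ge0.
apply: supn_le => [|y]; first by rewrite mulr_ge0 ?normc_ge0 ?cfun_norm_ge0.
by rewrite [_ y](_ : _ = c * f y)// normcM ler_wpM2l ?normc_ge0 ?le_cfun_norm.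
Qed.
Fact cfun_normM f h : cfun_norm (cfun_mul f h) <= cfun_norm f * cfun_norm h.
Proof.
apply: supn_le => [|y]; first by rewrite mulr_ge0 ?cfun_norm_ge0.
by rewrite normcM ler_pM ?normc_ge0 ?le_cfun_norm.
Qed.
Fact cfun_norm_adj f : cfun_norm (cfun_adj f) = cfun_norm f.
Proof. by congr sup; congr image; apply/funext => n; exact: normc_conj. Qed.

HB.instance Definition _ := Lmodule_isStarAlgebra.Build R CY
  cfun_mulA cfun_mulDl cfun_mulDr cfun_scalel cfun_scaler
  cfun_adjK cfun_adjD cfun_adjZ cfun_adjM
  cfun_normD cfun_normZ cfun_normM cfun_norm_adj.

Fact cfun_norm_eq0 f : snorm f = 0 -> f = 0.
Proof.
move=> f0; apply/val_inj/funext => y; apply: eq0_normc.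
by apply/eqP; rewrite eq_le normc_ge0 -f0 andbT; exact: le_cfun_norm.
Qed.

Fact cfun_cstar_identity f : snorm (star f ** f) = snorm f ^+ 2.
Proof.
apply/eqP; rewrite eq_le; apply/andP; split.
  by rewrite (le_trans (snormM _ _))// snorm_star expr2.
rewrite -ler_sqrt ?sqr_ge0 ?snorm_ge0// sqrtr_sqr ger0_norm ?snorm_ge0//.
apply: supn_le => [|y]; first exact: sqrtr_ge0.
rewrite -(ger0_norm (normc_ge0 (f y))) -sqrtr_sqr ler_sqrt ?snorm_ge0//.
by rewrite -normc_conjM; exact: (le_cfun_norm (star f ** f) y).
Qed.

Fact cfun_complete (u : nat -> CY) :
  (forall e : R, 0 < e -> exists N, forall m n, (N <= m)%N -> (N <= n)%N ->
     snorm (u m - u n) < e) ->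
  exists l : CY, snorm (u n - l) @[n --> \oo] --> (0 : R).
Proof.
move=> uC.
have uCy y (e : R) : 0 < e -> exists N, forall m n, (N <= m)%N -> (N <= n)%N ->
    normc (u m y - u n y) < e.
  move=> /uC[N uN]; exists N => m n Nm Nn.
  by apply: le_lt_trans (uN m n Nm Nn); exact: (le_cfun_norm (u m - u n) y).
pose l y := sval (cid (complex_complete (uCy y))).
have lP y (e : R) : 0 < e -> \forall n \near \oo, normc (u n y - l y) < e.
  exact: svalP (cid (complex_complete (uCy y))) e.
have unif (e : R) : 0 < e ->
    exists N, forall n, (N <= n)%N -> forall y, normc (u n y - l y) <= e.
  move=> e0; have [N uN] := uC e e0; exists N => n Nn y.
  apply/ler_addgt0Pr => d d0; near \oo => m.
  rewrite -[u n y](subrK (u m y)) -addrA.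
  rewrite (le_trans (le_normcD _ _))// lerD//.
    have Nm : (N <= m)%N by near: m; exists N.
    by apply: le_trans (ltW (uN n m Nn Nm)); exact: (le_cfun_norm (u n - u m) y).
  by apply/ltW; near: m; exact: lP.
have lc : l \in continuous_fun_pred.
  apply/asboolP => y; apply/complex_continuousP => e e0.
  have e4 : 0 < e / 4 by rewrite divr_gt0.
  have e2 : 0 < e / 2 by rewrite divr_gt0.
  have [N uN] := unif _ e4.
  apply: filterS (cfun_near (u N) y e2) => y' yy'.
  have -> : l y - l y' = (l y - u N y) + ((u N y - u N y') + (u N y' - l y')).
    by rewrite [(u N y - _) + _]addrA subrK addrA subrK.
  rewrite (le_lt_trans (le_normcD _ _))//.
  rewrite (_ : e = e / 4 + (e / 2 + e / 4)); last first.
    by field.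
  rewrite ler_ltD//; first by rewrite normc_distC uN.
  by rewrite (le_lt_trans (le_normcD _ _))// ltr_leD// uN.
exists (Cfun cY lc); apply/cvgrPdist_le => e e0.
have [N uN] := unif e e0; exists N => // n /= Nn.
rewrite sub0r normrN ger0_norm ?snorm_ge0//.
by apply: supn_le => [|y]; [exact: ltW|exact: uN].
Unshelve. all: by end_near. Qed.

HB.instance Definition _ := StarAlgebra_isCStar.Build R CY
  cfun_norm_eq0 cfun_cstar_identity cfun_complete.

End ContinuousFunctions.

Record continuous_action (G : topGroupType) (Y : topologicalType) :=
  ContinuousAction {
  gact :> G -> Y -> Y;
  gact_continuous : continuous (fun p : G * Y => gact p.1 p.2);
  gact1 : forall y, gact 1%g y = y;
  gactM : forall g h y, gact (g * h)%g y = gact g (gact h y)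
}.

Definition left_translation (G : topGroupType) : continuous_action G G :=
  ContinuousAction (@mulg_continuous G) (@mul1g G)
    (fun g h x => esym (mulgA g h x)).

Section InducedAction.
Context {R : realType} {G : topGroupType} {Y : topologicalType}.
Context (cY : compact [set: Y]) (a : continuous_action G Y).
Local Notation CY := (cfun R cY).

Fact gact_inv_continuous : continuous (fun p : G * Y => a p.1^-1%g p.2).
Proof.
move=> [g y]; apply: (@cvg_comp _ _ _ (fun p : G * Y => (p.1^-1%g, p.2))
  (fun p => a p.1 p.2) _ (nbhs (g^-1%g, y))).
  apply: cvg_pair; last exact: cvg_snd.
  apply: (@cvg_comp _ _ _ fst (fun x : G => x^-1%g) _ (nbhs g)).
    exact: cvg_fst.
  exact: invg_continuous.
exact: (@gact_continuous _ _ a (g^-1%g, y)).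
Qed.

Fact induced_subproof (g : G) (f : CY) :
  (fun y => f (a g^-1%g y)) \in continuous_fun_pred.
Proof.
apply/asboolP => y.
apply: (@cvg_comp _ _ _ (fun y => a g^-1%g y) f _ (nbhs (a g^-1%g y))).
  apply: (@cvg_comp _ _ _ (fun y => (g, y)) (fun p : G * Y => a p.1^-1%g p.2)
    _ (nbhs (g, y))); last exact: (@gact_inv_continuous (g, y)).
  by apply: cvg_pair; [exact: cvg_cst|exact: cvg_id].
exact: cfun_continuous.
Qed.

Definition induced_fun (g : G) (f : CY) : CY := Cfun cY (induced_subproof g f).

Definition induced_alg_action : alg_action G CY.
Proof.
apply: (@AlgAction _ _ _ induced_fun).
- by move=> *; exact: val_inj.
- by move=> *; exact: val_inj.
- by move=> *; exact: val_inj.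
- have le g f : snorm (induced_fun g f) <= snorm f.
    apply: supn_le => [|y]; first exact: snorm_ge0.
    exact: (le_cfun_norm f (a g^-1%g y)).
  move=> g f; apply/eqP; rewrite eq_le le /=.
  suff {1}-> : f = induced_fun g^-1%g (induced_fun g f) by exact: le.
  apply/val_inj/funext => y /=.
  by rewrite invgK -gactM mulVg gact1.
- by move=> f; apply/val_inj/funext => y /=; rewrite invg1 gact1.
- by move=> g h f; apply/val_inj/funext => y /=; rewrite invgM gactM.
Defined.

Fact induced_cont (f : CY) (g0 : G) :
  snorm (induced_alg_action g f - induced_alg_action g0 f) @[g --> g0]
    --> (0 : R).
Proof.
apply/cvgrPdist_le => e e0.
have e2 : 0 < e / 2 by rewrite divr_gt0.
have cont y : \forall p \near (g0, y),
    normc (f (a g0^-1%g y) - f (a p.1^-1%g p.2)) < e / 2.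
  exact: (@gact_inv_continuous (g0, y) _ (cfun_near f (a g0^-1%g y) e2)).
have /filterS : \forall g \near g0,
    setT `<=` (fun y => normc (f (a g^-1%g y) - f (a g0^-1%g y)) <= e).
  apply: ((@compact_near_coveringP Y setT).1 cY G (nbhs g0)
    (fun g y => normc (f (a g^-1%g y) - f (a g0^-1%g y)) <= e)) => y _.
  have [[U V] /= [U0 Vy] UV] := cont y.
  exists (V, U) => //= -[y' g] /= [Vy' Ug].
  have := UV (g, y') (conj Ug Vy').
  have := UV (g0, y') (conj (nbhs_singleton U0) Vy') => /= h1 h2.
  have -> : f (a g^-1%g y') - f (a g0^-1%g y') =
      - (f (a g0^-1%g y) - f (a g^-1%g y')) +
      (f (a g0^-1%g y) - f (a g0^-1%g y')) by rewrite opprB addrA subrK.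
  by rewrite (le_trans (le_normcD _ _))// normcN [leRHS]splitr lerD// ltW.
apply => g le; rewrite sub0r normrN ger0_norm ?snorm_ge0//.
by apply: supn_le => [|y]; [exact: ltW|exact: le].
Qed.

Definition induced_action : cstar_action G CY := CStarAction induced_cont.

End InducedAction.
Arguments induced_action {R G Y} cY a.

Section RokhlinDimension.
Context {R : realType} {G : topGroupType} (cG : compact [set: G]).

Definition translation_action : cstar_action G (cfun R cG) :=
  induced_action cG (left_translation G).

Definition Finf_cont (A : cstarAlgType R) (alpha : cstar_action G A) :
    star_subalg (Finf A) := continuous_part (Finf_act alpha).

Definition Finf_cont_act (A : cstarAlgType R) (alpha : cstar_action G A) :
    alg_action G (subalg (Finf_cont alpha)) :=
  continuous_part_action (Finf_act alpha).

(* The unit of F_oo(A) is specified by its defining property, so that A need not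
   be unital. *)
Definition has_rokhlin_towers (A : cstarAlgType R) (alpha : cstar_action G A)
    (d : nat) : Prop :=
  exists phi : 'I_d.+1 -> {linear cfun R cG -> subalg (Finf_cont alpha)},
    [/\ forall j, [/\ completely_positive (phi j), contractive (phi j),
          order_zero (phi j)
          & equivariant translation_action (Finf_cont_act alpha) (phi j)],
        forall i j, i != j -> forall f h,
          phi i f ** phi j h = phi j h ** phi i f
      & is_identity (\sum_j val (phi j cfun_one) : Finf A)].

Definition dim_rok_c (A : cstarAlgType R) (alpha : cstar_action G A) : \bar R :=
  least_nat R (has_rokhlin_towers alpha).

End RokhlinDimension.

Section Join.
Context (R : realType) (X Y : topologicalType).
Local Notation I01 := (set_type (`[0 : R, 1]%classic)).
Local Notation T := (X * Y * I01)%type.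

Definition join_rel : rel T := fun p q => `[< [\/ p = q,
   [/\ val p.2 = 0, val q.2 = 0 & p.1.2 = q.1.2]
 | [/\ val p.2 = 1, val q.2 = 1 & p.1.1 = q.1.1]] >].

Fact join_rel_refl : reflexive join_rel.
Proof. by move=> p; apply/asboolP; apply: Or31. Qed.

Fact join_rel_sym : symmetric join_rel.
Proof.
suff imp p q : join_rel p q -> join_rel q p.
  by move=> p q; apply/idP/idP; exact: imp.
by move=> /asboolP[->|[? ? ?]|[? ? ?]]; apply/asboolP;
  [apply: Or31|apply: Or32|apply: Or33].
Qed.

Fact join_rel_trans : transitive join_rel.
Proof.
move=> q p r /asboolP[->//|[p0 q0 pq]|[p1 q1 pq]] /asboolP[<-|[q0' r0 qr]|[q1' r1 qr]];
  apply/asboolP.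
- exact: Or32.
- by apply: Or32; split=> //; rewrite pq.
- by move: q1'; rewrite q0 => /eqP; rewrite eq_sym oner_eq0.
- exact: Or33.
- by move: q0'; rewrite q1 => /eqP; rewrite oner_eq0.
- by apply: Or33; split=> //; rewrite pq.
Qed.

Canonical join_equiv := EquivRel join_rel join_rel_refl join_rel_sym
  join_rel_trans.

Definition top_join : topologicalType := quotient_topology {eq_quot join_equiv}.

Definition join_pi (p : T) : top_join := \pi_{eq_quot join_equiv} p.
Definition join_repr (z : top_join) : T := repr (z : {eq_quot join_equiv}).

Definition join_map (fX : X -> X) (fY : Y -> Y) (z : top_join) : top_join :=
  let p := join_repr z in join_pi (fX p.1.1, fY p.1.2, p.2).

Lemma join_mapE fX fY x y t :
  join_map fX fY (join_pi (x, y, t)) = join_pi (fX x, fY y, t).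
Proof.
have /eqmodP/asboolP : join_repr (join_pi (x, y, t)) = (x, y, t)
  %[mod {eq_quot join_equiv}] by exact: reprK.
rewrite /join_map; case: (join_repr _) => -[x' y'] t' /= h.
apply/eqmodP/asboolP => /=.
case: h => [[-> -> ->]|/= [t'0 t0 ->]|/= [t'1 t1 ->]].
- exact: Or31.
- exact: Or32.
- exact: Or33.
Qed.

End Join.

(* Only the underlying maps matter to define equivariance. *)
Record gspace (G : topGroupType) := GSpace {
  gspace_car :> topologicalType;
  gspace_act : G -> gspace_car -> gspace_car
}.

Section Index.
Context (R : realType) (G : topGroupType).

(* join_pow k is the (k+1)-fold join of G, bracketed to the left. *)
Fixpoint join_pow (k : nat) : gspace G :=
  if k is k'.+1 then
    GSpace (fun g : G => @join_map R (join_pow k') G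
      (gspace_act g) (fun h => g * h)%g)
  else GSpace (fun g h : G => (g * h)%g).

Definition maps_to_join (Y : topologicalType) (a : continuous_action G Y)
    (n : nat) : Prop :=
  (1 <= n)%N /\ exists f : Y -> join_pow n.-1,
    continuous f /\ forall g y, f (a g y) = gspace_act g (f y).

Definition ind_G (Y : topologicalType) (a : continuous_action G Y) : \bar R :=
  least_nat R (maps_to_join a).

End Index.

Section LieGroup.
Context (R : realType).

(* Meaningful for U open only; the values of f outside of U are irrelevant. *)
Fixpoint is_Ck (k m n : nat) (U : set 'rV[R]_m) (f : 'rV[R]_m -> 'rV[R]_n) :
    Prop :=
  (forall x, U x -> {for x, continuous f}) /\
  (if k is k'.+1 then forall i : 'I_m,
     (forall x, U x -> derivable f x (delta_mx 0 i)) /\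
     is_Ck k' U (fun x => 'D_(delta_mx 0 i) f x)
   else True).

Definition smooth_on (m n : nat) (U : set 'rV[R]_m)
    (f : 'rV[R]_m -> 'rV[R]_n) : Prop := forall k, is_Ck k U f.

(* A homeomorphism from an open subset of M onto an open subset of R^n; the
   values of chart_map and chart_inv outside of these sets are irrelevant. *)
Record chart (M : topologicalType) (n : nat) := Chart {
  chart_dom : set M;
  chart_map : M -> 'rV[R]_n;
  chart_inv : 'rV[R]_n -> M;
  chart_dom_open : open chart_dom;
  chart_img_open : open (chart_map @` chart_dom);
  chart_mapK : forall x, chart_dom x -> chart_inv (chart_map x) = x;
  chart_map_cont : forall x, chart_dom x -> {for x, continuous chart_map};
  chart_inv_cont : forall z, (chart_map @` chart_dom) z ->
    {for z, continuous chart_inv}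
}.

Definition chart_img (M : topologicalType) n (c : chart M n) : set 'rV[R]_n :=
  chart_map c @` chart_dom c.

Definition smooth_atlas (M : topologicalType) n (At : set (chart M n)) : Prop :=
  (forall x, exists2 c, At c & chart_dom c x) /\
  (forall c d, At c -> At d ->
    smooth_on (chart_map c @` (chart_dom c `&` chart_dom d))
      (chart_map d \o chart_inv c)).

Section SmoothOperations.
Context (G : topGroupType) (n : nat) (At : set (chart G n)).

Definition smooth_mul : Prop := forall c d e, At c -> At d -> At e ->
  smooth_on
    [set z : 'rV[R]_(n + n) | [/\ chart_img c (lsubmx z), chart_img d (rsubmx z)
      & chart_dom e (chart_inv c (lsubmx z) * chart_inv d (rsubmx z))%g]]
    (fun z => chart_map e (chart_inv c (lsubmx z) * chart_inv d (rsubmx z))%g).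

Definition smooth_inv : Prop := forall c d, At c -> At d ->
  smooth_on
    [set z | chart_img c z /\ chart_dom d (chart_inv c z)^-1%g]
    (fun z => chart_map d (chart_inv c z)^-1%g).

End SmoothOperations.

Definition lie_group (G : topGroupType) : Prop :=
  [/\ hausdorff_space G, @second_countable G
    & exists n (At : set (chart G n)),
        [/\ smooth_atlas At, smooth_mul At & smooth_inv At]].

Definition metrizable (Y : topologicalType) : Prop :=
  exists dist : Y -> Y -> R,
    [/\ forall x y, dist x y = 0 <-> x = y,
        forall x y, dist x y = dist y x,
        forall x y z, dist x z <= dist x y + dist y z
      & forall x (U : set Y), nbhs x U <->
          exists2 e, 0 < e & [set y | dist x y < e] `<=` U].

End LieGroup.

(* Main.v *)
From HB Require Import structures.
Require Import Defs.
From mathcomp Require Import all_boot all_order all_algebra.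
From mathcomp Require Import complex generic_quotient.
From mathcomp Require Import all_classical all_reals all_analysis.
From mathcomp Require Import ring lra.

(** For every d, there are d+1 Rokhlin towers if and only if Y has an equivariant
    map to the (d+1)-fold join of G; the theorem follows, the two dimensions being
    the least such d and the least such d+1.

    From the join to towers ([join_to_rokhlin_towers]). A point of the join is
    given by barycentric weights w_j and, where w_j > 0, by points x_j of G. If f
    is an equivariant map from Y to the join, then sending h to the function
    y |-> w_j (f y) * h (x_j (f y)) is an equivariant completely positive
    contractive order zero map from C(G) to C(Y), which is continuous because the
    weight vanishes where x_j is undefined. The images of 1 add up to 1. The
    towers are obtained by embedding C(Y) in the central sequence algebra as the
    constant sequences.

    From towers to the join ([rokhlin_towers_to_join]). Let b be a bump function on
    G supported near 1. Represent the images of b under the towers by sequences in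
    C(Y). A term of large index yields functions e_j >= 0 on Y such that e_j is
    orthogonal to its translates by all g outside of a small neighbourhood U of 1,
    while the translates of the e_j cover Y ([rokhlin_bumps]). In the central
    sequence algebra orthogonality holds for each g separately; that one index
    serves for all g relies on the continuity of the action on the range of the
    towers and on Baire's theorem ([central_class_equicontinuous]).

    For y in Y, the set of the k with e_j (k^-1 y) > 0 is a subset of G that moves
    along with y, and it is small as it lies in a translate of U. If it has a
    center depending continuously and equivariantly on y, then the centers for
    j = 0 .. d, defined on the open sets where sup_g e_j (g y) > 0, together with
    these suprema as weights are the coordinates of an equivariant map to the join
    ([towers_to_join]). Here a Chebyshev center is taken: the inverse of the
    minimizer over c of the supremum over k of e_j (k^-1 y) * chi (c * k), where
    chi is a squared distance to 1 in a chart. It is equivariant by construction,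
    and it is continuous as soon as the minimizer is unique.

    Uniqueness is where the Lie structure enters: c |-> chi (c * k) is strictly
    quasi-convex in the chart, with the same midpoints for all small k
    ([chart_midpoint_gauge]), because the multiplication is of class C^2 and chi
    is a squared Euclidean norm. A supremum of such functions has at most one
    minimizer ([orbit_center_unique]). *)

Set Implicit Arguments.
Unset Strict Implicit.
Unset Printing Implicit Defensive.

Import Order.TTheory GRing.Theory Num.Theory numFieldNormedType.Exports.
Import Normc.

Local Open Scope classical_set_scope.
Local Open Scope ring_scope.
Local Open Scope complex_scope.
Local Open Scope quotient_scope.

(** * Continuity of composites and of suprema over a compact space *)

Lemma for_continuous_pair {X Y Z : topologicalType} (f : X -> Y) (g : X -> Z)
    (x : X) :
  {for x, continuous f} -> {for x, continuous g} ->
  {for x, continuous (fun x => (f x, g x))}.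
Proof. by move=> fc gc; exact: cvg_pair. Qed.

Lemma for_continuous2 {X Y Z W : topologicalType} (h : Y -> Z -> W)
    (f : X -> Y) (g : X -> Z) (x : X) :
  {for (f x, g x), continuous (fun p : Y * Z => h p.1 p.2)} ->
  {for x, continuous f} -> {for x, continuous g} ->
  {for x, continuous (fun x => h (f x) (g x))}.
Proof.
move=> hc fc gc.
apply: (@cvg_comp _ _ _ (fun x => (f x, g x)) (fun p : Y * Z => h p.1 p.2) _
  (nbhs (f x, g x))); last exact: hc.
exact: for_continuous_pair.
Qed.

Lemma for_continuous_comp {X Y Z : topologicalType} (h : Y -> Z)
    (f : X -> Y) (x : X) :
  {for f x, continuous h} -> {for x, continuous f} ->
  {for x, continuous (fun x => h (f x))}.
Proof. by move=> hc fc; exact: (@cvg_comp _ _ _ f h _ (nbhs (f x))). Qed.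

Lemma real_continuousP {R : realType} {X : topologicalType} (f : X -> R) x :
  {for x, continuous f} <->
  forall e, 0 < e -> \forall x' \near x, `|f x - f x'| < e.
Proof. exact: cvgrPdist_lt. Qed.

Lemma mulg_continuousl {G : topGroupType} (g x : G) :
  (g * y)%g @[y --> x] --> (g * x)%g.
Proof.
apply: (@for_continuous2 _ _ _ _ (fun g h : G => (g * h)%g) (cst g) id).
- exact: mulg_continuous.
- exact: cvg_cst.
- exact: cvg_id.
Qed.

Lemma mulg_continuousr {G : topGroupType} (g x : G) :
  (y * g)%g @[y --> x] --> (x * g)%g.
Proof.
apply: (@for_continuous2 _ _ _ _ (fun g h : G => (g * h)%g) id (cst g)).
- exact: mulg_continuous.
- exact: cvg_id.
- exact: cvg_cst.
Qed.

Section SupOverCompact.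
Context {R : realType} {T K : topologicalType} (cK : compact [set: K]) (k0 : K).
Variable F : T -> K -> R.
Hypothesis F_ge0 : forall t k, 0 <= F t k.
Hypothesis F_cont : continuous (fun p : T * K => F p.1 p.2).

Lemma supn_attained t :
  exists2 k, supn (F t) = F t k & forall k', F t k' <= F t k.
Proof.
have [||k _ kmax] := @compact_EVT_max K R (F t) setT _ cK; first by exists k0.
  apply: continuous_subspaceT => k; apply: for_continuous2.
  - exact: F_cont.
  - exact: cvg_cst.
  - exact: cvg_id.
have le k' : F t k' <= F t k by apply: kmax; rewrite inE.
exists k => //; apply/eqP; rewrite eq_le supn_le//=.
by apply: le_supn; exists (F t k).
Qed.

Lemma le_supn_compact t k : F t k <= supn (F t).
Proof. by have [k' -> le] := supn_attained t. Qed.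

Lemma supn_continuous : continuous (fun t => supn (F t)).
Proof.
move=> t0; apply/real_continuousP => e e0.
have e2 : 0 < e / 2 by rewrite divr_gt0.
have : \forall t \near t0, setT `<=` (fun k => `|F t0 k - F t k| <= e / 2).
  apply: ((@compact_near_coveringP K setT).1 cK T (nbhs t0)
    (fun t k => `|F t0 k - F t k| <= e / 2)) => k _.
  have e4 : 0 < e / 2 / 2 by rewrite divr_gt0.
  have [[V W] /= [V0 Wk] VW] := (real_continuousP _ _).1 (@F_cont (t0, k)) _ e4.
  exists (W, V) => //= -[k' t] /= [Wk' Vt].
  have := VW (t, k') (conj Vt Wk').
  have := VW (t0, k') (conj (nbhs_singleton V0) Wk') => /= h1 h2.
  rewrite [leRHS]splitr -(subrKA (F t0 k)) (le_trans (ler_normD _ _))// lerD//.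
    by rewrite distrC ltW.
  exact: ltW.
apply: filterS => t le.
apply: (@le_lt_trans _ _ (e / 2)); last by rewrite ltr_pdivrMr// ltr_pMr// ltr1n.
have [k -> kmax] := supn_attained t; have [k' -> k'max] := supn_attained t0.
have := le k I; have := le k' I; have := kmax k'; have := k'max k.
rewrite !ler_norml; lra.
Qed.

End SupOverCompact.

(** * Centers of orbits *)

(** [chi] plays the role of the squared distance to 1 and [g] that of a midpoint
    of [g1] and [g2]: the same [g] has to serve for all [k] in [U], so that it
    lowers a supremum over [k] of multiples of [chi (g * k)]. *)
Definition midpoint_gauge {R : realType} {G : topGroupType} (chi : G -> R)
    (eta : R) (U : set G) : Prop :=
  [/\ continuous chi, forall g, 0 <= chi g, forall k, U k -> chi k <= eta
    & forall g1 g2, chi g1 <= eta -> chi g2 <= eta -> g1 <> g2 ->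
      exists g, forall k, U k ->
        chi (g * k)%g < Num.max (chi (g1 * k)%g) (chi (g2 * k)%g)].

Section OrbitCenter.
Context {R : realType} {G : topGroupType} (cG : compact [set: G]).
Context {Y : topologicalType} (a : continuous_action G Y).
Variables (chi : G -> R) (eta : R) (U : set G).
Hypothesis chiP : midpoint_gauge chi eta U.
Variable e : Y -> R.
Hypothesis e_cont : continuous e.
Hypothesis e_ge0 : forall y, 0 <= e y.
Hypothesis e_sep : forall y g, 0 < e y -> 0 < e (a g y) -> U g.

Let chi_cont : continuous chi. Proof. by case: chiP. Qed.
Let chi_ge0 g : 0 <= chi g. Proof. by case: chiP. Qed.

Definition orbit_weight (y : Y) : R := supn (fun k => e (a k^-1%g y)).

(** A minimizer of [orbit_energy (y, c)] over [c] is the inverse of a Chebyshev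
    center of the set of the [k] with [e (a k^-1 y) > 0]. The factor [e] weighs
    these [k] in order that the energy be continuous in [y]. *)
Definition orbit_energy (p : Y * G) : R :=
  supn (fun k => e (a k^-1%g p.1) * chi (p.2 * k)%g).

Let translate_cont : continuous (fun p : Y * G => e (a p.2^-1%g p.1)).
Proof.
move=> p; apply: (@for_continuous_comp _ _ _ e (fun p : Y * G => a p.2^-1%g p.1)).
  exact: e_cont.
apply: (@for_continuous2 _ _ _ _ (fun g y => a g^-1%g y)).
- exact: (@gact_inv_continuous _ _ a (p.2, p.1)).
- exact: cvg_snd.
- exact: cvg_fst.
Qed.

Let term_cont :
  continuous (fun q : (Y * G) * G => e (a q.2^-1%g q.1.1) * chi (q.1.2 * q.2)%g).
Proof.
move=> q; apply: (@continuousM R).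
  apply: (@for_continuous2 _ _ _ _ (fun y k => e (a k^-1%g y))).
  - exact: (@translate_cont (q.1.1, q.2)).
  - by apply: (@for_continuous_comp _ _ _ fst fst); [exact: cvg_fst|exact: cvg_fst].
  - exact: cvg_snd.
apply: (@for_continuous_comp _ _ _ chi (fun q : Y * G * G => (q.1.2 * q.2)%g)).
  exact: chi_cont.
apply: (@for_continuous2 _ _ _ _ (fun g k : G => (g * k)%g)).
- exact: mulg_continuous.
- by apply: (@for_continuous_comp _ _ _ snd fst); [exact: cvg_snd|exact: cvg_fst].
- exact: cvg_snd.
Qed.

Let term_ge0 (p : Y * G) k : 0 <= e (a k^-1%g p.1) * chi (p.2 * k)%g.
Proof. exact: mulr_ge0. Qed.

Lemma orbit_weight_continuous : continuous orbit_weight.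
Proof. by apply: (supn_continuous cG 1%g). Qed.

Lemma orbit_weight_ge0 y : 0 <= orbit_weight y.
Proof. exact: supn_ge0. Qed.

Lemma orbit_weight_gt0 y g : 0 < e (a g y) -> 0 < orbit_weight y.
Proof.
move=> eg; apply: lt_le_trans eg _; rewrite -{1}[g]invgK.
exact: (@le_supn_compact R Y G cG 1%g (fun y k => e (a k^-1%g y)) _ translate_cont).
Qed.

Lemma orbit_weight_inv g y : orbit_weight (a g y) = orbit_weight y.
Proof.
have le h z : orbit_weight (a h z) <= orbit_weight z.
  apply: supn_le => [|k]; first exact: orbit_weight_ge0.
  rewrite -gactM.
  have -> : (k^-1 * h)%g = ((h^-1 * k)^-1)%g by rewrite invgM invgK.
  exact: (@le_supn_compact R Y G cG 1%g (fun y k => e (a k^-1%g y)) _ translate_cont).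
apply/eqP; rewrite eq_le le /= -{1}[y](gact1 a) -(mulVg g) gactM.
exact: le.
Qed.

Lemma orbit_energy_continuous : continuous orbit_energy.
Proof.
exact: (@supn_continuous R (Y * G)%type G cG 1%g
  (fun p k => e (a k^-1%g p.1) * chi (p.2 * k)%g) term_ge0 term_cont).
Qed.

Lemma le_orbit_energy y c k :
  e (a k^-1%g y) * chi (c * k)%g <= orbit_energy (y, c).
Proof.
exact: (@le_supn_compact R (Y * G)%type G cG 1%g
  (fun p k => e (a k^-1%g p.1) * chi (p.2 * k)%g) term_ge0 term_cont (y, c) k).
Qed.

Lemma orbit_energy_act h y c :
  orbit_energy (a h y, c) = orbit_energy (y, c * h)%g.
Proof.
have le h' y' c' : orbit_energy (a h' y', c') <= orbit_energy (y', c' * h')%g.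
  apply: supn_le => [|k /=]; first exact: supn_ge0.
  have -> : (c' * k = c' * h' * (h'^-1 * k))%g by rewrite mulgA mulgK.
  rewrite -gactM.
  have -> : (k^-1 * h')%g = ((h'^-1 * k)^-1)%g by rewrite invgM invgK.
  exact: le_orbit_energy.
apply/eqP; rewrite eq_le le /=.
have := le h^-1%g (a h y) (c * h)%g.
by rewrite -gactM mulVg gact1 mulgK.
Qed.

Lemma orbit_energy_min y :
  exists c, forall c', orbit_energy (y, c) <= orbit_energy (y, c').
Proof.
have [||c _ cmin] := @compact_EVT_min G R (fun c => orbit_energy (y, c)) setT _ cG.
- by exists 1%g.
- apply: continuous_subspaceT => c.
  apply: (@for_continuous_comp _ _ _ orbit_energy (fun c => (y, c))).
    exact: orbit_energy_continuous.
  by apply: cvg_pair; [exact: cvg_cst|exact: cvg_id].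
by exists c => c'; apply: cmin; rewrite inE.
Qed.

Definition orbit_center y : G := sval (cid (orbit_energy_min y)).

Lemma orbit_centerP y c : orbit_energy (y, orbit_center y) <= orbit_energy (y, c).
Proof. exact: (svalP (cid (orbit_energy_min y))). Qed.

(** If [k] carries the largest weight [e (a k^-1 y)], comparing the energy of a
    minimizer [c] with that of [k^-1] gives [chi (c * k) <= eta]. Two minimizers
    would thus be in the range of the gauge, which provides a point of smaller
    energy. *)
Lemma orbit_center_unique y c : 0 < orbit_weight y ->
  (forall c', orbit_energy (y, c) <= orbit_energy (y, c')) ->
  c = orbit_center y.
Proof.
move=> y0 cmin; apply: contrapT => neq.
have [_ _ Ueta mid] := chiP.
have [k] := @supn_attained R Y G cG 1%g (fun y k => e (a k^-1%g y))
  (fun _ _ => e_ge0 _) translate_cont y.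
rewrite -/(orbit_weight y) => ky kmax.
have ek : 0 < e (a k^-1%g y) by rewrite -ky.
have near k' : 0 < e (a k'^-1%g y) -> U (k^-1 * k')%g.
  move=> ek'; apply: (e_sep ek'); rewrite -gactM.
  by rewrite -mulgA mulgV mulg1.
have small c' : (forall c'', orbit_energy (y, c') <= orbit_energy (y, c'')) ->
    chi (c' * k)%g <= eta.
  move=> c'min; rewrite -(ler_pM2l ek).
  apply: le_trans (le_orbit_energy _ _ _) _; apply: le_trans (c'min k^-1%g) _.
  apply: supn_le => [|k' /=].
    have := near k ek; rewrite mulVg => /Ueta eta0.
    by rewrite mulr_ge0// (le_trans _ eta0).
  have [->|ek'] := eqVneq (e (a k'^-1%g y)) 0.
    have := near k ek; rewrite mulVg => /Ueta eta0.
    by rewrite mul0r mulr_ge0// (le_trans _ eta0).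
  have ek'0 : 0 < e (a k'^-1%g y) by rewrite lt_neqAle eq_sym ek' e_ge0.
  by apply: ler_pM => //; exact/Ueta/near.
have [||hk|g gP] := mid (c * k)%g (orbit_center y * k)%g.
- exact: small.
- exact/small/orbit_centerP.
- by apply: neq; exact: mulIg hk.
(* The candidate for a smaller energy: the midpoint, translated back by k. *)
pose c' := (g * k^-1)%g.
have c'P k' : 0 < e (a k'^-1%g y) ->
    e (a k'^-1%g y) * chi (c' * k')%g < orbit_energy (y, c).
  move=> ek'; have := gP _ (near _ ek').
  rewrite -!mulgA !mulVKg.
  rewrite -(ltr_pM2l ek') => /lt_le_trans; apply.
  have [_|_] := leP (chi (c * k')%g); last exact: le_orbit_energy.
  apply: le_trans (le_orbit_energy _ _ _) _; exact: orbit_centerP.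
have [k' k'E k'max] := @supn_attained R (Y * G)%type G cG 1%g
  (fun p k => e (a k^-1%g p.1) * chi (p.2 * k)%g) term_ge0 term_cont (y, c').
have : orbit_energy (y, c') < orbit_energy (y, c).
  rewrite /orbit_energy k'E /=.
  have [ek'|ek'] := ltP 0 (e (a k'^-1%g y)); first exact: c'P.
  have -> : e (a k'^-1%g y) = 0 by apply/eqP; rewrite eq_le ek' e_ge0.
  rewrite mul0r; apply: le_lt_trans (c'P k ek); exact: mulr_ge0.
by rewrite ltNge cmin.
Qed.

Lemma orbit_center_act h y : 0 < orbit_weight y ->
  orbit_center (a h y) = (orbit_center y * h^-1)%g.
Proof.
move=> y0; apply/esym/orbit_center_unique; first by rewrite orbit_weight_inv.
move=> c; rewrite !orbit_energy_act -mulgA mulVg mulg1; exact: orbit_centerP.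
Qed.

(** A unique minimizer over a compact set depends continuously on the
    parameter. *)
Lemma orbit_center_continuous y : 0 < orbit_weight y ->
  {for y, continuous orbit_center}.
Proof.
move=> y0 V /= Vc.
have near_cov : \forall z \near y, setT `<=`
    (fun c => ~ V c -> orbit_energy (z, orbit_center y) < orbit_energy (z, c)).
  apply: ((@compact_near_coveringP G setT).1 cG Y (nbhs y)
    (fun z c => ~ V c ->
      orbit_energy (z, orbit_center y) < orbit_energy (z, c))) => c _.
  have [->|neq] := pselect (c = orbit_center y).
    exists (V, setT) => /=; first by split => //; exact: filterT.
    by move=> [c' z] /= [].
  have lt : orbit_energy (y, orbit_center y) < orbit_energy (y, c).
    rewrite ltNge; apply/negP => le; apply: neq.
    apply: orbit_center_unique => // c'; apply: le_trans le _.
    exact: orbit_centerP.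
  have d0 : 0 < (orbit_energy (y, c) - orbit_energy (y, orbit_center y)) / 2.
    by rewrite divr_gt0// subr_gt0.
  have [[A B] /= [Ay Bc] AB] :=
    (real_continuousP _ _).1 (@orbit_energy_continuous (y, c)) _ d0.
  have [[A' B'] /= [Ay' Bc'] AB'] :=
    (real_continuousP _ _).1 (@orbit_energy_continuous (y, orbit_center y)) _ d0.
  exists (B, A `&` A') => /=; first by split => //; exact: filterI.
  move=> [c' z] /= [Bc'' [Az A'z]] _.
  have := AB (z, c') (conj Az Bc''); rewrite /= ltr_norml => /andP[_].
  have := AB' (z, orbit_center y) (conj A'z (nbhs_singleton Bc')).
  rewrite /= ltr_norml => /andP[+ _].
  by rewrite -subr_gt0; lra.
apply: filterS near_cov => z zP; apply: contrapT => /zP-/(_ I).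
by rewrite ltNge orbit_centerP.
Qed.

End OrbitCenter.

(** * Gluing partial maps into a join *)

Section UnitInterval.
Context {R : realType}.
Local Notation I01 := (set_type (`[0 : R, 1]%classic)).

(** Continuity into the subtype [0, 1] of the line is dealt with by composing
    real functions with this retraction. *)
Fact clamp01_subproof (t : R) :
  Num.max 0 (Num.min 1 t) \in (`[0 : R, 1]%classic : set R).
Proof.
by rewrite inE /= in_itv /= le_max lexx /= ge_max ler01 ge_min lexx.
Qed.

Definition clamp01 (t : R) : I01 :=
  @exist R (fun x => x \in (`[0 : R, 1]%classic : set R)) _ (clamp01_subproof t).

Lemma val_clamp01 t : 0 <= t <= 1 -> val (clamp01 t) = t.
Proof. by case/andP=> t0 t1 /=; rewrite min_r// max_r. Qed.

Lemma clamp01_continuous : continuous clamp01.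
Proof.
apply/continuous_comp_initial => t /=.
by apply: continuous_max; [exact: cvg_cst|apply: continuous_min; [exact: cvg_cst|exact: cvg_id]].
Qed.

Lemma clamp01K (i : I01) : clamp01 (val i) = i.
Proof.
apply: val_inj; rewrite val_clamp01//.
by have := set_valP i; rewrite /= in_itv.
Qed.

Lemma unit_interval_compact : compact [set: I01].
Proof.
have -> : [set: I01] = clamp01 @` `[0, 1].
  apply/seteqP; split => // i _; exists (val i); last exact: clamp01K.
  exact: (set_valP i).
apply: continuous_compact; last exact: segment_compact.
by apply: continuous_subspaceT; exact: clamp01_continuous.
Qed.

End UnitInterval.

Section JoinTopology.
Context {R : realType} {X Z : topologicalType}.
Local Notation I01 := (set_type (`[0 : R, 1]%classic)).
Local Notation pi := (@join_pi R X Z).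

Lemma join_pi_continuous : continuous pi.
Proof. exact: pi_continuous. Qed.

Lemma join_pi0 x x' z (i : I01) : val i = 0 -> pi (x, z, i) = pi (x', z, i).
Proof. by move=> i0; apply/eqmodP/asboolP; apply: Or32. Qed.

Lemma join_pi1 x z z' (i : I01) : val i = 1 -> pi (x, z, i) = pi (x, z', i).
Proof. by move=> i1; apply/eqmodP/asboolP; apply: Or33. Qed.

Lemma join_compact : compact [set: X] -> compact [set: Z] ->
  compact [set: top_join R X Z].
Proof.
move=> cX cZ.
have -> : [set: top_join R X Z] = pi @` setT.
  by apply/seteqP; split => // w _; exists (join_repr w) => //; exact: reprK.
apply: continuous_compact; first exact/continuous_subspaceT/join_pi_continuous.
rewrite -setXTT -setXTT; apply: compact_setX; last exact: unit_interval_compact.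
exact: compact_setX.
Qed.

Context {Y : topologicalType}.
Implicit Types (f : Y -> X) (q : Y -> Z) (t : Y -> R) (y : Y).

Lemma join_pi_continuous_at f q t y :
  {for y, continuous f} -> {for y, continuous q} -> {for y, continuous t} ->
  {for y, continuous (fun y => pi (f y, q y, clamp01 (t y)))}.
Proof.
move=> fc qc tc.
apply: (@for_continuous_comp _ _ _ pi (fun y => (f y, q y, clamp01 (t y)))).
  exact: join_pi_continuous.
apply: for_continuous_pair; first exact: for_continuous_pair.
apply: (@for_continuous_comp _ _ _ clamp01 t) => //; exact: clamp01_continuous.
Qed.

(** The tube lemma: near the end where the first coordinate is collapsed, that
    coordinate may be discontinuous. *)
Lemma join_pi_continuous_at0 f q t y : compact [set: X] ->
  t y = 0 -> {for y, continuous q} -> {for y, continuous t} ->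
  {for y, continuous (fun y => pi (f y, q y, clamp01 (t y)))}.
Proof.
move=> cX t0 qc tc W /= Wy.
have tube : \forall y' \near y,
    setT `<=` (fun x => W (pi (x, q y', clamp01 (t y')))).
  apply: ((@compact_near_coveringP X setT).1 cX Y (nbhs y)
    (fun y' x => W (pi (x, q y', clamp01 (t y'))))) => x _.
  have : \forall p \near (y, x), W (pi (p.2, q p.1, clamp01 (t p.1))).
    have Wx : nbhs (pi (x, q y, clamp01 (t y))) W.
      by rewrite (@join_pi0 x (f y))// val_clamp01 t0 ?lexx ?ler01.
    have : {for (y, x), continuous
        (fun p : Y * X => pi (p.2, q p.1, clamp01 (t p.1)))}.
      apply: (@for_continuous_comp _ _ _ pi
        (fun p : Y * X => (p.2, q p.1, clamp01 (t p.1)))).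
        exact: join_pi_continuous.
      apply: for_continuous_pair; first apply: for_continuous_pair.
      - exact: cvg_snd.
      - by apply: (@for_continuous_comp _ _ _ q fst) => //; exact: cvg_fst.
      - apply: (@for_continuous_comp _ _ _ clamp01 (t \o fst)).
          exact: clamp01_continuous.
        by apply: (@for_continuous_comp _ _ _ t fst) => //; exact: cvg_fst.
    exact.
  case=> -[A B] /= [Ay Bx] AB; exists (B, A) => //= -[x' y'] /= [Bx' Ay'].
  exact: (AB (y', x')).
by apply: filterS tube => y' /(_ (f y') I).
Qed.

Lemma join_pi_continuous_at1 f q t y : compact [set: Z] ->
  t y = 1 -> {for y, continuous f} -> {for y, continuous t} ->
  {for y, continuous (fun y => pi (f y, q y, clamp01 (t y)))}.
Proof.
move=> cZ t1 fc tc W /= Wy.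
have tube : \forall y' \near y,
    setT `<=` (fun z => W (pi (f y', z, clamp01 (t y')))).
  apply: ((@compact_near_coveringP Z setT).1 cZ Y (nbhs y)
    (fun y' z => W (pi (f y', z, clamp01 (t y'))))) => z _.
  have : \forall p \near (y, z), W (pi (f p.1, p.2, clamp01 (t p.1))).
    have Wx : nbhs (pi (f y, z, clamp01 (t y))) W.
      by rewrite (@join_pi1 _ z (q y))// val_clamp01 t1 ?lexx ?ler01.
    have : {for (y, z), continuous
        (fun p : Y * Z => pi (f p.1, p.2, clamp01 (t p.1)))}.
      apply: (@for_continuous_comp _ _ _ pi
        (fun p : Y * Z => (f p.1, p.2, clamp01 (t p.1)))).
        exact: join_pi_continuous.
      apply: for_continuous_pair; first apply: for_continuous_pair.
      - by apply: (@for_continuous_comp _ _ _ f fst) => //; exact: cvg_fst.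
      - exact: cvg_snd.
      - apply: (@for_continuous_comp _ _ _ clamp01 (t \o fst)).
          exact: clamp01_continuous.
        by apply: (@for_continuous_comp _ _ _ t fst) => //; exact: cvg_fst.
    exact.
  case=> -[A B] /= [Ay Bx] AB; exists (B, A) => //= -[x' y'] /= [Bx' Ay'].
  exact: (AB (y', x')).
by apply: filterS tube => y' /(_ (q y') I).
Qed.

End JoinTopology.

Section TowersToJoin.
Context {R : realType} {G : topGroupType} (cG : compact [set: G]).
Context {Y : topologicalType} (a : continuous_action G Y).

Lemma join_pow_compact k : compact [set: join_pow R G k].
Proof. by elim: k => [|k IHk] //=; exact: join_compact. Qed.

Variables (u : nat -> Y -> R) (q : nat -> Y -> G).
Hypothesis u_ge0 : forall j y, 0 <= u j y.
Hypothesis u_cont : forall j, continuous (u j).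
Hypothesis u_inv : forall j g y, u j (a g y) = u j y.
Hypothesis q_cont : forall j y, 0 < u j y -> {for y, continuous (q j)}.
Hypothesis q_equiv : forall j g y, 0 < u j y -> q j (a g y) = (g * q j y)%g.

Let s k y := \sum_(j < k.+1) u j y.

Let s_ge0 k y : 0 <= s k y. Proof. exact: sumr_ge0. Qed.

Let s_cont k : continuous (s k).
Proof.
elim: k => [|k IHk] y.
  have -> : s 0 = u 0%N by apply/funext => z; rewrite /s big_ord1.
  exact: u_cont.
have -> : s k.+1 = (fun z => s k z + u k.+1 z).
  by apply/funext => z; rewrite /s big_ord_recr.
by apply: (@continuousD R R^o); [exact: IHk|exact: u_cont].
Qed.

Let s_inv k g y : s k (a g y) = s k y.
Proof. by apply: eq_bigr => j _; rewrite u_inv. Qed.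

(** Induction on the number of towers: the last one is joined to the map
    obtained from the others at the parameter [s / (s + u)], where [s] is the sum
    of the previous weights. That map is arbitrary where [s] vanishes, but there
    its value is collapsed by the join. *)
Lemma towers_to_join k : exists f : Y -> join_pow R G k,
  forall y, 0 < \sum_(j < k.+1) u j y ->
    {for y, continuous f} /\ forall g, f (a g y) = gspace_act g (f y).
Proof.
elim: k => [|k [f fP]].
  exists (q 0) => y; rewrite big_ord1 => y0; split; first exact: q_cont.
  by move=> g; exact: q_equiv.
pose t y := s k y / (s k y + u k.+1 y).
pose F y : join_pow R G k.+1 := join_pi (f y, q k.+1 y, clamp01 (t y)).
exists F => y.
have -> : \sum_(j < k.+2) u j y = s k y + u k.+1 y by rewrite big_ord_recr.
move=> y0.
have tc : {for y, continuous t}.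
  apply: (@continuousM R); first exact: s_cont.
  apply: (@continuousV R); first by rewrite gt_eqF.
  by apply: (@continuousD R R^o); [exact: s_cont|exact: u_cont].
have t_inv g : t (a g y) = t y by rewrite /t s_inv u_inv.
have FE g : gspace_act g (F y) =
    join_pi (gspace_act g (f y), (g * q k.+1 y)%g, clamp01 (t y)).
  exact: (@join_mapE R (join_pow R G k) G).
have [s0|sn0] := eqVneq (s k y) 0.
  have t0 : t y = 0 by rewrite /t s0 mul0r.
  have v0 : 0 < u k.+1 y by rewrite s0 add0r in y0.
  split=> [|g].
    apply: join_pi_continuous_at0 => //; [exact: join_pow_compact|exact: q_cont].
  rewrite FE /F t_inv t0 q_equiv//; apply: join_pi0.
  by rewrite val_clamp01// lexx ler01.
have s0 : 0 < s k y by rewrite lt_neqAle eq_sym sn0 s_ge0.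
have [fc feq] := fP _ s0.
have [v0|vn0] := eqVneq (u k.+1 y) 0.
  have t1 : t y = 1 by rewrite /t v0 addr0 divff.
  split=> [|g]; first exact: join_pi_continuous_at1.
  rewrite FE /F t_inv t1 feq; apply: join_pi1.
  by rewrite val_clamp01// lexx ler01.
have v0 : 0 < u k.+1 y by rewrite lt_neqAle eq_sym vn0 u_ge0.
split=> [|g]; first by apply: join_pi_continuous_at => //; exact: q_cont.
by rewrite FE /F t_inv feq q_equiv.
Qed.

End TowersToJoin.

(** * Second order estimates along coordinate paths *)

Section CoordinatePaths.
Context {R : realType}.

Lemma mean_value_bound (phi dphi : R -> R) (t K : R) :
  (forall s : R, `|s| <= `|t| -> is_derive s 1 phi (dphi s)) ->
  (forall s, `|s| <= `|t| -> `|dphi s| <= K) ->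
  `|phi t - phi 0| <= K * `|t|.
Proof.
move=> phiD dphiK.
have cont (A : set R) : (forall s, A s -> `|s| <= `|t|) -> {within A, continuous phi}.
  move=> At; apply: continuous_in_subspaceT => s /[!inE] /At st.
  apply: differentiable_continuous; apply/derivable1_diffP.
  exact: (@ex_derive _ _ _ _ _ _ _ (phiD s st)).
have [t0|t0] := leP 0 t.
  have st s : s \in `[0, t] -> `|s| <= `|t|.
    by rewrite in_itv /= => /andP[s0 st]; rewrite !ger0_norm.
  have [||s s0t ->] := @MVT_segment R phi dphi 0 t t0.
  - by move=> s s0t; apply/phiD/st; exact: subset_itv_oo_cc.
  - by apply: cont => s; exact: st.
  - by rewrite subr0 normrM ler_wpM2r// dphiK// st.
have st s : s \in `[t, 0] -> `|s| <= `|t|.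
  rewrite in_itv /= => /andP[s0 st].
  by rewrite ler0_norm// ltr0_norm// lerN2.
have [||s s0t] := @MVT_segment R phi dphi t 0 (ltW t0).
- by move=> s s0t; apply/phiD/st; exact: subset_itv_oo_cc.
- by apply: cont => s; exact: st.
- rewrite distrC => ->.
  by rewrite sub0r normrM normrN ler_wpM2r// dphiK// st.
Qed.

Context {N : nat}.
Implicit Types (g : 'rV[R]_N -> R) (v w x z : 'rV[R]_N).

Lemma is_derive_line g z v (t d : R) : is_derive (z + t *: v) v g d ->
  is_derive t 1 (fun s => g (z + s *: v)) d.
Proof.
case=> gD gd.
have E : (fun h : R => h^-1 *: (((fun s => g (z + s *: v)) \o shift t) (h *: (1 : R))
      - g (z + t *: v))) =
    (fun h => h^-1 *: ((g \o shift (z + t *: v)) (h *: v) - g (z + t *: v))).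
  apply/funext => h /=; congr (_ *: (g _ - _)).
  by rewrite [h *: _]mulr1 scalerDl addrCA.
by split; [rewrite /derivable E|rewrite -gd /derive E].
Qed.

Definition partial_row w (i : nat) : 'rV[R]_N :=
  \row_j (if (j < i)%N then w 0 j else 0).

Lemma partial_row0 w : partial_row w 0 = 0.
Proof. by apply/rowP => j; rewrite !mxE. Qed.

Lemma partial_row_full w : partial_row w N = w.
Proof. by apply/rowP => j; rewrite !mxE ltn_ord. Qed.

Lemma partial_rowS w (i : 'I_N) :
  partial_row w i.+1 = partial_row w i + w 0 i *: delta_mx 0 i.
Proof.
apply/rowP => j; rewrite !mxE ltnS eqxx /=.
have [->|ji] := eqVneq j i; first by rewrite leqnn ltnn add0r mulr1.
by rewrite leq_eqVlt (inj_eq val_inj) (negbTE ji) mulr0 addr0.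
Qed.

Lemma norm_coord_le w (i : 'I_N) : `|w 0 i| <= `|w|.
Proof.
by rewrite [leRHS]/Num.Def.normr /= mx_normrE; exact: (le_bigmax _ (fun k => `|w k.1 k.2|) (0, i)).
Qed.

Lemma norm_row_le w (K : R) : 0 <= K -> (forall i, `|w 0 i| <= K) -> `|w| <= K.
Proof.
move=> K0 wK; rewrite [leLHS]/Num.Def.normr /= mx_normrE; apply: bigmax_le => //.
by case=> i j _; rewrite ord1; exact: wK.
Qed.

Lemma norm_partial_row w (i : 'I_N) (t : R) : `|t| <= `|w 0 i| ->
  `|partial_row w i + t *: delta_mx 0 i| <= `|w|.
Proof.
move=> tw; apply: norm_row_le => // j; rewrite !mxE eqxx /=.
have [->|ji] := eqVneq j i.
  by rewrite ltnn add0r mulr1 (le_trans tw)// norm_coord_le.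
rewrite mulr0 addr0; case: ifP => _; first exact: norm_coord_le.
by rewrite normr0.
Qed.

Lemma coordinate_path_sum g x w : g (x + w) - g x =
  \sum_(i < N) (g (x + partial_row w i + w 0 i *: delta_mx 0 i) -
                g (x + partial_row w i)).
Proof.
have := @telescope_sumr _ 0%N N (fun i => g (x + partial_row w i)) (leq0n _).
rewrite partial_row_full partial_row0 addr0 => <-; rewrite big_mkord.
by apply: eq_bigr => i _; rewrite partial_rowS addrA.
Qed.

Variables (O : 'rV[R]_N) (r M : R) (g : 'rV[R]_N -> R).
Variable dg : 'I_N -> 'rV[R]_N -> R.
Hypothesis gD : forall x, `|x - O| < r ->
  forall i, is_derive x (delta_mx 0 i) g (dg i x).

Let path_in x w i t : `|x - O| + `|w| < r -> `|t| <= `|w 0 i| ->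
  `|x + partial_row w i + t *: delta_mx 0 i - O| < r.
Proof.
move=> xw tw; apply: le_lt_trans xw.
rewrite -[x + _ + _]addrA addrAC (le_trans (ler_normD _ _))// lerD2l.
exact: norm_partial_row.
Qed.

(** One coordinate at a time, the mean value theorem for functions of one
    variable is enough. The ball for the supremum norm contains the whole
    path. *)
Lemma lipschitz_of_partials x w :
  (forall x, `|x - O| < r -> forall i, `|dg i x| <= M) ->
  `|x - O| + `|w| < r -> `|g (x + w) - g x| <= N%:R * M * `|w|.
Proof.
move=> dgM xw; rewrite coordinate_path_sum (le_trans (ler_norm_sum _ _ _))//.
rewrite (@le_trans _ _ (\sum_(i < N) M * `|w|))//; last first.
  by rewrite big_const_ord iter_addr_0 -mulrA mulr_natl.
apply: ler_sum => i _.
have := @mean_value_bound (fun t => g (x + partial_row w i + t *: delta_mx 0 i))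
  (fun t => dg i (x + partial_row w i + t *: delta_mx 0 i)) (w 0 i) M.
rewrite scale0r addr0 => le; apply: (le_trans (le _ _)).
- by move=> s sw; apply: is_derive_line; exact/gD/path_in.
- by move=> s sw; exact/dgM/path_in.
- rewrite ler_wpM2l ?norm_coord_le//.
  exact: le_trans (normr_ge0 _) (dgM _ (path_in xw (lexx `|w 0 i|)) i).
Qed.

(** The increments of [g] along the coordinate paths of [w] and of [- w] are
    paired: each pair is [w 0 i] times the difference of the values of a partial
    derivative at points whose distance is at most [2 * `|w|]. *)
Lemma midpoint_of_partials (L : R) x w :
  (forall x y, `|x - O| < r -> `|y - O| < r ->
    forall i, `|dg i x - dg i y| <= L * `|x - y|) -> 0 <= L ->
  `|x - O| + `|w| < r ->
  `|g (x + w) + g (x - w) - 2 * g x| <= N%:R * (2 * L) * `|w| ^+ 2.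
Proof.
move=> dgL L0 xw.
have -> : g (x + w) + g (x - w) - 2 * g x =
    (g (x + w) - g x) + (g (x + - w) - g x) by ring.
rewrite !coordinate_path_sum -big_split /= (le_trans (ler_norm_sum _ _ _))//.
rewrite (@le_trans _ _ (\sum_(i < N) (2 * L * `|w|) * `|w|))//; last first.
  rewrite big_const_ord iter_addr_0 -[leLHS]mulr_natl expr2; by rewrite !mulrA.
apply: ler_sum => i _.
have xNw : `|x - O| + `|- w| < r by rewrite normrN.
pose p t := x + partial_row w i + t *: delta_mx 0 i.
pose p' t := x + partial_row (- w) i + t *: delta_mx 0 i.
have pin s : `|s| <= `|w 0 i| -> `|p s - O| < r by exact: path_in.
have p'in s : `|s| <= `|w 0 i| -> `|p' s - O| < r.
  by move=> sw; apply: path_in => //; rewrite mxE normrN.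
have := @mean_value_bound (fun t => g (p t) + g (p' (- t)))
  (fun t => dg i (p t) + dg i (p' (- t)) * (-1)) (w 0 i) (2 * L * `|w|).
rewrite /p /p' oppr0 !scale0r !addr0 -/(p _) -/(p' _) => le.
have -> : (- w) 0 i = - w 0 i by rewrite mxE.
rewrite addrACA -opprD; apply: (le_trans (le _ _)).
- move=> s sw; apply: is_deriveD; first by apply: is_derive_line; exact/gD/pin.
  apply: (@is_derive1_comp R (fun t => g (p' t)) -%R).
    by apply: is_derive_line; apply: gD; apply: p'in; rewrite normrN.
- move=> s sw; rewrite mulrN1.
  apply: (le_trans (dgL _ _ _ _ i)); [exact: pin|by apply: p'in; rewrite normrN|].
  have -> : p s - p' (- s) = (partial_row w i + s *: delta_mx 0 i) *+ 2.
    by apply/rowP => j; rewrite !mxE eqxx /=; case: ifP => _; ring.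
  rewrite normrMn mulrnAr -mulr_natl -mulrA !ler_wpM2l//.
  exact: norm_partial_row.
- by rewrite ler_wpM2l ?norm_coord_le// !mulr_ge0.
Qed.

End CoordinatePaths.

Lemma nbhs_norm_ex {R : realType} {n : nat} (o : 'rV[R]_n) (A : set 'rV[R]_n) :
  nbhs o A -> exists2 r, 0 < r & forall z, `|z - o| < r -> A z.
Proof.
move=> /nbhs_normP[r /= r0 rA]; exists r => // z zo.
by apply: rA; rewrite /ball_ /= distrC.
Qed.

Lemma norm_ex_nbhs {R : realType} {n : nat} (o : 'rV[R]_n) (r : R) : 0 < r ->
  \forall z \near o, `|z - o| < r.
Proof.
move=> r0; apply/nbhs_normP; exists r => //= z.
by rewrite /ball_ /= distrC.
Qed.

Section SquaredNorm.
Context {R : realType} {n : nat}.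
Implicit Types (a b s w : 'rV[R]_n).

Definition sqnorm w : R := \sum_k w 0 k ^+ 2.

Lemma sqnorm_ge0 w : 0 <= sqnorm w.
Proof. by apply: sumr_ge0 => k _; exact: sqr_ge0. Qed.

Lemma le_sqnorm w : `|w| ^+ 2 <= sqnorm w.
Proof.
have [->|w0] := eqVneq `|w| 0; first by rewrite expr0n sqnorm_ge0.
have [[i j] /= wij] := mx_norm_neq0 w0.
have -> : `|w| = `|w i j| by exact: wij.
rewrite ord1 real_normK ?num_real// /sqnorm (bigD1 j)//= lerDl.
by apply: sumr_ge0 => k _; exact: sqr_ge0.
Qed.

Lemma sqnorm_le w (r : R) : `|w| <= r -> sqnorm w <= n%:R * r ^+ 2.
Proof.
move=> wr; rewrite /sqnorm (@le_trans _ _ (\sum_(k < n) r ^+ 2))//; last first.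
  by rewrite big_const_ord iter_addr_0 mulr_natl.
apply: ler_sum => k _; rewrite -[leLHS]real_normK ?num_real//.
have := le_trans (norm_coord_le w k) wr.
by move=> le; rewrite ler_pXn2r ?nnegrE// (le_trans _ le).
Qed.

Lemma sqnorm_continuous : continuous sqnorm.
Proof.
move=> w.
apply: (@cvg_big R 'I_n +%R 0 xpredT (@add_continuous R) _
  (nbhs w) (index_enum 'I_n) (fun k (z : 'rV[R]_n) => z 0 k ^+ 2)) => k _.
by apply: (@continuousM R); exact: coord_continuous.
Qed.

(** By the parallelogram identity, the squared norm of the midpoint of [a] and [b]
    lies [sqnorm (a - b) / 4] below the mean of theirs; this outweighs the error
    of replacing that midpoint by [s]. *)
Lemma sqnorm_midpoint a b s (rho C K D : R) : 0 < D ->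
  `|a| <= rho -> `|b| <= rho -> D <= K * `|a - b| ->
  `|s *+ 2 - a - b| <= C * D ^+ 2 ->
  n%:R * (C * (4 * rho + C * D ^+ 2)) * K ^+ 2 < 1 ->
  sqnorm s < Num.max (sqnorm a) (sqnorm b).
Proof.
move=> D0 ar br DK; set e := s *+ 2 - a - b => eC small.
set X := `|a - b| in DK; set E := `|e| in eC.
have X0 : 0 <= X by exact: normr_ge0.
have E0 : 0 <= E by exact: normr_ge0.
have rho0 : 0 <= rho by exact: le_trans (normr_ge0 _) ar.
have D20 : 0 < D ^+ 2 by rewrite exprn_gt0.
have C0 : 0 <= C by rewrite -(pmulr_lge0 _ D20) (le_trans E0).
have n0 : 0 <= n%:R :> R by rewrite ler0n.
have id4 : 4 * sqnorm s = 2 * sqnorm a + 2 * sqnorm b - sqnorm (a - b)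
    + \sum_k (2 * (a 0 k + b 0 k) * e 0 k + e 0 k ^+ 2).
  rewrite /sqnorm !mulr_sumr -!sumrN -!big_split /=.
  by apply: eq_bigr => k _; rewrite /e !mxE; ring.
have err : \sum_k (2 * (a 0 k + b 0 k) * e 0 k + e 0 k ^+ 2) <=
    n%:R * (E * (4 * rho + E)).
  rewrite (@le_trans _ _ (\sum_(k < n) E * (4 * rho + E)))//; last first.
    by rewrite big_const_ord iter_addr_0 -[leLHS]mulr_natl.
  apply: ler_sum => k _.
  have ek := norm_coord_le e k; have ak := le_trans (norm_coord_le a k) ar.
  have bk := le_trans (norm_coord_le b k) br; rewrite -/E in ek.
  apply: le_trans (ler_norm _) _; rewrite (le_trans (ler_normD _ _))//.
  rewrite [leRHS]mulrDr lerD//.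
    rewrite normrM mulrC ler_pM// normrM ger0_norm//.
    have -> : 4 * rho = 2 * (rho + rho) :> R by ring.
    by rewrite ler_wpM2l// (le_trans (ler_normD _ _))// lerD.
  by rewrite normrX expr2 ler_pM.
have ab := le_sqnorm (a - b); rewrite -/X in ab.
have Xgt : 0 < X.
  by rewrite lt_neqAle X0 andbT eq_sym; apply/eqP => X00; move: DK; rewrite X00 mulr0 leNgt D0.
have D2 : D ^+ 2 <= K ^+ 2 * X ^+ 2.
  by rewrite -exprMn ler_pXn2r ?nnegrE ?(ltW D0)// (le_trans (ltW D0)).
have : E * (4 * rho + E) <= C * (4 * rho + C * D ^+ 2) * (K ^+ 2 * X ^+ 2).
  apply: (@le_trans _ _ (C * D ^+ 2 * (4 * rho + C * D ^+ 2))).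
    by apply: ler_pM => //; [rewrite addr_ge0// mulr_ge0|rewrite lerD2l].
  rewrite mulrAC ler_wpM2l//.
  by rewrite mulr_ge0// addr_ge0 ?mulr_ge0// ltW.
move=> /(ler_wpM2l n0) err2.
have X20 : 0 < X ^+ 2 by rewrite exprn_gt0.
move: small; rewrite -(ltr_pM2r X20) mul1r => small.
have {err2 err} lt4 : 4 * sqnorm s < 2 * sqnorm a + 2 * sqnorm b.
  rewrite id4; move: err err2 small ab; rewrite !mulrA.
  set T := \sum_k _; lra.
rewrite lt_max; apply/orP.
have [?|?] := ltP (sqnorm s) (sqnorm a); [by left|right; lra].
Qed.

End SquaredNorm.

Lemma norm_row_mx_le {R : realType} {n1 n2 : nat} (u : 'rV[R]_n1)
    (v : 'rV[R]_n2) (K : R) :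
  `|u| <= K -> `|v| <= K -> `|row_mx u v| <= K.
Proof.
move=> uK vK; apply: norm_row_le => [|i]; first exact: le_trans uK.
rewrite mxE; case: split_ordP => j _.
  exact: le_trans (norm_coord_le _ _) uK.
exact: le_trans (norm_coord_le _ _) vK.
Qed.

Lemma norm_lsubmx_le {R : realType} {n1 n2 : nat} (z : 'rV[R]_(n1 + n2)) :
  `|lsubmx z| <= `|z|.
Proof. by apply: norm_row_le => // i; rewrite mxE norm_coord_le. Qed.

Lemma norm_rsubmx_le {R : realType} {n1 n2 : nat} (z : 'rV[R]_(n1 + n2)) :
  `|rsubmx z| <= `|z|.
Proof. by apply: norm_row_le => // i; rewrite mxE norm_coord_le. Qed.

Lemma le_sum_term {R : realType} {I : finType} (F : I -> R) (i : I) :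
  (forall j, 0 <= F j) -> F i <= \sum_j F j.
Proof. by move=> F0; rewrite (bigD1 i)//= lerDl sumr_ge0. Qed.

(** The Lipschitz estimate holds for [f] and for its first partial derivatives,
    as the second ones are locally bounded; for the latter it is the hypothesis
    of the midpoint estimate. *)
Lemma C2_estimates {R : realType} {N n : nat} (U : set 'rV[R]_N)
    (f : 'rV[R]_N -> 'rV[R]_n) (O : 'rV[R]_N) :
  nbhs O U -> is_Ck 2 U f ->
  exists r K C : R, [/\ 0 < r, 0 <= K, 0 <= C,
    forall x w, `|x - O| + `|w| < r -> `|f (x + w) - f x| <= K * `|w|
    & forall x w, `|x - O| + `|w| < r ->
      `|f (x + w) + f (x - w) - f x *+ 2| <= C * `|w| ^+ 2].
Proof.
move=> UO [_ fC].
pose D (i : 'I_N) := 'D_(delta_mx 0 i) f : 'rV[R]_N -> 'rV[R]_n.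
pose DD (i j : 'I_N) := 'D_(delta_mx 0 j) (D i) : 'rV[R]_N -> 'rV[R]_n.
have bound (h : 'rV[R]_N -> 'rV[R]_n) : {for O, continuous h} ->
    \forall x \near O, `|h x| <= `|h O| + 1.
  move=> /cvgrPdist_lt/(_ 1 ltr01); apply: filterS => x hx.
  by rewrite -lerBlDl (le_trans (lerB_dist _ _))// distrC ltW.
have OU : U O by exact: nbhs_singleton.
(* A crude common bound for finitely many functions near O. *)
pose M := \sum_i (`|D i O| + 1) + \sum_i \sum_j (`|DD i j O| + 1).
have DM i : `|D i O| + 1 <= M.
  apply: le_trans (@le_sum_term R _ (fun i => `|D i O| + 1) i _) _; first by move=> j; rewrite addr_ge0.
  by rewrite lerDl; do 2! apply: sumr_ge0 => ? _; rewrite addr_ge0.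
have DDM i j : `|DD i j O| + 1 <= M.
  apply: le_trans (@le_sum_term R _ (fun j => `|DD i j O| + 1) j _) _; first by move=> k; rewrite addr_ge0.
  apply: le_trans (@le_sum_term R _ (fun i => \sum_j (`|DD i j O| + 1)) i _) _.
    by move=> k; apply: sumr_ge0 => ? _; rewrite addr_ge0.
  by rewrite lerDr; apply: sumr_ge0 => ? _; rewrite addr_ge0.
have M0 : 0 <= M.
  by rewrite addr_ge0//; [|apply: sumr_ge0 => ? _];
    apply: sumr_ge0 => ? _; rewrite addr_ge0.
have [r r0 rP] : exists2 r, 0 < r & forall x, `|x - O| < r ->
    [/\ U x, forall i, `|D i x| <= M & forall i j, `|DD i j x| <= M].
  apply: nbhs_norm_ex.
  have n1 : \forall x \near O, forall i, `|D i x| <= `|D i O| + 1.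
    apply: (@filter_forall _ _ (fun i x => `|D i x| <= `|D i O| + 1) (nbhs O) _) => i.
    apply: bound.
    by have [_ [Dc _]] := fC i; exact: Dc.
  have n2 : \forall x \near O, forall i, forall j, `|DD i j x| <= `|DD i j O| + 1.
    apply: (@filter_forall _ _
      (fun i x => forall j, `|DD i j x| <= `|DD i j O| + 1) (nbhs O) _) => i.
    apply: (@filter_forall _ _
      (fun j x => `|DD i j x| <= `|DD i j O| + 1) (nbhs O) _) => j.
    apply: bound.
    by have [_ [_ /(_ j) [_ [DDc _]]]] := fC i; exact: DDc.
  apply: filterS3 UO n1 n2 => x Ux DxM DDxM; split=> // [i|i j].
    exact: le_trans (DxM i) (DM i).
  exact: le_trans (DDxM i j) (DDM i j).
pose dg k i x := D i x 0 k.
have gD x : `|x - O| < r -> forall k i,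
    is_derive x (delta_mx 0 i) (fun x => f x 0 k) (dg k i x).
  move=> /rP[Ux _ _] k i; have [/(_ x Ux) fd _] := fC i.
  split; first exact: (derivable_mxP _ _ _).1.
  have := @derive_mx R _ 1 n f x (delta_mx 0 i) fd.
  by move=> /(congr1 (fun A : 'rV[R]_n => A 0 k)); rewrite mxE.
have dgD x : `|x - O| < r -> forall k i j,
    is_derive x (delta_mx 0 j) (dg k i) (DD i j x 0 k).
  move=> /rP[Ux _ _] k i j; have [_ [_ /(_ j) [/(_ x Ux) fd _]]] := fC i.
  split; first exact: (derivable_mxP _ _ _).1 fd 0 k.
  have := @derive_mx R _ 1 n (D i) x (delta_mx 0 j) fd.
  by move=> /(congr1 (fun A : 'rV[R]_n => A 0 k)); rewrite mxE.
have r4 : 0 < r / 4 by rewrite divr_gt0.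
have N0 : 0 <= N%:R :> R by rewrite ler0n.
have r4r : r / 4 <= r by rewrite ler_pdivrMr// ler_peMr// ?ler1n// ltW.
exists (r / 4), (N%:R * M), (N%:R * (2 * (N%:R * M))).
have C0 : 0 <= N%:R * (2 * (N%:R * M)) by rewrite !mulr_ge0.
split => //; first by rewrite mulr_ge0.
  move=> x w xw; apply: norm_row_le => [|k]; first by rewrite !mulr_ge0.
  rewrite mxE [X in _ + X]mxE.
  apply: (@lipschitz_of_partials R N O r M (fun x => f x 0 k) (dg k)).
  - by move=> z zO i; exact: gD.
  - move=> z /rP[_ DzM _] i; exact: le_trans (norm_coord_le _ _) (DzM i).
  - exact: lt_le_trans xw _.
move=> x w xw; apply: norm_row_le => [|k]; first by rewrite mulr_ge0.
have -> : (f (x + w) + f (x - w) - f x *+ 2) 0 k =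
    f (x + w) 0 k + f (x - w) 0 k - 2 * f x 0 k by rewrite !mxE; ring.
apply: (@midpoint_of_partials R N O (r / 4) (fun x => f x 0 k) (dg k)) => //.
- by move=> z zO i; apply: gD; exact: lt_le_trans zO _.
- move=> y z yO zO i.
  have := @lipschitz_of_partials R N O r M (dg k i) (fun j z => DD i j z 0 k)
    _ z (y - z).
  rewrite (_ : z + (y - z) = y); last by rewrite addrC subrK.
  apply.
  + by move=> z' z'O j; exact: dgD.
  + move=> z' /rP[_ _ DDzM] j; exact: le_trans (norm_coord_le _ _) (DDzM i j).
  + have : `|y - z| <= `|y - O| + `|z - O|.
      by rewrite [`|z - O|]distrC; exact: ler_distD.
    by lra.
- by rewrite mulr_ge0.
Qed.

(** * A gauge on a Lie group *)

Lemma nbhs1_mulV {G : topGroupType} (B : set G) : nbhs (1%g : G) B ->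
  exists2 W, nbhs (1%g : G) W &
    forall g h, W g -> W h -> B (g * h)%g /\ B g^-1%g.
Proof.
move=> B1.
have : \forall p \near ((1, 1)%g : G * G), B (p.1 * p.2)%g.
  by apply: (@mulg_continuous G (1, 1)%g) => /=; rewrite mulg1.
case=> -[V W] /= [V1 W1] VW.
have I1 : \forall g \near (1%g : G), B g^-1%g.
  by apply: (@invg_continuous G 1%g); rewrite /= invg1.
exists ((V `&` W) `&` [set g | B g^-1%g]).
  by apply: filterI => //; exact: filterI.
by move=> g h [[Vg _] Bg] [[_ Wh] _]; split => //; exact: (VW (g, h)).
Qed.

Lemma sqnorm_sub_continuous {R : realType} {n : nat} (o : 'rV[R]_n) :
  continuous (fun z : 'rV[R]_n => sqnorm (z - o)).
Proof.
move=> z; apply: (@for_continuous_comp _ _ _ sqnorm (fun z : 'rV[R]_n => z - o)).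
  exact: sqnorm_continuous.
exact: (@cvgB R 'rV[R]_n _ (nbhs z) _ id (fun=> o) z o (@cvg_id _ _) (cvg_cst o)).
Qed.

Section ChartGauge.
Context {R : realType} {G : topGroupType} (hG : hausdorff_space G).
Context {n : nat} (c : chart R G n) (dom1 : chart_dom c 1%g).

Let o := chart_map c 1%g.
Let img_o : chart_img c o. Proof. by exists 1%g. Qed.
Let inv_o : chart_inv c o = 1%g. Proof. exact: chart_mapK. Qed.

Lemma chart_ball (W : set G) : nbhs (1%g : G) W -> exists2 rho : R, 0 < rho &
  forall z, `|z - o| < rho -> chart_img c z /\ W (chart_inv c z).
Proof.
move=> W1; apply: nbhs_norm_ex; apply: filterI.
  by apply: open_nbhs_nbhs; split; [exact: chart_img_open|exact: img_o].
have : chart_inv c z @[z --> o] --> chart_inv c o := chart_inv_cont img_o.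
by rewrite inv_o; apply.
Qed.

Definition chart_nbhd (rho : R) : set G :=
  [set g | chart_dom c g /\ `|chart_map c g - o| < rho].

Lemma nbhs_chart_nbhd rho : 0 < rho -> nbhs (1%g : G) (chart_nbhd rho).
Proof.
move=> rho0; apply: filterI.
  by apply: open_nbhs_nbhs; split; [exact: chart_dom_open|].
have : chart_map c g @[g --> (1%g : G)] --> o := chart_map_cont dom1.
by move=> /(_ _ (norm_ex_nbhs o rho0)).
Qed.

Lemma chart_imgK z : chart_img c z ->
  chart_dom c (chart_inv c z) /\ chart_map c (chart_inv c z) = z.
Proof. by case=> g gc <-; rewrite chart_mapK. Qed.

Definition chart_gauge (tau : R) (g : G) : R :=
  if `[< chart_dom c g >] then Num.min (tau ^+ 2) (sqnorm (chart_map c g - o))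
  else tau ^+ 2.

Lemma chart_gauge_ge0 tau g : 0 <= chart_gauge tau g.
Proof.
by rewrite /chart_gauge; case: ifP => _; rewrite ?le_min !sqr_ge0 ?sqnorm_ge0.
Qed.

Lemma chart_gauge_le tau g : chart_dom c g ->
  chart_gauge tau g <= sqnorm (chart_map c g - o).
Proof. by move=> gc; rewrite /chart_gauge asboolT// ge_min lexx orbT. Qed.

Lemma chart_gaugeE tau g : chart_dom c g ->
  sqnorm (chart_map c g - o) <= tau ^+ 2 ->
  chart_gauge tau g = sqnorm (chart_map c g - o).
Proof. by move=> gc le; rewrite /chart_gauge asboolT// min_r. Qed.

Lemma chart_gauge_lt tau g : chart_gauge tau g < tau ^+ 2 ->
  chart_dom c g /\ chart_gauge tau g = sqnorm (chart_map c g - o).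
Proof.
rewrite /chart_gauge; case: asboolP => [gc|_]; last by rewrite ltxx.
by rewrite gt_min ltxx /= => /ltW le; rewrite min_r.
Qed.

(** The closed ball of radius [tau] of the chart is compact, hence closed in the
    group: near a point outside of the chart the gauge is constant. *)
Lemma chart_gauge_continuous tau : 0 < tau ->
  (forall z, `|z - o| <= tau -> chart_img c z) -> continuous (chart_gauge tau).
Proof.
move=> tau0 tau_img g.
pose h (z : 'rV[R]_n) := Num.min (tau ^+ 2) (sqnorm (z - o)).
have hc : continuous h.
  by move=> z; exact: (@continuous_min R _ (cst (tau ^+ 2)) _ z
    (@cst_continuous _ R (tau ^+ 2) z) (@sqnorm_sub_continuous R n o z)).
have [gc|gc] := pselect (chart_dom c g).
  have near_dom : \forall g' \near g, chart_dom c g'.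
    by apply: open_nbhs_nbhs; split; [exact: chart_dom_open|].
  apply/real_continuousP => e e0.
  have : {for g, continuous (fun g => h (chart_map c g))}.
    apply: (@for_continuous_comp _ _ _ h (chart_map c)); first exact: hc.
    exact: chart_map_cont.
  move=> /real_continuousP/(_ e e0); apply: filterS2 near_dom => g' gc'.
  by rewrite /chart_gauge !asboolT.
pose Z := [set z | sqnorm (z - o) <= tau ^+ 2].
have Ztau z : Z z -> `|z - o| <= tau.
  move=> Zz; rewrite -(@ler_pXn2r _ 2)// ?nnegrE// ?(ltW tau0)//.
  exact: le_trans (le_sqnorm _) Zz.
have cZ : compact Z.
  apply: bounded_closed_compact.
    exists (tau + `|o|); split=> [|M tM z /Ztau zo /=]; first exact: num_real.
    rewrite -(subrK o z) (le_trans (ler_normD _ _))//.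
    by rewrite (le_trans _ (ltW tM))// lerD2r.
  rewrite (_ : Z = (fun z => sqnorm (z - o)) @^-1` [set x | x <= tau ^+ 2])//.
  apply: closed_comp; last exact: closed_le.
  by move=> z _; exact: sqnorm_sub_continuous.
have clK : closed (chart_inv c @` Z).
  apply: compact_closed => //; apply: continuous_compact cZ.
  apply: continuous_in_subspaceT => z; rewrite inE => /Ztau/tau_img.
  exact: chart_inv_cont.
have nearK : \forall g' \near g, (~` (chart_inv c @` Z)) g'.
  apply: open_nbhs_nbhs; split; first exact: closed_openC.
  move=> [z /Ztau/tau_img/chart_imgK[dz _] zg].
  by apply: gc; rewrite -zg.
apply/real_continuousP => e e0; apply: filterS nearK => g' g'K.
suff -> : chart_gauge tau g' = tau ^+ 2.
  by rewrite /chart_gauge asboolF// subrr normr0.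
rewrite /chart_gauge; case: asboolP => // gc'; rewrite min_l//.
rewrite leNgt; apply/negP => lt; apply: g'K; exists (chart_map c g').
  exact: ltW.
exact: chart_mapK.
Qed.

Lemma chart_gauge1 tau : chart_gauge tau 1%g = 0.
Proof.
rewrite /chart_gauge asboolT// subrr.
have -> : sqnorm (0 : 'rV[R]_n) = 0.
  by rewrite /sqnorm big1// => k _; rewrite mxE expr0n.
by rewrite min_r// sqr_ge0.
Qed.

Let S : set 'rV[R]_(n + n) :=
  [set z : 'rV[R]_(n + n) | [/\ chart_img c (lsubmx z), chart_img c (rsubmx z)
    & chart_dom c (chart_inv c (lsubmx z) * chart_inv c (rsubmx z))%g]].
Let m (z : 'rV[R]_(n + n)) :=
  chart_map c (chart_inv c (lsubmx z) * chart_inv c (rsubmx z))%g.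

Let nbhs_S : nbhs (row_mx o o) S.
Proof.
have [W W1 WB] := nbhs1_mulV (nbhs_chart_nbhd ltr01).
have [r r0 rP] := chart_ball W1.
apply: filterS (norm_ex_nbhs (row_mx o o) r0) => z zo.
have lz : `|lsubmx z - o| < r.
  rewrite -{1}(row_mxKl o o) -linearB; exact: le_lt_trans (norm_lsubmx_le _) zo.
have rz : `|rsubmx z - o| < r.
  rewrite -{1}(row_mxKr o o) -linearB; exact: le_lt_trans (norm_rsubmx_le _) zo.
have [il wl] := rP _ lz; have [ir wr] := rP _ rz.
by split=> //; have [[]] := WB _ _ wl wr.
Qed.

Hypothesis smooth_m : smooth_on S m.

(** In the chart, right multiplication by an element close to 1 is bi-Lipschitz
    and maps midpoints to midpoints up to second order, so that the strict
    convexity of the squared Euclidean norm survives it. *)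
Lemma chart_midpoint_gauge : exists (chi : G -> R) (eta : R) (U : set G),
  nbhs (1%g : G) U /\ midpoint_gauge chi eta U.
Proof.
have [r [K [C [r0 K0 C0 lip mid]]]] := C2_estimates nbhs_S (smooth_m 2).
have [tau tau0 tau_img] : exists2 tau, 0 < tau &
    forall z, `|z - o| <= tau -> chart_img c z.
  have [t t0 tP] := chart_ball (@filterT _ (nbhs (1%g : G)) _).
  exists (t / 2); first by rewrite divr_gt0.
  move=> z zt; have [] // : chart_img c z /\ setT (chart_inv c z).
  by apply: tP; apply: le_lt_trans zt _; rewrite ltr_pdivrMr// ltr_pMr// ltr1n.
(* rho bounds all chart coordinates: it makes the error term of the
   parallelogram identity small, keeps the ball below the truncation at tau
   and keeps the estimates on the multiplication available. *)
pose A : R := n%:R * C * K ^+ 2 * (4 + 4 * C) + 1.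
have n0 : 0 <= n%:R :> R by rewrite ler0n.
have A0 : 0 < A by rewrite ltr_wpDl// !mulr_ge0 ?addr_ge0 ?mulr_ge0 ?sqr_ge0.
pose rho := Num.min (Num.min 1 A^-1) (Num.min (tau / n.+1%:R) (r / 8)).
have rho0 : 0 < rho by rewrite !lt_min ltr01 invr_gt0 A0 !divr_gt0.
have rho1 : rho <= 1 by rewrite !ge_min lexx.
have rhoA : rho * A <= 1.
  by rewrite -ler_pdivlMr// mul1r !ge_min lexx !orbT.
have rhot : n%:R * rho ^+ 2 <= tau ^+ 2.
  have rn : rho * n.+1%:R <= tau by rewrite -ler_pdivlMr// !ge_min lexx !orbT.
  apply: (@le_trans _ _ ((rho * n.+1%:R) ^+ 2)).
    rewrite exprMn mulrC ler_wpM2l ?sqr_ge0// -natrX ler_nat.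
    by rewrite -mulnn mulnS leqW// leq_addr.
  by rewrite ler_pXn2r// nnegrE ?(ltW tau0)// mulr_ge0// ltW.
have rhor : 8 * rho <= r.
  have : rho <= r / 8 by rewrite !ge_min lexx !orbT.
  by lra.
have small : n%:R * (C * (4 * rho + C * (2 * rho) ^+ 2)) * K ^+ 2 < 1.
  apply: lt_le_trans rhoA.
  have -> : rho * A = rho * (n%:R * C * K ^+ 2 * (4 + 4 * C)) + rho.
    by rewrite /A; ring.
  rewrite ltr_pwDr//.
  have -> : n%:R * (C * (4 * rho + C * (2 * rho) ^+ 2)) * K ^+ 2 =
      rho * (n%:R * C * K ^+ 2 * (4 + 4 * C * rho)) by ring.
  rewrite ler_wpM2l ?(ltW rho0)// ler_wpM2l ?mulr_ge0 ?sqr_ge0//.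
  by rewrite lerD2l ler_piMr// mulr_ge0.
have [W1 W1n W1P] := nbhs1_mulV (nbhs_chart_nbhd rho0).
pose W := W1 `&` chart_nbhd rho.
have Wn : nbhs (1%g : G) W by apply: filterI => //; exact: nbhs_chart_nbhd.
have [rho' rho'0 rho'P] := chart_ball Wn.
pose eta := Num.min (tau ^+ 2) (rho' ^+ 2) / 2.
have m0 : 0 < Num.min (tau ^+ 2) (rho' ^+ 2) by rewrite lt_min !exprn_gt0.
have eta0 : 0 < eta by rewrite divr_gt0.
have etam : eta < Num.min (tau ^+ 2) (rho' ^+ 2).
  by rewrite ltr_pdivrMr// ltr_pMr// ltr1n.
pose chi := chart_gauge tau.
have chic : continuous chi by exact: chart_gauge_continuous.
have chiP g : chi g <= eta ->
    [/\ chart_dom c g, `|chart_map c g - o| < rho' & W g].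
  move=> ge; have gm := le_lt_trans ge etam; rewrite lt_min in gm.
  case/andP: gm => /chart_gauge_lt[gc gE]; rewrite -/(chi g) in gE.
  rewrite gE => /(le_lt_trans (le_sqnorm _)).
  rewrite ltr_pXn2r// ?nnegrE// ?(ltW rho'0)// => lt; split=> //.
  by rewrite -(chart_mapK gc); have [] := rho'P _ lt.
exists chi, eta, [set k | W k /\ chi k <= eta]; split.
  apply: filterI => //.
  have /real_continuousP/(_ eta eta0) := chic 1%g.
  apply: filterS => k; rewrite /chi chart_gauge1 sub0r normrN => lt.
  exact: ltW (le_lt_trans (ler_norm _) lt).
split=> //; [exact: chart_gauge_ge0|by move=> k []|].
move=> g1 g2 /chiP[d1 r1 w1] /chiP[d2 r2 w2] g12.
pose u1 := chart_map c g1; pose u2 := chart_map c g2.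
pose D := `|u1 - u2|.
have D0 : 0 < D.
  rewrite normr_gt0 subr_eq0; apply/eqP => u12; apply: g12.
  by rewrite -(chart_mapK d1) -(chart_mapK d2) -/u1 -/u2 u12.
pose ub := 2^-1 *: (u1 + u2).
have ubr : `|ub - o| < rho'.
  have -> : ub - o = 2^-1 *: ((u1 - o) + (u2 - o)).
    by apply/rowP => j; rewrite !mxE; field.
  rewrite normrZ ger0_norm ?invr_ge0//; have := ler_normD (u1 - o) (u2 - o).
  by move: r1 r2; rewrite -/u1 -/u2; lra.
have [iub wub] := rho'P _ ubr; have [dub cub] := chart_imgK iub.
pose g := chart_inv c ub.
exists g => k [wk _].
have mE x y : m (row_mx x y) = chart_map c (chart_inv c x * chart_inv c y)%g.
  by rewrite /m row_mxKl row_mxKr.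
have [_ [dk kr]] := wk.
pose v := chart_map c k.
have close x : W x -> chart_nbhd rho (x * k)%g.
  by move=> [x1 _]; have [] := W1P _ _ x1 wk.1.
have [dV Vr] : chart_nbhd rho (k^-1)%g by have [] := W1P _ _ wk.1 wk.1.
have [d1k r1k] := close _ w1; have [d2k r2k] := close _ w2.
have [dgk _] := close _ wub.
pose p1 := chart_map c (g1 * k)%g; pose p2 := chart_map c (g2 * k)%g.
(* Multiplying by k^-1 on the right recovers gi from gi * k, so the lower
   bound is the Lipschitz estimate for the multiplication again. *)
have lower : D <= K * `|p1 - p2|.
  have rec x : chart_dom c x -> chart_dom c (x * k)%g -> chart_map c x =
      m (row_mx (chart_map c (x * k)%g) (chart_map c k^-1%g)).
    by move=> dx dxk; rewrite mE !chart_mapK// mulgK.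
  rewrite /D /u1 /u2 (rec g1)// (rec g2)// -/p1 -/p2.
  set y := chart_map c k^-1%g.
  have := lip (row_mx p2 y) (row_mx (p1 - p2) 0).
  rewrite add_row_mx addr0 [p2 + _]addrC subrK => le.
  have nw : `|row_mx (p1 - p2) (0 : 'rV[R]_n)| <= `|p1 - p2|.
    by apply: norm_row_mx_le => //; rewrite normr0.
  apply: (le_trans (le _)); last by rewrite ler_wpM2l.
  have nx : `|row_mx p2 y - row_mx o o| <= rho.
    by rewrite opp_row_mx add_row_mx; apply: norm_row_mx_le; exact: ltW.
  have : `|p1 - p2| <= `|p1 - o| + `|o - p2| by exact: ler_distD.
  by move: r1k r2k; rewrite -/p1 -/p2 [`|o - _|]distrC; lra.
have upper : `|(chart_map c (g * k)%g - o) *+ 2 - (p1 - o) - (p2 - o)| <=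
    C * D ^+ 2.
  pose w := 2^-1 *: (u1 - u2).
  have := mid (row_mx ub v) (row_mx w 0).
  have -> : - row_mx w (0 : 'rV[R]_n) = row_mx (- w) 0.
    by rewrite opp_row_mx oppr0.
  rewrite !add_row_mx !addr0.
  have -> : ub + w = u1 by apply/rowP => j; rewrite !mxE; field.
  have -> : ub - w = u2 by apply/rowP => j; rewrite !mxE; field.
  rewrite !mE /u1 /u2 /v !chart_mapK// -/g -/p1 -/p2 => le.
  have wD : `|w| = D / 2.
    by rewrite normrZ ger0_norm ?invr_ge0// mulrC.
  have nw : `|row_mx w (0 : 'rV[R]_n)| <= D / 2.
    by apply: norm_row_mx_le; rewrite ?wD// normr0 divr_ge0// ltW.
  have -> : (chart_map c (g * k)%g - o) *+ 2 - (p1 - o) - (p2 - o) =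
      - (p1 + p2 - chart_map c (g * k)%g *+ 2).
    by apply/rowP => j; rewrite !mxE; ring.
  rewrite normrN; apply: (le_trans (le _)); last first.
    rewrite ler_wpM2l// ler_pXn2r// ?nnegrE// ?(ltW D0)//.
    by apply: (le_trans nw); have := ltW D0; lra.
  have nx : `|row_mx ub v - row_mx o o| <= rho.
    rewrite opp_row_mx add_row_mx; apply: norm_row_mx_le; last exact: ltW.
    by rewrite -cub; have [_ []] := wub => _ /ltW.
  have : D <= `|u1 - o| + `|o - u2| by exact: ler_distD.
  move: w1.2.2 w2.2.2; rewrite -/u1 -/u2 [`|o - _|]distrC; move: D0; lra.
have D2 : D <= 2 * rho.
  have : D <= `|u1 - o| + `|o - u2| by exact: ler_distD.
  move: w1.2.2 w2.2.2; rewrite -/u1 -/u2 [`|o - _|]distrC; lra.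
have sqE x : chart_nbhd rho x -> chi x = sqnorm (chart_map c x - o).
  case=> dx xr; apply: chart_gaugeE => //; apply: le_trans rhot.
  exact/sqnorm_le/ltW.
rewrite (sqE (g1 * k)%g)// (sqE (g2 * k)%g)//.
apply: le_lt_trans (chart_gauge_le _ dgk) _.
apply: (sqnorm_midpoint (K := K) D0 (ltW r1k) (ltW r2k) _ upper).
  by rewrite -/p1 -/p2 opprB addrA subrK.
apply: le_lt_trans small; rewrite ler_wpM2r ?sqr_ge0// ler_wpM2l//.
rewrite ler_wpM2l// lerD2l ler_wpM2l// ler_pXn2r// nnegrE ?(ltW D0)//.
by rewrite mulr_ge0// ltW.
Qed.

End ChartGauge.

Lemma lie_group_gauge {R : realType} {G : topGroupType} : lie_group R G ->
  exists (chi : G -> R) (eta : R) (U : set G),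
    nbhs (1%g : G) U /\ midpoint_gauge chi eta U.
Proof.
move=> [hG _ [n [At [[cover _] smooth_mul _]]]].
have [c cAt c1] := cover 1%g.
by apply: (chart_midpoint_gauge hG c1); exact: smooth_mul.
Qed.

(** * Central sequences of a unital commutative algebra *)

Section UnitalCommutative.
Context {R : realType} {A : starAlgType R}.
Hypothesis smulC : forall x y : A, x ** y = y ** x.
Variable one : A.
Hypothesis smulr1 : forall x, x ** one = x.

Local Notation pi0 := (quot_pi (c0 A)).

Fact commutant_full (x : Ainf A) : x \in subalg_pred (commutant A).
Proof.
apply/asboolP => a; elim/(@quot_ind R (linfty A) (c0 A)): x => l.
rewrite [LHS]quot_mulE [RHS]quot_mulE; congr quot_pi.
by apply/val_inj/funext => k; exact: smulC.
Qed.

(** As all bounded sequences are central and the annihilator is trivial, this is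
    the quotient map from bounded sequences onto the central sequence algebra. *)
Definition central_class (l : linfty A) : Finf A :=
  quot_pi (annihilator A) (Subalg (commutant_full (pi0 l))).

Lemma central_class_surj z : exists l, z = central_class l.
Proof.
elim/(@quot_ind R _ (annihilator A)): z => x; exists (quot_repr (val x)).
by congr quot_pi; apply: val_inj; rewrite /= quot_reprK.
Qed.

Lemma central_classD l k :
  central_class (l + k) = central_class l + central_class k.
Proof.
rewrite -[RHS]quot_piD; congr quot_pi; apply: val_inj.
exact: (quot_piD (c0 A)).
Qed.

Lemma central_classZ c l : central_class (c *: l) = c *: central_class l.
Proof.
rewrite -[RHS]quot_piZ; congr quot_pi; apply: val_inj.
exact: (quot_piZ (c0 A)).
Qed.

Lemma central_classM l k :
  central_class (l ** k) = central_class l ** central_class k.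
Proof.
rewrite [RHS]quot_mulE; congr quot_pi; apply: val_inj.
by rewrite [RHS]quot_mulE.
Qed.

Lemma central_class_star l : central_class (star l) = star (central_class l).
Proof.
rewrite [RHS]quot_adjE; congr quot_pi; apply: val_inj.
by rewrite [RHS]quot_adjE.
Qed.

Lemma central_class0 : central_class 0 = 0.
Proof. by rewrite -(scale0r (0 : linfty A)) central_classZ scale0r. Qed.

Lemma central_classB l k :
  central_class (l - k) = central_class l - central_class k.
Proof. by rewrite -scaleN1r central_classD central_classZ scaleN1r. Qed.

Lemma central_class_sum (I : Type) (r : seq I) (F : I -> linfty A) :
  central_class (\sum_(i <- r) F i) = \sum_(i <- r) central_class (F i).
Proof. exact: (big_morph _ central_classD central_class0). Qed.

Let Ainf_mul1 (x : Ainf A) : x ** Ainf_const one = x.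
Proof.
elim/(@quot_ind R (linfty A) (c0 A)): x => l.
rewrite [LHS]quot_mulE; congr quot_pi.
by apply/val_inj/funext => k; exact: smulr1.
Qed.

Lemma central_class_inj l k : central_class l = central_class k ->
  pi0 l = pi0 k.
Proof.
move=> /quot_piP/asboolP/(_ one); rewrite Ainf_mul1 raddfB /= => /eqP.
by rewrite subr_eq0 => /eqP.
Qed.

Lemma central_class_eq0 l : central_class l = 0 ->
  snorm (l k) @[k --> \oo] --> (0 : R).
Proof.
rewrite -central_class0 => /central_class_inj/quot_piP.
by rewrite subr0 => /asboolP.
Qed.

(** Some representative of the class has norm less than [e], by definition of the
    two quotient seminorms; [l] differs from it by a null sequence. *)
Lemma central_class_lt l (e : R) : snorm (central_class l) < e ->
  \forall k \near \oo, snorm (l k) < e.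
Proof.
move=> /(inf_lt (quot_norm_has_inf _).1)[_ [x xl <-]].
move=> /(inf_lt (quot_norm_has_inf _).1)[_ [k kx <-]] ke.
have : central_class k = central_class l.
  by rewrite -xl; congr quot_pi; apply: val_inj.
move=> /central_class_inj/esym/quot_piP/asboolP lk.
have d0 : 0 < e - snorm k by rewrite subr_gt0.
move/cvgrPdist_lt : lk => /(_ _ d0); apply: filterS => j.
rewrite sub0r normrN ger0_norm ?snorm_ge0// => lt.
rewrite -(subrK (k j) (l j)) (le_lt_trans (snormD _ _))//.
by rewrite -ltrBrDr (lt_le_trans lt)// lerB// le_linfty_norm.
Qed.

Lemma central_class_le l : snorm (central_class l) <= snorm l.
Proof. by apply: le_trans (quot_norm_le _ _) _; exact: quot_norm_le. Qed.

Lemma central_class_act {G : groupType} (b : alg_action G A) g l :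
  Finf_act b g (central_class l) = central_class (linfty_act b g l).
Proof.
rewrite [LHS](quot_act_funE (@annihilator_act R G A b)); congr quot_pi; apply: val_inj.
exact: (quot_act_funE (@c0_act R G A b)).
Qed.

Lemma central_class_identity : is_identity (central_class (const_seq one)).
Proof.
have id l : l ** const_seq one = l by apply/val_inj/funext => k; exact: smulr1.
have id' l : const_seq one ** l = l.
  by apply/val_inj/funext => k; rewrite -[RHS]smulr1; exact: smulC.
move=> z; have [l ->] := central_class_surj z.
by rewrite -!central_classM id id'.
Qed.

End UnitalCommutative.

(** * Equicontinuity of representing sequences *)

(** Otherwise there is a decreasing sequence of nonempty open subsets of [V], the
    closure of the next one avoiding [C k], and compactness gives a point in all
    of these closures. *)
Lemma compact_hausdorff_baire (T : topologicalType) (C : nat -> set T)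
    (V : set T) :
  hausdorff_space T -> compact [set: T] -> (forall k, closed (C k)) ->
  open V -> V !=set0 -> V `<=` \bigcup_k C k ->
  exists k (x : T), nbhs x (C k).
Proof.
move=> hT cT clC oV [x0 Vx0] VC; apply: contrapT => nointerior.
pose good (S : set T) := [/\ open S, S !=set0 & S `<=` V].
have step k (S : {S | good S}) : {S' : {S | good S} |
    closure (sval S') `<=` sval S `\` C k}.
  apply: cid; case: S => S [oS [x Sx] SV] /=.
  have [y [Sy Cy]] : exists y, S y /\ ~ C k y.
    apply: contrapT => none; apply: nointerior; exists k, x.
    apply: filterS (open_nbhs_nbhs (conj oS Sx)) => y Sy.
    by apply: contrapT => Cy; apply: none; exists y.
  have Sy' : nbhs y (S `\` C k).
    apply: open_nbhs_nbhs; split; last by split.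
    by rewrite setDE; apply: openI => //; exact: closed_openC.
  have [B By BS] := @compact_regular T y setT hT cT filterT _ Sy'.
  have gB : good (interior B).
    split; [exact: open_interior|by exists y|].
    move=> z /interior_subset Bz; apply: SV.
    by have [] := BS _ (subset_closure Bz).
  exists (exist _ _ gB).
  exact: (subset_trans (closureS (@interior_subset _ B)) BS).
have gV : good V by split => //; exists x0.
pose s := fix s (k : nat) : {S | good S} :=
  if k is k'.+1 then sval (step k' (s k')) else exist _ V gV.
have sS k : closure (sval (s k.+1)) `<=` sval (s k) `\` C k.
  exact: (svalP (step k (s k))).
have s_dec i k : sval (s (k + i)%N) `<=` sval (s k).
  elim: i => [|i IHi]; first by rewrite addn0.
  rewrite addnS; apply: subset_trans IHi => z /subset_closure sz.
  by have [] := sS _ _ sz.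
have pick k : {x | sval (s k) x}.
  by apply: cid; have [_ [x sx] _] := svalP (s k); exists x.
pose x k := sval (pick k).
have [p [_ px]] := cT (x @ \oo) _ (@filterT _ (x @ \oo) _).
have pS k : closure (sval (s k)) p.
  move=> W Wp; apply: px Wp; exists k => // i /= ki.
  by rewrite -(subnKC ki); apply: s_dec; exact: svalP (pick _).
have [k _ pk] : (\bigcup_k C k) p by apply: VC; have [] := sS _ _ (pS 1%N).
by have [_] := sS _ _ (pS k.+1).
Qed.

Section Equicontinuity.
Context {R : realType} {G : topGroupType} (hG : hausdorff_space G).
Context (cG : compact [set: G]).
Context {A : cstarAlgType R} (b : cstar_action G A).
Hypothesis smulC : forall x y : A, x ** y = y ** x.
Variable one : A.
Hypothesis smulr1 : forall x : A, x ** one = x.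
Variable l : linfty A.

Local Notation P := (central_class smulC).

Lemma closed_near_fixed (x : A) (e : R) :
  closed [set g | snorm (b g x - x) <= e].
Proof.
rewrite (_ : [set g | _] = (fun g => snorm (b g x - x)) @^-1` [set t | t <= e])//.
apply: closed_comp; last exact: closed_le.
move=> g _; apply/real_continuousP => d d0.
have /cvgrPdist_lt/(_ d d0) := @cstar_act_cont _ _ _ b x g.
apply: filterS => h; rewrite sub0r normrN ger0_norm ?snorm_ge0// => lt.
have le (u v w : A) : snorm (u - w) <= snorm (u - v) + snorm (v - w).
  by rewrite -(subrKA v) snormD.
have := le (b g x) (b h x) x; have := le (b h x) (b g x) x.
rewrite [snorm (b g x - b h x)]snorm_distC.
by move: lt; rewrite ltr_norml; lra.
Qed.

(** Continuity of the orbit of a class only controls, for each [g], the limit of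
    [snorm (b g (l k) - l k)] as [k] grows. By Baire's theorem, the set where
    this is small from some index [N] on has an interior point [s0] for some [N];
    translating by [s0] gives a neighbourhood of 1. *)
Lemma central_class_equicontinuous (e : R) : 0 < e ->
  P l \in subalg_pred (continuous_part (Finf_act b)) ->
  exists2 V, nbhs (1%g : G) V & exists N, forall k g, (N <= k)%N -> V g ->
    snorm (b g (l k) - l k) <= e.
Proof.
move=> e0 /asboolP/(_ 1%g); have e2 : 0 < e / 2 by rewrite divr_gt0.
move=> /cvgrPdist_lt/(_ _ e2) nearP.
have /nbhs_interior : \forall g \near (1%g : G),
    \forall k \near \oo, snorm (b g (l k) - l k) < e / 2.
  apply: filterS nearP => g.
  rewrite sub0r normrN ger0_norm ?snorm_ge0// act_one.
  by rewrite central_class_act -central_classB => /(central_class_lt smulr1).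
set V0 := interior _ => V01.
pose C (N : nat) := [set g | forall k, (N <= k)%N -> snorm (b g (l k) - l k) <= e / 2].
have [N [s0 s0N]] : exists N (s : G), nbhs s (C N).
  apply: (compact_hausdorff_baire (V := V0)) => //.
  - move=> N; rewrite (_ : C N = \bigcap_(k in [set k | (N <= k)%N])
      [set g | snorm (b g (l k) - l k) <= e / 2])//.
    by apply: closed_bigI => k _; exact: closed_near_fixed.
  - exact: open_interior.
  - by exists 1%g; exact: nbhs_singleton.
  - move=> g /interior_subset[N _ NP]; exists N => // k Nk.
    exact/ltW/NP.
exists [set s | C N (s * s0)%g].
  have := @mulg_continuousr G s0 1%g.
  by rewrite mul1g; apply.
exists N => k s Nk sC.
have -> : b s (l k) - l k = b s (l k - b s0 (l k)) + (b (s * s0)%g (l k) - l k).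
  by rewrite actB -act_comp subrKA.
rewrite (le_trans (snormD _ _))// [leRHS]splitr lerD//.
  by rewrite act_norm snorm_distC; exact: (nbhs_singleton s0N).
exact: sC.
Qed.

(** For a single [g] this is convergence to 0; equicontinuity makes it locally
    uniform in [g], and compactness uniform. *)
Lemma central_class_orthogonal_translates (U : set G) (e : R) : 0 < e ->
  open U -> P l \in subalg_pred (continuous_part (Finf_act b)) ->
  (forall g, ~ U g -> P l ** Finf_act b g (P l) = 0) ->
  \forall k \near \oo, forall g, ~ U g -> snorm (l k ** b g (l k)) <= e.
Proof.
move=> e0 oU lc orth.
have : \forall k \near \oo, setT `<=`
    (fun g => ~ U g -> snorm (l k ** b g (l k)) <= e).
  apply: ((@compact_near_coveringP G setT).1 cG nat \oo
    (fun k g => ~ U g -> snorm (l k ** b g (l k)) <= e)) => s _.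
  have [Us|Us] := pselect (U s).
    exists (U, setT) => /=; last by move=> [g k] /= [].
    by split; [exact: open_nbhs_nbhs|exact: filterT].
  have M0 : 0 <= linfty_norm l by exact: linfty_norm_ge0.
  pose e' := e / (2 * (linfty_norm l + 1)).
  have e'0 : 0 < e' by rewrite divr_gt0// mulr_gt0// ltr_wpDl.
  have [V V1 [N VN]] := central_class_equicontinuous e'0 lc.
  have e2 : 0 < e / 2 by rewrite divr_gt0.
  have := orth s Us; rewrite central_class_act -central_classM.
  move=> /(central_class_eq0 smulr1)/cvgrPdist_lt/(_ _ e2) near_s.
  exists ([set g | V (s^-1 * g)%g], [set k | (N <= k)%N /\
      snorm (l k ** b s (l k)) < e / 2]).
    split => /=.
      have := @mulg_continuousl G s^-1%g s.
      by rewrite mulVg; apply.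
    apply: filterI; first by exists N.
    apply: filterS near_s => k.
    by rewrite sub0r normrN ger0_norm ?snorm_ge0.
  move=> [g k] /= [Vg [Nk ks]] _.
  have -> : l k ** b g (l k) = l k ** b s (l k)
      + l k ** b s (b (s^-1 * g)%g (l k) - l k).
    by rewrite actB -act_comp mulVKg smulBr addrC subrK.
  rewrite (le_trans (snormD _ _))// [leRHS]splitr lerD// ?(ltW ks)//.
  apply: le_trans (snormM _ _) _; rewrite act_norm.
  apply: (@le_trans _ _ ((linfty_norm l + 1) * e')).
    apply: ler_pM; rewrite ?snorm_ge0//.
      by rewrite (le_trans (le_linfty_norm l k))// lerDl.
    exact: VN.
  have M1 : linfty_norm l + 1 != 0 by rewrite gt_eqF// ltr_wpDl.
  rewrite /e' le_eqVlt; apply/orP; left; apply/eqP; field.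
  exact: M1.
by apply: filterS => k kP g; exact: kP.
Qed.

End Equicontinuity.

(** * From Rokhlin towers to the join *)

Lemma normc_real {R : realType} (x : R) : normc x%:C = `|x|.
Proof. by rewrite /normc /= expr0n addr0 sqrtr_sqr. Qed.

Lemma real_continuous_fun {R : realType} {Y : topologicalType} (f : Y -> R) :
  continuous f -> (fun y => (f y)%:C) \in @continuous_fun_pred R Y.
Proof.
move=> fc; apply/asboolP => y; apply/complex_continuousP => e e0.
have /real_continuousP/(_ e e0) := fc y.
apply: filterS => y'.
have E : normc ((f y)%:C - (f y')%:C) = `|f y - f y'|.
  by rewrite -rmorphB normc_real.
by rewrite -E.
Qed.

Definition real_cfun {R : realType} {Y : topologicalType} (cY : compact [set: Y])
    (f : Y -> R) (fc : continuous f) : cfun R cY :=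
  Cfun cY (real_continuous_fun fc).

Lemma normc_cfun_continuous {R : realType} {Y : topologicalType}
    {cY : compact [set: Y]} (f : cfun R cY) : continuous (fun y => normc (f y)).
Proof.
move=> y; apply/real_continuousP => e e0.
apply: filterS (cfun_near f y e0) => y' lt.
have le z w : normc z <= normc (z - w) + normc w :> R.
  by rewrite -{1}(subrK w z) le_normcD.
have := le (f y) (f y'); have := le (f y') (f y); rewrite (normc_distC (f y')).
by rewrite ltr_norml; move: lt; lra.
Qed.

Lemma cfun_smulC {R : realType} {Y : topologicalType} {cY : compact [set: Y]}
  (f h : cfun R cY) : f ** h = h ** f.
Proof. by apply/val_inj/funext => y; exact: mulrC. Qed.

Lemma cfun_smulr1 {R : realType} {Y : topologicalType} {cY : compact [set: Y]}
  (f : cfun R cY) : f ** cfun_one = f.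
Proof. by apply/val_inj/funext => y; exact: mulr1. Qed.

Lemma cfun_sumE {R : realType} {Y : topologicalType} {cY : compact [set: Y]}
    (I : Type) (r : seq I) (F : I -> cfun R cY) y :
  (\sum_(i <- r) F i) y = \sum_(i <- r) F i y.
Proof. exact: (big_morph (fun f : cfun R cY => f y)). Qed.

Lemma linfty_sumE {R : realType} {A : starAlgType R} (I : Type) (r : seq I)
    (F : I -> linfty A) k :
  (\sum_(i <- r) F i) k = \sum_(i <- r) F i k.
Proof. exact: (big_morph (fun l : linfty A => l k)). Qed.

Section Bump.
Context {R : realType} {G : topGroupType} (hG : hausdorff_space G).
Context (cG : compact [set: G]).

Lemma bump_exists (V : set G) : nbhs (1%g : G) V ->
  exists f : G -> R, [/\ continuous f, f 1%g = 1 & forall x, f x != 0 -> V x].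
Proof.
move=> V1.
have : @uniform_separator G (~` V°) [set 1%g].
  apply: normal_uniform_separator.
  - exact: compact_normal.
  - by apply: open_closedC; exact: open_interior.
  - by apply: compact_closed => //; exact: compact_set1.
  - by rewrite -subset0 => x [nV /= x1]; apply: nV; rewrite x1; exact: V1.
move=> /(@uniform_separatorP G R)[f [fc _ f0 f1]]; exists f; split => //.
  by apply: f1; exists 1%g.
move=> x fx; apply: interior_subset; apply: contrapT => nV.
by move/eqP: fx; apply; apply: f0; exists x.
Qed.

Lemma finite_translate_cover (V : set G) : nbhs (1%g : G) V ->
  exists s : seq G, forall x, exists2 g, g \in s & V (g^-1 * x)%g.
Proof.
move=> V1.
(* Compactness is applied along the filter of sequences ordered by inclusion. *)
pose F := filter_from setT (fun s0 : seq G => [set s : seq G | {subset s0 <= s}]).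
have FF : Filter F.
  apply: filter_from_filter; first by exists [::].
  move=> s t _ _; exists (s ++ t) => // u su; split=> x xs; apply: su;
    by rewrite mem_cat xs ?orbT.
have [s0 _ s0P] : \forall s \near F,
    setT `<=` (fun x => exists2 g, g \in s & V (g^-1 * x)%g).
  apply: ((@compact_near_coveringP G setT).1 cG _ F
    (fun s x => exists2 g, g \in s & V (g^-1 * x)%g)) => x _.
  exists ([set y | V (x^-1 * y)%g], [set s : seq G | {subset [:: x] <= s}]).
    split => /=; last by exists [:: x].
    have := @mulg_continuousl G x^-1%g x.
    by rewrite mulVg; apply.
  by move=> [y s] /= [Vy xs]; exists x => //; apply: xs; rewrite mem_head.
by exists s0 => x; exact: (s0P s0 _ x I).
Qed.

End Bump.

Lemma completely_positive_square {R : realType} {A B : starAlgType R}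
    (f : A -> B) (p : A) :
  completely_positive f -> exists q, f (star p ** p) = star q ** q.
Proof.
move=> /(_ 1%N (\matrix_(i, j) (star p ** p))) [|Z ZE].
  by exists (\matrix_(i, j) p) => i j; rewrite big_ord1 !mxE.
by exists (Z 0 0); have := ZE 0 0; rewrite big_ord1 !mxE.
Qed.

Lemma is_identity_unique {R : realType} {A : starAlgType R} (e e' : A) :
  is_identity e -> is_identity e' -> e = e'.
Proof. by move=> eP e'P; rewrite -(e'P e).2 (eP e').1. Qed.

Lemma normc_sum_le {R : realType} (I : Type) (r : seq I) (F : I -> R[i]) :
  normc (\sum_(i <- r) F i) <= \sum_(i <- r) normc (F i).
Proof.
elim: r => [|i r IHr]; first by rewrite !big_nil normc0.
by rewrite !big_cons (le_trans (le_normcD _ _))// lerD2l.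
Qed.

Lemma conjc_mul_normc {R : realType} (z : R[i]) : z^*%C * z = (normc z ^+ 2)%:C.
Proof.
case: z => x y; rewrite /normc sqr_sqrtr ?addr_ge0 ?sqr_ge0//.
by simpc; congr (_ +i* _); ring.
Qed.

Section RokhlinBumps.
Context {R : realType} {G : topGroupType} (hG : hausdorff_space G).
Context (cG : compact [set: G]).
Context {Y : topologicalType} (cY : compact [set: Y]).
Context (a : continuous_action G Y).

Local Notation alpha := (induced_action (R := R) cY a).
Local Notation A := (cfun R cY).
Local Notation P := (central_class (@cfun_smulC R Y cY)).

(** [e j] is the modulus of a term of a sequence representing the image of a bump
    [b] under the [j]-th tower, cut off at [delta]. If [~ U g], then [b] and its
    translate by [g] are orthogonal, and order zero maps preserve this. Finitely
    many translates of [b] add up to at least 1/2; by positivity so do those of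
    the images over all towers, up to a small error, and one of them is
    large. *)
Lemma rokhlin_bumps (d : nat) (U : set G) : nbhs (1%g : G) U ->
  has_rokhlin_towers cG alpha d ->
  exists e : 'I_d.+1 -> Y -> R,
    [/\ forall j, continuous (e j), forall j y, 0 <= e j y,
        forall j y g, 0 < e j y -> 0 < e j (a g y) -> U g
      & forall y, exists j g, 0 < e j (a g y)].
Proof.
move=> /nbhs_interior U1 [phi [phiP _ phi1]].
have [W W1 WU] := nbhs1_mulV U1.
have [W' W'1 WW'] := nbhs1_mulV W1.
(* If f is nonzero at x and at g^-1 * x, then g is in the interior of U. *)
have [f [fc f1 fW]] := bump_exists (R := R) hG cG (filterI W1 W'1).
have f2c : continuous (fun x => f x ^+ 2).
  by move=> x; apply: (@continuousM R); exact: fc.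
have [s sP] : exists s : seq G, forall x, exists2 g, g \in s &
    2^-1 < f (g^-1 * x)%g ^+ 2.
  apply: (finite_translate_cover cG (V := [set x | 2^-1 < f x ^+ 2])).
  have h0 : 0 < (2^-1 : R) by rewrite invr_gt0.
  have /real_continuousP/(_ _ h0) := f2c 1%g.
  apply: filterS => x; rewrite f1 expr1n ltr_norml /= => /andP[_]; lra.
pose y := real_cfun cG fc; pose b := star y ** y.
have bE x : b x = (f x ^+ 2)%:C.
  by rewrite expr2 rmorphM /= -[X in _ = X * _]conjc_real.
pose F x := \sum_(g <- s) f (g^-1 * x)%g ^+ 2.
have F2 x : 2^-1 <= F x.
  have [g gs /ltW fg] := sP x; apply: le_trans fg _.
  rewrite /F (big_rem g)//= lerDl; apply: sumr_ge0 => h _; exact: sqr_ge0.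
have Fc : continuous (fun x => Num.sqrt (F x - 2^-1)).
  move=> x; apply: (@for_continuous_comp _ _ _ Num.sqrt (fun x => F x - 2^-1)).
    exact: sqrt_continuous.
  apply: (@cvgB R R^o); last exact: cvg_cst.
  apply: (@cvg_big R G +%R 0 xpredT (@add_continuous R) _
    (nbhs x) s (fun g x => f (g^-1 * x)%g ^+ 2)) => g _.
  apply: (@for_continuous_comp _ _ _ (fun x => f x ^+ 2) (fun x => (g^-1 * x)%g)).
    exact: f2c.
  exact: mulg_continuousl.
(* Positive elements are squares by definition, whence this square root. *)
pose p := real_cfun cG Fc.
have bsum : \sum_(g <- s) translation_action cG g b =
    (2^-1)%:C *: cfun_one + star p ** p :> cfun R cG.
  apply/val_inj/funext => x; rewrite [LHS](cfun_sumE _ _ x).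
  have -> : \sum_(g <- s) (translation_action cG g b : cfun R cG) x = (F x)%:C.
    rewrite /F rmorph_sum /=; apply: eq_bigr => g _; exact: bE.
  set r := Num.sqrt (F x - 2^-1).
  have -> : F x = 2^-1 + r * r by rewrite -expr2 sqr_sqrtr ?subr_ge0// addrC subrK.
  rewrite rmorphD rmorphM /=.
  transitivity ((2^-1)%:C * 1 + r%:C^*%C * r%:C); last by [].
  by rewrite conjc_real mulr1.
have /choice[l lP] : forall j, exists l : linfty A, val (phi j b) = P l.
  by move=> j; exact: (central_class_surj (@cfun_smulC R Y cY)).
have /choice[k kP] : forall j, exists k : linfty A,
    val (phi j (star p ** p)) = P (star k ** k).
  move=> j; have [/(completely_positive_square p)[q qE] _ _ _] := phiP j.
  have [k kE] := central_class_surj (@cfun_smulC R Y cY) (val q).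
  by exists k; rewrite qE central_classM central_class_star -kE.
(* The image of bsum under all towers, lifted to a null sequence. *)
pose D := \sum_j \sum_(g <- s) linfty_act alpha g (l j) -
  ((2^-1)%:C *: const_seq (cfun_one : A) + \sum_j star (k j) ** k j).
have PD0 : P D = 0.
  apply/eqP; rewrite central_classB subr_eq0; apply/eqP.
  rewrite central_classD central_classZ !central_class_sum.
  rewrite -(is_identity_unique phi1
    (central_class_identity (@cfun_smulC R Y cY) (@cfun_smulr1 R Y cY))).
  rewrite scaler_sumr -big_split /=; apply: eq_bigr => j _.
  rewrite central_class_sum -kP -[RHS]/(val ((2^-1)%:C *: phi j cfun_one +
    phi j (star p ** p))) -linearZ -linearD -bsum linear_sum.
  rewrite (big_morph val (fun _ _ => erefl) erefl); apply: eq_bigr => g _.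
  have [_ _ _ ->] := phiP j; transitivity (Finf_act alpha g (P (l j))).
    by rewrite central_class_act.
  by rewrite -lP.
(* m terms of size at most delta add up to at most 1/4. *)
pose m : R := (d.+1 * size s)%:R + 1.
have m0 : 0 < m by rewrite ltr_wpDl.
pose delta := (4 * m)^-1.
have delta0 : 0 < delta by rewrite invr_gt0 mulr_gt0.
have [N [DN orthN]] : exists N, snorm (D N) < 4^-1 /\
    forall j g, ~ U° g -> snorm (l j N ** alpha g (l j N)) <= delta ^+ 2.
  have h4 : 0 < (4^-1 : R) by rewrite invr_gt0.
  have near1 : \forall N \near \oo, snorm (D N) < 4^-1.
    have /cvgrPdist_lt/(_ _ h4) :=
      central_class_eq0 (@cfun_smulr1 R Y cY) PD0.
    by apply: filterS => N; rewrite sub0r normrN ger0_norm ?snorm_ge0.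
  have near2 : \forall N \near \oo, forall j, forall g, ~ U° g ->
      snorm (l j N ** alpha g (l j N)) <= delta ^+ 2.
    apply: (@filter_forall _ _ (fun j N => forall g, ~ U° g ->
      snorm (l j N ** alpha g (l j N)) <= delta ^+ 2) \oo _) => j.
    apply: (central_class_orthogonal_translates
      (smulC := @cfun_smulC R Y cY) hG cG (@cfun_smulr1 R Y cY)).
    - by rewrite exprn_gt0.
    - exact: open_interior.
    - by rewrite -lP; exact: subalg_valP.
    move=> g Ug; have [_ _ oz eqv] := phiP j.
    rewrite -lP -[X in _ ** X]/(val (Finf_cont_act alpha g (phi j b))) -eqv.
    have -> : (0 : Finf A) = val (0 : subalg (Finf_cont alpha)) by [].
    rewrite -(oz b (translation_action cG g b))//.
    - by exists y.
    - by exists (translation_action cG g y); rewrite act_mul act_star.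
    apply/val_inj/funext => x; 
    transitivity (b x * b (g^-1 * x)%g : R[i]); first by [].
    transitivity (0 : R[i]); last by [].
    rewrite !bE.
    have z2 : ((0 : R) ^+ 2)%:C = 0 by rewrite expr0n.
    have [->|fx] := eqVneq (f x) 0; first by rewrite z2 mul0r.
    have [->|fgx] := eqVneq (f (g^-1 * x)%g) 0; first by rewrite z2 mulr0.
    have [Wx _] := fW _ fx; have [_ W'x] := fW _ fgx.
    have [_ Wgx] := WW' _ _ W'x W'x.
    by have [] := WU _ _ Wx Wgx; rewrite invgM invgK mulVKg.
  by have [N [? ?]] := filter_ex (filterI near1 near2); exists N.
pose e j y := Num.max 0 (normc (l j N y) - delta).
have e_gt0 j z : 0 < e j z -> delta < normc (l j N z).
  by rewrite lt_max ltxx /= subr_gt0.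
exists e; split.
- move=> j z; apply: (@continuous_max R Y (cst 0) (fun z => normc (l j N z) - delta)).
    exact: cst_continuous.
  apply: (@cvgB R R^o); last exact: cvg_cst.
  exact: normc_cfun_continuous.
- by move=> j z; rewrite le_max lexx.
- move=> j z g /e_gt0 z0 /e_gt0 gz0; apply: interior_subset.
  apply: contrapT => /(orthN j).
  move=> /(le_trans (le_cfun_norm _ (a g z))).
  rewrite [X in normc X](_ : _ = l j N (a g z) * l j N (a g^-1%g (a g z)))//.
  rewrite -gactM mulVg gact1 normcM leNgt expr2.
  by rewrite ltr_pM// ltW.
move=> z; apply: contrapT => none.
have small j g : normc (l j N (a g^-1%g z)) <= delta.
  rewrite leNgt; apply/negP => lt; apply: none; exists j, g^-1%g.
  by rewrite lt_max subr_gt0 lt orbT.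
have := le_lt_trans (le_cfun_norm (D N) z) DN.
pose S := \sum_j \sum_(g <- s) l j N (a g^-1%g z).
pose t := \sum_j normc (k j N z) ^+ 2.
have -> : D N z = S - (2^-1 + t)%:C.
  have evalB (x x' : linfty A) : (x - x') N z = x N z - x' N z by [].
  have evalD (x x' : linfty A) : (x + x') N z = x N z + x' N z by [].
  rewrite evalB evalD rmorphD; congr (_ - (_ + _)); last 1 first.
  - rewrite linfty_sumE cfun_sumE /t rmorph_sum; apply: eq_bigr => j _.
    exact: conjc_mul_normc.
  - by rewrite linfty_sumE cfun_sumE; apply: eq_bigr => j _;
      rewrite linfty_sumE cfun_sumE.
  - exact: mulr1.
have t0 : 0 <= t by apply: sumr_ge0 => j _; exact: sqr_ge0.
have S4 : normc S <= 4^-1.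
  rewrite (le_trans (normc_sum_le _ _))//.
  apply: (@le_trans _ _ (\sum_(j < d.+1) \sum_(g <- s) delta)).
    apply: ler_sum => j _; rewrite (le_trans (normc_sum_le _ _))//.
    by apply: ler_sum => g _; exact: small.
  rewrite big_const_ord big_const_seq !iter_addr_0 count_predT -mulrnA.
  rewrite -[leLHS]mulr_natr /delta invfM -mulrA ler_piMr ?invr_ge0//.
  by rewrite mulrC ler_pdivrMr// mul1r mulnC /m lerDl.
have : normc (2^-1 + t)%:C <= normc S + normc (S - (2^-1 + t)%:C).
  by rewrite (normc_distC S) -{1}(subrK S (2^-1 + t)%:C) addrC le_normcD.
rewrite normc_real ger0_norm ?addr_ge0 ?invr_ge0//.
move: S4 t0; lra.
Qed.

End RokhlinBumps.

(** The inverse of [orbit_center] is an equivariant map to the group, on the set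
    where the [orbit_weight] of the tower is positive. *)
Lemma rokhlin_towers_to_join {R : realType} {G : topGroupType}
    (cG : compact [set: G]) (lieG : lie_group R G) {Y : topologicalType}
    (cY : compact [set: Y]) (a : continuous_action G Y) (d : nat) :
  has_rokhlin_towers cG (induced_action (R := R) cY a) d ->
  maps_to_join R a d.+1.
Proof.
move=> towers; split => //.
have [chi [eta [U [U1 chiP]]]] := lie_group_gauge lieG.
have [hG _ _] := lieG.
have [e [ec e0 esep ecov]] := rokhlin_bumps hG U1 towers.
pose u (j : nat) := orbit_weight a (e (inord j)).
pose q (j : nat) y := (orbit_center cG a chiP (ec (inord j)) (e0 (inord j)) y)^-1%g.
have [|||||f fP] := @towers_to_join R G cG Y a u q _ _ _ _ _ d.
- by move=> j y; exact: orbit_weight_ge0.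
- by move=> j; exact: orbit_weight_continuous.
- by move=> j g y; exact: orbit_weight_inv.
- move=> j y u0; apply: (@for_continuous_comp _ _ _ (fun x : G => x^-1%g)).
    exact: invg_continuous.
  by apply: orbit_center_continuous => // z g; exact: esep.
- move=> j g y u0; rewrite /q orbit_center_act ?invgM ?invgK// => z h.
  exact: esep.
have pos y : 0 < \sum_(j < d.+1) u j y.
  have [j [g eg]] := ecov y.
  rewrite (bigD1 j)//= ltr_pwDl ?sumr_ge0// => [|i _]; last exact: orbit_weight_ge0.
  by rewrite /u inord_val; exact: (orbit_weight_gt0 cG _ (e0 j) eg).
exists f; split => [y|g y]; first by have [] := fP y (pos y).
by have [_ ->] := fP y (pos y).
Qed.

(** * From the join to Rokhlin towers *)

Lemma sqrtr_itv01 {R : realType} (x : R) : x <= 1 -> 0 <= Num.sqrt x <= 1.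
Proof. by move=> x1; rewrite sqrtr_ge0 -[leRHS]sqrtr1 ler_sqrt. Qed.

Section JoinTowers.
Context {R : realType} {G : topGroupType}.

(** A point of the join with [j]-th barycentric weight [w] and [j]-th coordinate
    [x] is seen as the functional [h |-> sqrt w * h x], which remains continuous
    where [x] is undefined because [w] vanishes. With the square root, the product
    of the functionals of [star h] and [h'] is [w] times the value of
    [star h ** h'] at [x]. *)
Fixpoint join_coord (k j : nat) (h : G -> R[i]) : join_pow R G k -> R[i] :=
  if k is k'.+1 then fun z : top_join R (join_pow R G k') G =>
    let p := join_repr z in
    if j == k'.+1 then (Num.sqrt (1 - val p.2))%:C * h p.1.2
    else (Num.sqrt (val p.2))%:C * join_coord j h p.1.1
  else fun x : G => if j == 0%N then h x else 0.

Lemma join_coordS k j h x y t :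
  join_coord (k := k.+1) j h (join_pi (x, y, t)) =
  if j == k.+1 then (Num.sqrt (1 - val t))%:C * h y
  else (Num.sqrt (val t))%:C * join_coord (k := k) j h x.
Proof.
rewrite /=; have /eqmodP/asboolP : join_repr (join_pi (x, y, t)) = (x, y, t)
  %[mod {eq_quot (join_equiv R (join_pow R G k) G)}] by exact: reprK.
case: (join_repr _) => -[x' y'] t' /= h'.
case: h' => [[-> -> ->]//|/= [-> -> ->]|/= [-> -> ->]].
  by case: ifP => // _; rewrite sqrtr0 !mul0r.
by case: ifP => // _; rewrite subrr sqrtr0 !mul0r.
Qed.

Lemma join_ind k (Q : join_pow R G k.+1 -> Prop) :
  (forall x y t, Q (join_pi (x, y, t))) -> forall z, Q z.
Proof.
move=> Qpi z; have <- : join_pi (join_repr z) = z by exact: reprK.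
by case: (join_repr z) => -[x y] t; exact: Qpi.
Qed.

(** Algebraic identities for the coordinates reduce to this pointwise form. *)
Lemma join_coord_point k j (z : join_pow R G k) : exists (w : R) (x : G),
  0 <= w <= 1 /\ forall h, join_coord j h z = w%:C * h x.
Proof.
elim: k j z => [|k IHk] j z.
  exists (j == 0%N)%:R, z; split; first by case: eqP; rewrite ?lexx ?ler01.
  by move=> h /=; case: eqP; rewrite ?mul1r ?mul0r.
elim/join_ind: z => x y t.
have t01 : 0 <= val t <= 1 by have := set_valP t; rewrite /= in_itv.
have [t0 t1] := andP t01.
have [jk|jk] := eqVneq j k.+1.
  exists (Num.sqrt (1 - val t)), y; split=> [|h]; last by rewrite join_coordS jk eqxx.
  by apply: sqrtr_itv01; rewrite gerBl.
have [w [x' [/andP[w0 w1] wE]]] := IHk j x.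
exists (Num.sqrt (val t) * w), x'; split=> [|h].
  have /andP[st0 st1] := sqrtr_itv01 t1.
  by rewrite mulr_ge0//= mulr_ile1.
by rewrite join_coordS (negbTE jk) wE rmorphM mulrA.
Qed.

Lemma join_coord_act k j h g (z : join_pow R G k) :
  join_coord j h (gspace_act g z) = join_coord j (fun x => h (g * x)%g) z.
Proof.
elim: k j z => [|k IHk] j z //.
elim/join_ind: z => x y t.
have -> : gspace_act g (join_pi (x, y, t) : join_pow R G k.+1) =
    join_pi (gspace_act g x, (g * y)%g, t) by exact: join_mapE.
by rewrite !join_coordS IHk.
Qed.

Lemma join_coord_continuous k j (h : G -> R[i]^o) : continuous h ->
  continuous (join_coord j h : join_pow R G k -> R[i]^o).
Proof.
move=> hc; elim: k => [|k IHk].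
  have -> : (join_coord j h : join_pow R G 0 -> R[i]^o) =
      if j == 0%N then h else fun=> 0 by apply/funext => x /=; case: ifP.
  by case: ifP => _ x; [exact: hc|exact: cvg_cst].
apply/quotient_continuous => -[[x y] t].
pose XT := (join_pow R G k * G * set_type (`[0 : R, 1]%classic))%type.
have -> : (join_coord j h : join_pow R G k.+1 -> R[i]^o) \o \pi =
    fun p : XT => if j == k.+1 then (Num.sqrt (1 - val p.2))%:C * h p.1.2
      else (Num.sqrt (val p.2))%:C * join_coord j h p.1.1.
  by apply/funext => -[[x' y'] t']; exact: join_coordS.
have sqrtC (f : R -> R) (fc : continuous f) :
    continuous (fun p : XT => (Num.sqrt (f (val p.2)))%:C : R[i]^o).
  have valc : continuous (fun p : XT => Num.sqrt (f (val p.2))).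
    move=> p; apply: (@for_continuous_comp XT R R Num.sqrt
      (fun p : XT => f (val p.2))); first exact: sqrt_continuous.
    apply: (@for_continuous_comp XT R R f (fun p : XT => val p.2)).
      exact: fc.
    apply: (@for_continuous_comp XT (set_type (`[0 : R, 1]%classic)) R
      (fun t => val t) (fun p => p.2)); last exact: cvg_snd.
    exact: initial_continuous.
  by have /asboolP := real_continuous_fun valc.
case: (j == k.+1).
  apply: (@cvgM R[i]); first by apply: (sqrtC (fun t => 1 - t)) => z;
    apply: (@cvgB R R^o); [exact: cvg_cst|exact: cvg_id].
  apply: (@for_continuous_comp XT G R[i]^o h (fun p => p.1.2)); first exact: hc.
  by apply: (@for_continuous_comp XT _ G snd fst); [exact: cvg_snd|exact: cvg_fst].
apply: (@cvgM R[i]); first by apply: (sqrtC id) => z; exact: cvg_id.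
apply: (@for_continuous_comp XT (join_pow R G k) R[i]^o (join_coord j h)
  (fun p => p.1.1)); first exact: IHk.
by apply: (@for_continuous_comp XT _ _ fst fst); [exact: cvg_fst|exact: cvg_fst].
Qed.

Lemma join_coord_sum k (z : join_pow R G k) :
  \sum_(j < k.+1) join_coord j (fun=> 1) z ^+ 2 = 1.
Proof.
elim: k z => [|k IHk] z; first by rewrite big_ord1 /= expr1n.
elim/join_ind: z => x y t.
have t01 : 0 <= val t <= 1 by have := set_valP t; rewrite /= in_itv.
have [t0 t1] := andP t01.
rewrite big_ord_recr.
rewrite (eq_bigr (fun j : 'I_k.+1 =>
    (val t)%:C * join_coord j (fun=> 1) x ^+ 2)); last first.
  move=> j _; have -> : join_coord (widen_ord (leqnSn k.+1) j) (fun=> 1)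
      (join_pi (x, y, t) : join_pow R G k.+1) =
      (Num.sqrt (val t))%:C * join_coord j (fun=> 1) x.
    by rewrite join_coordS (ltn_eqF (ltn_ord j : (widen_ord (leqnSn k.+1) j < k.+1)%N)).
  by rewrite exprMn -rmorphXn sqr_sqrtr.
have -> : join_coord (@ord_max k.+1) (fun=> 1)
    (join_pi (x, y, t) : join_pow R G k.+1) = (Num.sqrt (1 - val t))%:C.
  by rewrite join_coordS eqxx mulr1.
rewrite -mulr_sumr IHk mulr1 -rmorphXn sqr_sqrtr ?subr_ge0//.
by rewrite /= -rmorphD /= addrC subrK.
Qed.

End JoinTowers.

Section ConstantSequences.
Context {R : realType} {G : topGroupType}.
Context {Y : topologicalType} (cY : compact [set: Y]).
Context (alpha : cstar_action G (cfun R cY)).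

Local Notation A := (cfun R cY).
Local Notation P := (central_class (@cfun_smulC R Y cY)).

Lemma const_class_continuous (u : A) :
  P (const_seq u) \in subalg_pred (Finf_cont alpha).
Proof.
apply/asboolP => g0; apply: squeeze0 (@cstar_act_cont _ _ _ alpha u g0).
  by move=> g; exact: snorm_ge0.
move=> g; rewrite !central_class_act -central_classB.
apply: le_trans (central_class_le _ _) _.
by apply: supn_le => [|k]; [exact: snorm_ge0|exact: lexx].
Qed.

Definition const_class (u : A) : subalg (Finf_cont alpha) :=
  Subalg (const_class_continuous u).

Lemma const_class_linear : linear const_class.
Proof.
move=> c u v; apply: val_inj; rewrite /= -central_classZ -central_classD.
by congr central_class; exact: val_inj.
Qed.

HB.instance Definition _ := GRing.isLinear.Build R[i] A
  (subalg (Finf_cont alpha)) *:%R const_class const_class_linear.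

Lemma const_classM u v : const_class (u ** v) = const_class u ** const_class v.
Proof.
apply: val_inj; rewrite /= -[RHS]central_classM.
by congr central_class; exact: val_inj.
Qed.

Lemma const_class_star u : const_class (star u) = star (const_class u).
Proof.
apply: val_inj; rewrite /= -[RHS]central_class_star.
by congr central_class; exact: val_inj.
Qed.

Lemma const_class_act g u :
  const_class (alpha g u) = Finf_cont_act alpha g (const_class u).
Proof.
apply: val_inj; rewrite -[RHS]/(Finf_act alpha g (P (const_seq u))).
by rewrite central_class_act; congr central_class; exact: val_inj.
Qed.

Lemma const_class_le u : snorm (const_class u) <= snorm u.
Proof.
apply: le_trans (central_class_le _ _) _.
by apply: supn_le => [|k]; [exact: snorm_ge0|exact: lexx].
Qed.

End ConstantSequences.

Section JoinToTowers.
Context {R : realType} {G : topGroupType} (cG : compact [set: G]).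
Context {Y : topologicalType} (cY : compact [set: Y]).
Context (a : continuous_action G Y) (d : nat).
Variable f : Y -> join_pow R G d.
Hypothesis f_cont : continuous f.
Hypothesis f_equiv : forall g y, f (a g y) = gspace_act g (f y).

Local Notation A := (cfun R cY).
Local Notation alpha := (induced_action (R := R) cY a).

Fact pullback_subproof (j : nat) (h : cfun R cG) :
  (fun y => join_coord j h (f y)) \in @continuous_fun_pred R Y.
Proof.
apply/asboolP => y.
apply: (@for_continuous_comp Y (join_pow R G d) R[i]^o (join_coord j h) f).
  by apply: join_coord_continuous; exact: cfun_continuous.
exact: f_cont.
Qed.

Definition coord_pullback j h : A := Cfun cY (pullback_subproof j h).

Definition tower_fun j h : A := coord_pullback j cfun_one ** coord_pullback j h.

Lemma coord_pullback_point j y : exists (w : R) (x : G),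
  0 <= w <= 1 /\ forall h, coord_pullback j h y = w%:C * h x.
Proof.
have [w [x [w01 wE]]] := join_coord_point j (f y).
by exists w, x; split => // h; exact: wE.
Qed.

Lemma tower_fun_point j y : exists (w : R) (x : G),
  0 <= w <= 1 /\ forall h, tower_fun j h y = w%:C * h x.
Proof.
have [w [x [/andP[w0 w1] wE]]] := coord_pullback_point j y.
exists (w * w), x; rewrite mulr_ge0//= mulr_ile1//; split=> // h.
have w1E : coord_pullback j cfun_one y = w%:C by rewrite wE; exact: mulr1.
transitivity (coord_pullback j cfun_one y * coord_pullback j h y : R[i]); first by [].
by rewrite w1E wE rmorphM /= mulrA.
Qed.

Lemma tower_fun_linear j : linear (tower_fun j).
Proof.
move=> c h h'; apply/val_inj/funext => y.
have [w [x [_ wE]]] := tower_fun_point j y.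
rewrite [LHS]wE; transitivity (w%:C * (c * h x + h' x) : R[i]); first by [].
transitivity (c * (w%:C * h x) + w%:C * h' x : R[i]); first by ring.
by rewrite -!wE.
Qed.

HB.instance Definition _ j := GRing.isLinear.Build R[i] (cfun R cG) A *:%R
  (tower_fun j) (tower_fun_linear j).

(** Complete positivity of [tower_fun j] comes from this factorization, since
    [coord_pullback j] can be applied to the entries of a matrix square root. *)
Lemma tower_fun_square j h h' :
  tower_fun j (star h ** h') = star (coord_pullback j h) ** coord_pullback j h'.
Proof.
apply/val_inj/funext => y.
have [w [x [_ wE]]] := coord_pullback_point j y.
have w1E : coord_pullback j cfun_one y = w%:C by rewrite wE; exact: mulr1.
have wcE : (w%:C * h x)^*%C = w%:C * (h x)^*%C :> R[i].
  by apply: etrans (rmorphM _ _ _) _; congr (_ * _); exact: conjc_real.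
transitivity (coord_pullback j cfun_one y * coord_pullback j (star h ** h') y : R[i]).
  by [].
transitivity ((coord_pullback j h y)^*%C * coord_pullback j h' y : R[i]); last by [].
rewrite w1E !wE wcE; transitivity (w%:C * (w%:C * ((h x)^*%C * h' x)) : R[i]).
  by [].
by ring.
Qed.

Lemma tower_fun_act j g h :
  tower_fun j (translation_action cG g h) = alpha g (tower_fun j h).
Proof.
have act h' : coord_pullback j (translation_action cG g h') =
    alpha g (coord_pullback j h').
  apply/val_inj/funext => y; rewrite [RHS]/(join_coord j h' (f (a g^-1%g y))).
  by rewrite f_equiv; exact/esym/join_coord_act.
rewrite /tower_fun act_mul -!act; congr (_ ** _).
by apply/val_inj/funext.
Qed.

Definition tower j : {linear cfun R cG -> subalg (Finf_cont alpha)} :=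
  (const_class alpha \o tower_fun j)%FUN.

Lemma join_to_rokhlin_towers : has_rokhlin_towers cG alpha d.
Proof.
exists (fun j : 'I_d.+1 => tower j); split.
- move=> j; split.
  + move=> n X [Z XZ].
    exists (\matrix_(k, i) const_class alpha (coord_pullback j (Z k i))) => i i'.
    rewrite mxE XZ raddf_sum; apply: eq_bigr => k _.
    by rewrite !mxE -const_class_star -const_classM -tower_fun_square.
  + move=> h; apply: le_trans (const_class_le _ _) _.
    apply: supn_le => [|y]; first exact: snorm_ge0.
    have [w [x [/andP[w0 w1] ->]]] := tower_fun_point j y.
    rewrite normcM normc_real ger0_norm// -[leRHS]mul1r.
    by rewrite ler_pM ?normc_ge0//; exact: le_cfun_norm.
  + move=> h h' _ _ hh'; rewrite -[LHS]const_classM.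
    rewrite (_ : _ ** _ = 0) ?linear0//.
    apply/val_inj/funext => y; have [w [x [_ wE]]] := tower_fun_point j y.
    have hx0 : h x * h' x = 0 :> R[i] := congr1 (fun u : cfun R cG => u x) hh'.
    transitivity (tower_fun j h y * tower_fun j h' y : R[i]); first by [].
    transitivity (w%:C * w%:C * (h x * h' x) : R[i]).
      by rewrite !wE; exact: mulrACA.
    by rewrite hx0 mulr0.
  + by move=> g h; rewrite /= tower_fun_act const_class_act.
- move=> i j _ h h'; rewrite -[LHS]const_classM -[RHS]const_classM.
  by rewrite cfun_smulC.
- have -> : \sum_(j < d.+1) (val (tower j cfun_one) : Finf A) =
      central_class (@cfun_smulC R Y cY) (const_seq cfun_one).
    transitivity (val (\sum_(j < d.+1) tower j cfun_one) : Finf A).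
      by rewrite (big_morph val (fun _ _ => erefl) erefl).
    rewrite -[RHS]/(val (const_class alpha cfun_one)); congr val.
    rewrite -linear_sum; congr const_class.
    apply/val_inj/funext => y; rewrite [LHS](cfun_sumE _ _ y).
    transitivity (1 : R[i]); last by [].
    apply: etrans (join_coord_sum (f y)).
    by apply: eq_bigr => j _; rewrite expr2.
  exact: (central_class_identity (@cfun_smulC R Y cY) (@cfun_smulr1 R Y cY)).
Qed.

End JoinToTowers.

(** * Rokhlin dimension and index *)

Lemma least_nat_pred {R : realType} (P Q : nat -> Prop) :
  ~ Q 0%N -> (forall d, P d <-> Q d.+1) ->
  (least_nat R P = least_nat R Q - 1)%E.
Proof.
move=> Q0 PQ; rewrite /least_nat.
case: pselect => [exP|nP]; case: pselect => [exQ|nQ] //.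
- case: ex_minnP => m /asboolP Pm mmin; case: ex_minnP => k /asboolP Qk kmin.
  have : k = m.+1.
    apply/eqP; rewrite eqn_leq kmin; last exact/asboolP/PQ.
    case: k Qk {kmin} => [//|k] /PQ Pk; rewrite ltnS mmin//; exact/asboolP.
  by move=> ->; rewrite -EFinB -natr1 addrK.
- case: nQ; case: exP => m /asboolP/PQ Qm; exists m.+1; exact/asboolP.
- case: nP; case: exQ => -[/asboolP//|k /asboolP/PQ Pk]; exists k; exact/asboolP.
Qed.

Theorem theorem5p2 (R : realType) (G : topGroupType)
    (cG : compact [set: G]) (lieG : lie_group R G)
    (Y : topologicalType) (cY : compact [set: Y]) (mY : metrizable R Y)
    (a : continuous_action G Y) :
  (dim_rok_c cG (induced_action (R := R) cY a) = ind_G R a - 1)%E.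
Proof.
apply: least_nat_pred => [[]//|d]; split.
  exact: rokhlin_towers_to_join.
by move=> [_ [f [fc fe]]]; exact: join_to_rokhlin_towers fe.
Qed.
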